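(* If an $L$-isothermic immersion $F:M\to\Lambda$ has two Bianchi--Darboux transforms $F^{(1)}$ and $F^{(2)}$, then there is another $L$-isothermic immersion $F^{\ast}$ which is a Bianchi--Darboux transform of $F^{(1)}$ and $F^{(2)}$ and is such that $$F^{\ast}=F^{(1)}\ast_FF^{(2)}=F^{(2)}\ast_FF^{(1)},$$ where $\ast_F$ denotes superposition.
   Context: Minkowski space $\mathbb R^4_1$ has coordinates $u^1,\dots,u^4$ with $\langle u,u\rangle=(u^1)^2+(u^2)^2+(u^3)^2-(u^4)^2$, and also linear coordinates $x^1,\dots,x^4$ with $u^1=(x^1-x^4)/\sqrt2$, $u^2=x^2$, $u^3=x^3$, $u^4=(x^1+x^4)/\sqrt2$, in which $\langle x,x\rangle=-2x^1x^4+(x^2)^2+(x^3)^2$; it is oriented by $dx^1\wedge\dots\wedge dx^4$ and time-oriented by $x^1+x^4>0$. $\mathcal L^+=\{v\neq0:\ -2v^1v^4+(v^2)^2+(v^3)^2=0,\ v^1+v^4>0\}$ in $x$-coordinates. A contact element $(x,n)\in\Lambda=\mathbb R^3\times S^2$ is identified with the null line $\{(x-tn,t):t\in\mathbb R\}$ (in $u$-coordinates). $[a,w]\in\Lambda$ denotes the null line through $a$ with null direction $w$. $L=\mathbb R^4\rtimes SO_0(3,1)$ is the identity component of the isometry group of $\mathbb R^4_1$. An element $A=(a_0,a)\in L$ is viewed as a frame $(a_0;a_1,\dots,a_4)$, where the $a_j$ are the columns of $a$ in $x$-coordinates; thus $\langle a_1,a_4\rangle=-1$, $\langle a_2,a_2\rangle=\langle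 a_3,a_3\rangle=1$ and all other products vanish. For $A:M\to L$ the connection form $\alpha=(\alpha_0,\alpha')=A^{-1}dA$ is given by $da_0=\sum_i\alpha^i_0a_i$, $da_j=\sum_i\alpha^i_ja_i$. A map $F=(f,n)$ from a surface $M$ to $\Lambda$ is Legendre if $df\cdot n=0$. Put $\mathrm{III}=dn\cdot dn$ (assumed positive definite), $\mathrm{II}=-df\cdot dn$. Give $M$ the complex structure determined by $\mathrm{III}$ and the orientation; $F$ is $L$-isothermic if there are a holomorphic quadratic differential $q$ and a smooth real function $\mu$ with $\mathrm{II}^{(2,0)}=\mu q$. A sphere congruence is an immersion $S:M\to\mathbb R^4_1$ (points of $\mathbb R^4_1$ being identified with oriented spheres and points of $\mathbb R^3$). If $S$ is space-like and its normal bundle has null line subbundles spanned by $N_1,N_2$, its two envelopes are $[S,N_1]$ and $[S,N_2]$. $S$ is a Darboux congruence if the resulting correspondence between the two envelopes preserves curvature lines and is conformal with respect to their third fundamental forms. It is nondegenerate if the two envelopes have opposite orientations; what is excluded is the case in which the normals of the two envelopes are Möbius equivalent in $S^2$ (the envelopes are then related by an element of $L$, with the same orientation). Two $L$-isothermic surfaces are Bianchi--Darboux transforms of each other if they are the two envelopes of a nondegenerate Darboux congruence. A curved flat framing is a map $A:M\to L$ with $\alpha^1_0=\alpha^4_0=0$, $\alpha^1_2\wedge\alpha^2_1+\alpha^1_3\wedge\alpha^3_1=0$ and $\alpha^1_2\wedge\alpha^3_1+\alpha^2_1\wedge\alpha^1_3=0$; up to a gauge change it can be chosen so that $\alpha^1_1=0$,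 as is done here. Its first and second envelopes are $[a_0,a_1]$ and $[a_0,a_4]$. A nondegenerate Darboux congruence $S$ defines a curved flat framing with $a_0=S$. Superposition: let $A^{(1)}=(a_0;a_1,\dots,a_4)$ and $A^{(2)}=(b_0;b_1,\dots,b_4)$ be curved flat framings having $F$ as common first envelope and second envelopes $F^{(1)}$ and $F^{(2)}$, respectively, and let $\alpha$ be the connection form of $A^{(1)}$. The framings are related by a gauge change $A^{(2)}=A^{(1)}g(s,v)$, that is, $$b_0=a_0+sa_1,\quad b_1=\tfrac1{v^4}a_1,\quad b_2=a_2+\tfrac{v^2}{v^4}a_1,\quad b_3=a_3+\tfrac{v^3}{v^4}a_1,\quad b_4=v^1a_1+v^2a_2+v^3a_3+v^4a_4,$$ where $v={}^t(v^1,\dots,v^4):M\to\mathcal L^+$ is a solution, for some constant $\lambda\in\mathbb R$, of the integrable linear system $dv=-\alpha'_\lambda v$ with $$\alpha'_\lambda=\begin{pmatrix}0&\lambda\alpha^1_2&\lambda\alpha^1_3&0\\ \alpha^2_1&0&-\alpha^3_2&\lambda\alpha^1_2\\ \alpha^3_1&\alpha^3_2&0&\lambda\alpha^1_3\\ 0&\alpha^2_1&\alpha^3_1&0\end{pmatrix},$$ and $s=r/v^4$ with $dr=v^2\alpha^2_0+v^3\alpha^3_0$. The superposition of $F^{(1)}$ and $F^{(2)}$ is the $L$-isothermic map $$F^{(1)}\ast_FF^{(2)}=\Big[a_0+\tfrac{\lambda r}{v^1}a_4,\ \ \lambda^{-1}v^1a_1+v^2a_2+v^3a_3+\lambda v^4a_4\Big]:M\to\Lambda,$$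 which is the first envelope of a curved flat framing with $a_0+\frac{\lambda r}{v^1}a_4$ as its sphere congruence and $F^{(1)}$ as its second envelope. $F^{(2)}\ast_FF^{(1)}$ is defined in the same way with the roles of $A^{(1)}$ and $A^{(2)}$ exchanged.
   Formalization: The curved flat framings and the gauge relation defining the superposition are given data; it is further assumed that λ and v¹ do not vanish and that the sphere congruences of both superpositions are immersions, without which the superposition is undefined or not a Bianchi–Darboux transform. *)

(* Defs.v *)
From mathcomp Require Import all_boot all_order all_algebra.
From mathcomp Require Import complex.
From mathcomp Require Import all_classical all_reals all_analysis.
Set Implicit Arguments.
Unset Strict Implicit.
Unset Printing Implicit Defensive.
Import Order.TTheory GRing.Theory Num.Theory.
Import numFieldNormedType.Exports.
Local Open Scope classical_set_scope.
Local Open Scope ring_scope.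

(* For k >= 1, a map of class C^k is differentiable on O with directional
   derivatives of class C^(k-1). *)
Fixpoint class_C {R : realType} {V : normedModType R} (k : nat)
    (O : set 'rV[R]_2) (f : 'rV[R]_2 -> V) : Prop :=
  if k is k'.+1 then
    (forall x, O x -> differentiable f x) /\
    (forall w : 'rV[R]_2, class_C k' O (fun x => 'D_w f x))
  else forall x, O x -> {for x, continuous f}.

Definition smooth_on {R : realType} {V : normedModType R}
    (O : set 'rV[R]_2) (f : 'rV[R]_2 -> V) : Prop :=
  forall k, class_C k O f.

(* The total maps [to] and [from] are meaningful on [dom] and [cod] only. *)
Record chart (R : realType) (T : topologicalType) := Chart {
  dom : set T;
  cod : set 'rV[R]_2;
  to : T -> 'rV[R]_2;
  from : 'rV[R]_2 -> T }.

Definition is_chart (R : realType) (T : topologicalType) (c : chart R T) :=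
  [/\ open (dom c) /\ open (cod c),
      forall p, dom c p -> cod c (to c p) /\ from c (to c p) = p,
      forall x, cod c x -> dom c (from c x) /\ to c (from c x) = x,
      forall p, dom c p -> {for p, continuous (to c)} &
      forall x, cod c x -> {for x, continuous (from c)}].

Definition compatible (R : realType) (T : topologicalType) (c c' : chart R T) :=
  let O := to c @` (dom c `&` dom c') in
  let h := to c' \o from c in
  smooth_on O h /\ forall x, O x -> 0 < \det (jacobian h x).

Record orientedSurface (R : realType) := OrientedSurface {
  surface_sort :> topologicalType;
  surface_hausdorff : hausdorff_space surface_sort;
  surface_second_countable : @second_countable surface_sort;
  atlas : set (chart R surface_sort);
  atlas_chart : forall c, atlas c -> is_chart c;
  atlas_cover : forall p, exists2 c, atlas c & dom c p;
  atlas_compatible : forall c c', atlas c -> atlas c' -> compatible c c';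
  atlas_maximal : forall c, is_chart c ->
    (forall c', atlas c' -> compatible c c' /\ compatible c' c) -> atlas c }.

Definition smooth {R : realType} {M : orientedSurface R}
    {V : normedModType R} (g : M -> V) : Prop :=
  forall c, atlas c -> smooth_on (cod c) (g \o from c).

(* dg at p, on the tangent vector whose components in the chart c are w. *)
Definition dmap {R : realType} {M : orientedSurface R}
    {V : normedModType R} (c : chart R M) (g : M -> V) (p : M) (w : 'rV[R]_2)
    : V :=
  'D_w (g \o from c) (to c p).

(* Quantification over the tangent vectors of M. *)
Definition for_all_tangent {R : realType} {M : orientedSurface R}
    (P : chart R M -> M -> 'rV[R]_2 -> Prop) : Prop :=
  forall c p w, atlas c -> dom c p -> P c p w.

(* The coordinate vector fields of a chart. *)
Definition bvec {R : realType} (i : 'I_2) : 'rV[R]_2 := delta_mx 0 i.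

(* (theta /\ eta)(d_1, d_2) *)
Definition wedge {R : realType} (theta eta : 'rV[R]_2 -> R) : R :=
  theta (bvec 0) * eta (bvec 1) - theta (bvec 1) * eta (bvec 0).

Definition immersion {R : realType} {M : orientedSurface R}
    {V : normedModType R} (g : M -> V) : Prop :=
  for_all_tangent (fun c p w => w != 0 -> dmap c g p w != 0).

Notation k1 := (@Ordinal 4 0 isT).
Notation k2 := (@Ordinal 4 1 isT).
Notation k3 := (@Ordinal 4 2 isT).
Notation k4 := (@Ordinal 4 3 isT).

(* Vectors of Minkowski space are given by their x-coordinates. *)
Definition mink {R : realType} (y z : 'cV[R]_4) : R :=
  - (y k1 0 * z k4 0 + y k4 0 * z k1 0) + y k2 0 * z k2 0 + y k3 0 * z k3 0.

Definition lightcone {R : realType} : set 'cV[R]_4 :=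
  [set v | [/\ v != 0, mink v v = 0 & 0 < v k1 0 + v k4 0]].

(* The vector with u-coordinates (y, t). *)
Definition of_u {R : realType} (y : 'cV[R]_3) (t : R) : 'cV[R]_4 :=
  let y1 := y 0 0 in
  \col_i nth 0 [:: (y1 + t) / Num.sqrt 2; y 1 0; y 2%:R 0;
                   (t - y1) / Num.sqrt 2] i.

Definition dot {R : realType} (y z : 'cV[R]_3) : R := \sum_i y i 0 * z i 0.

Record contact (R : realType) := Contact {
  cpoint : 'cV[R]_3;
  cnormal : 'cV[R]_3;
  cnormal_unit : dot cnormal cnormal = 1 }.

Definition null_line {R : realType} (L : contact R) : set 'cV[R]_4 :=
  [set of_u (cpoint L - t *: cnormal L) t | t in setT].

(* L = [a, w] *)
Definition is_contact {R : realType} (L : contact R) (a w : 'cV[R]_4) : Prop :=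
  null_line L = [set a + t *: w | t in setT].

Section Lisothermic.
Context {R : realType} {M : orientedSurface R}.
Implicit Types (F : M -> contact R) (c : chart R M) (p : M).

Definition pointmap F : M -> 'cV[R]_3 := fun p => cpoint (F p).
Definition normalmap F : M -> 'cV[R]_3 := fun p => cnormal (F p).

Definition III F c p (w w' : 'rV[R]_2) : R :=
  dot (dmap c (normalmap F) p w) (dmap c (normalmap F) p w').

Definition II F c p (w w' : 'rV[R]_2) : R :=
  - dot (dmap c (pointmap F) p w) (dmap c (normalmap F) p w').

Definition legendre F : Prop :=
  [/\ smooth (pointmap F), smooth (normalmap F) &
      for_all_tangent (fun c p w => dot (dmap c (pointmap F) p w)
                                        (normalmap F p) = 0)].

(* Implied by III_posdef. *)
Definition contact_immersion F : Prop :=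
  for_all_tangent (fun c p w => w != 0 ->
    ~ (dmap c (pointmap F) p w = 0 /\ dmap c (normalmap F) p w = 0)).

Definition III_posdef F : Prop :=
  for_all_tangent (fun c p w => w != 0 -> 0 < III F c p w w).

Definition complex_of (x : 'rV[R]_2) : R[i] := (x 0 0 +i* x 0 1)%C.
Definition of_complex (z : R[i]) : 'rV[R]_2 :=
  \row_j (if j == 0 then complex.Re z else complex.Im z).

(* The holomorphic charts of the complex structure determined by III and the
   orientation: positively oriented isothermal coordinates of III. *)
Definition holomorphic_chart F c : Prop :=
  atlas c /\ forall p, dom c p ->
    III F c p (bvec 0) (bvec 0) = III F c p (bvec 1) (bvec 1) /\
    III F c p (bvec 0) (bvec 1) = 0.

Definition holomorphic_on (O : set R[i]) (h : R[i] -> R[i]) : Prop :=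
  forall z, O z -> derivable (h : R[i]^o -> R[i]^o) z 1.

(* dz'/dz at p, for z and z' the coordinates of c and c'. *)
Definition transition_deriv c c' p : R[i] :=
  'D_1 ((complex_of \o to c' \o from c \o of_complex) : R[i]^o -> R[i]^o)
    (complex_of (to c p)).

(* q c p is the coefficient of dz^2 at p, for z the coordinate of c. *)
Definition holomorphic_quadratic_differential F (q : chart R M -> M -> R[i])
    : Prop :=
  (forall c, holomorphic_chart F c ->
     holomorphic_on [set z | cod c (of_complex z)]
       (fun z => q c (from c (of_complex z)))) /\
  (forall c c' p, holomorphic_chart F c -> holomorphic_chart F c' ->
     dom c p -> dom c' p -> q c p = q c' p * transition_deriv c c' p ^+ 2).

(* The coefficient II(d_z, d_z) of dz^2 in II, with d_z = (d_1 - i d_2)/2. *)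
Definition II20 F c p : R[i] :=
  ((II F c p (bvec 0) (bvec 0) - II F c p (bvec 1) (bvec 1)) / 4 +i*
   - ((II F c p (bvec 0) (bvec 1) + II F c p (bvec 1) (bvec 0)) / 4))%C.

Definition L_isothermic_immersion F : Prop :=
  [/\ legendre F, contact_immersion F, III_posdef F &
      exists q (mu : M -> R),
        [/\ holomorphic_quadratic_differential F q, smooth mu &
            forall c p, holomorphic_chart F c -> dom c p ->
              II20 F c p = (mu p)%:C%C * q c p]].

End Lisothermic.

Section Darboux.
Context {R : realType} {M : orientedSurface R}.
Implicit Types (F : M -> contact R) (c : chart R M) (p : M).
Implicit Types (S N : M -> 'cV[R]_4).

Definition sphere_congruence S : Prop := smooth S /\ immersion S.

Definition spacelike S : Prop :=
  for_all_tangent (fun c p w => w != 0 ->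
    0 < mink (dmap c S p w) (dmap c S p w)).

Definition null_normal S N : Prop :=
  [/\ smooth N, forall p, N p != 0 /\ mink (N p) (N p) = 0 &
      for_all_tangent (fun c p w => mink (N p) (dmap c S p w) = 0)].

Definition curvature_direction F c p (w : 'rV[R]_2) : Prop :=
  w != 0 /\ exists k : R * R, k != (0, 0) /\
    k.1 *: dmap c (pointmap F) p w + k.2 *: dmap c (normalmap F) p w = 0.

(* At points that are umbilic for neither map this says that the two principal
   directions are the same; at an umbilic point of one of them, where every
   direction is a curvature direction, it imposes nothing. *)
Definition preserves_curvature_lines F1 F2 : Prop :=
  forall c p, atlas c -> dom c p -> exists w1 w2 : 'rV[R]_2,
    [/\ w1 != 0, forall k : R, w2 != k *: w1,
        curvature_direction F1 c p w1 /\ curvature_direction F1 c p w2 &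
        curvature_direction F2 c p w1 /\ curvature_direction F2 c p w2].

Definition III_conformal F1 F2 : Prop :=
  forall c p, atlas c -> dom c p -> exists2 rho : R, 0 < rho &
    forall w w', III F2 c p w w' = rho * III F1 c p w w'.

(* The determinant of the map dN : T_pM -> N^perp / N, where N^perp / N is
   identified with the tangent plane dS(T_pM) and then, by <,>, with the dual
   of T_pM.  Its sign is the orientation that the normal of the envelope
   [S, N] induces on M, relative to the one induced by dS; it does not change
   under N |-> k N with k a nowhere vanishing function. *)
Definition envelope_orientation S N c p : R :=
  \det (\matrix_(i < 2, j < 2)
          mink (dmap c N p (bvec i)) (dmap c S p (bvec j))).

(* The orientations of the two envelopes are compared in the common tangent
   plane dS(T_pM).  If they agree for a Darboux congruence, the shape operators of S along N1 and N2
   are proportional, S lies in a hyperplane of Minkowski space, and the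
   reflection in it exchanges the envelopes: their normals are Moebius
   equivalent. *)
Definition opposite_orientations S N1 N2 : Prop :=
  forall c p, atlas c -> dom c p ->
    envelope_orientation S N1 c p * envelope_orientation S N2 c p < 0.

(* S is a nondegenerate Darboux congruence with envelopes F1 = [S, N1] and
   F2 = [S, N2]. *)
Definition nondegenerate_darboux_congruence S N1 N2 F1 F2 : Prop :=
  [/\ sphere_congruence S /\ spacelike S,
      [/\ null_normal S N1, null_normal S N2 &
          forall p (k : R), N2 p != k *: N1 p],
      forall p, is_contact (F1 p) (S p) (N1 p) /\ is_contact (F2 p) (S p) (N2 p),
      preserves_curvature_lines F1 F2 /\ III_conformal F1 F2 &
      opposite_orientations S N1 N2].

Definition bianchi_darboux_transforms F1 F2 : Prop :=
  [/\ L_isothermic_immersion F1, L_isothermic_immersion F2 &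
      exists S N1 N2, nondegenerate_darboux_congruence S N1 N2 F1 F2].

End Darboux.

(* SO_0(3,1), acting on x-coordinates *)
Definition SO0 {R : realType} : set 'M[R]_4 :=
  connected_component
    [set g | forall y z : 'cV[R]_4, mink (g *m y) (g *m z) = mink y z] 1%:M.

(* A map M -> R^4 x| SO_0(3,1), A = (a_0, a); the condition on a is in
   is_framing. *)
Record framing (R : realType) (M : orientedSurface R) := Framing {
  fpoint : M -> 'cV[R]_4;
  fmat : M -> 'M[R]_4 }.

Section Framings.
Context {R : realType} {M : orientedSurface R}.
Implicit Types (A B : framing M) (F G : M -> contact R) (c : chart R M) (p : M).

Definition is_framing A : Prop :=
  [/\ smooth (fpoint A), smooth (fmat A) & forall p, SO0 (fmat A p)].

Definition fvec A (j : 'I_4) p : 'cV[R]_4 := col j (fmat A p).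

Definition alpha0 A c p (w : 'rV[R]_2) : 'cV[R]_4 :=
  invmx (fmat A p) *m dmap c (fpoint A) p w.

Definition alpha' A c p (w : 'rV[R]_2) : 'M[R]_4 :=
  invmx (fmat A p) *m dmap c (fmat A) p w.

Definition curved_flat A : Prop :=
  [/\ is_framing A,
      for_all_tangent (fun c p w =>
        alpha0 A c p w k1 0 = 0 /\ alpha0 A c p w k4 0 = 0),
      for_all_tangent (fun c p w => alpha' A c p w k1 k1 = 0) &
      forall c p, atlas c -> dom c p ->
        let al i j := fun w => alpha' A c p w i j in
        wedge (al k1 k2) (al k2 k1) + wedge (al k1 k3) (al k3 k1) = 0 /\
        wedge (al k1 k2) (al k3 k1) + wedge (al k2 k1) (al k1 k3) = 0].

Definition first_envelope A F : Prop :=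
  forall p, is_contact (F p) (fpoint A p) (fvec A k1 p).

Definition second_envelope A F : Prop :=
  forall p, is_contact (F p) (fpoint A p) (fvec A k4 p).

Definition alpha'_lam (lam : R) (al : 'M[R]_4) : 'M[R]_4 :=
  \matrix_(i < 4, j < 4) nth 0 (nth [::]
    [:: [:: 0;        lam * al k1 k2; lam * al k1 k3; 0             ];
        [:: al k2 k1; 0;              - al k3 k2;     lam * al k1 k2];
        [:: al k3 k1; al k3 k2;       0;              lam * al k1 k3];
        [:: 0;        al k2 k1;       al k3 k1;       0             ]] i) j.

(* B = A g(r / v^4, v), with v a solution of dv = - alpha'_lam v *)
Definition gauge_related A B (lam : R) (v : M -> 'cV[R]_4) (r : M -> R)
    : Prop :=
  [/\ smooth v /\ smooth r,
      forall p, lightcone (v p),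
      for_all_tangent (fun c p w =>
        dmap c v p w = - (alpha'_lam lam (alpha' A c p w) *m v p)),
      for_all_tangent (fun c p w =>
        dmap c r p w = v p k2 0 * alpha0 A c p w k2 0 +
                       v p k3 0 * alpha0 A c p w k3 0) &
      forall p,
        let a j := fvec A j p in
        let vp j := v p j 0 in
        [/\ fpoint B p = fpoint A p + (r p / vp k4) *: a k1,
            fvec B k1 p = (vp k4)^-1 *: a k1,
            fvec B k2 p = a k2 + (vp k2 / vp k4) *: a k1,
            fvec B k3 p = a k3 + (vp k3 / vp k4) *: a k1 &
            fvec B k4 p = \sum_j vp j *: a j]].

Definition superposition_congruence A (lam : R) (v : M -> 'cV[R]_4)
    (r : M -> R) : M -> 'cV[R]_4 :=
  fun p => fpoint A p + (lam * r p / v p k1 0) *: fvec A k4 p.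

Definition superposition_direction A (lam : R) (v : M -> 'cV[R]_4)
    : M -> 'cV[R]_4 :=
  fun p => (lam^-1 * v p k1 0) *: fvec A k1 p + v p k2 0 *: fvec A k2 p +
           v p k3 0 *: fvec A k3 p + (lam * v p k4 0) *: fvec A k4 p.

(* G is the superposition F^(1) *_F F^(2), where F is the common first envelope
   of A and B, and F^(1), F^(2) are their second envelopes.  The conditions
   lam != 0, v^1 != 0 and sphere_congruence make the superposition defined. *)
Definition is_superposition A B G : Prop :=
  exists (lam : R) (v : M -> 'cV[R]_4) (r : M -> R),
    [/\ gauge_related A B lam v r, lam != 0, forall p, v p k1 0 != 0,
        sphere_congruence (superposition_congruence A lam v r) &
        forall p, is_contact (G p) (superposition_congruence A lam v r p)
                                   (superposition_direction A lam v p)].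

End Framings.

(* Main.v *)
(* Let S be a space-like surface with null normals N1, N2 such that <N1,N2> = -1 and
   <dN1,N2> = 0.  In the tangent planes, identified with the complex line, write x, y, z
   for the 1-forms dS, dN1, dN2.  The curved flat condition is conj y /\ z = 0, that is,
   z = k conj y, while the symmetry of the shape operators gives x = r1 y + r2 z with r1, r2
   real.  Hence the envelopes [S,N1] and [S,N2] are conformal with opposite orientations and
   share their curvature directions.  By the Codazzi equations the (2,0)-part q of <dN1,dN2>
   is holomorphic for the complex structure of y, and II^(2,0) of [S,N1] is
   (r2 / (time component of N1)) q, so that [S,N1] is L-isothermic.

   For a curved flat framing (a_0; a_1, ..., a_4) and a solution v of the linear system, the
   superposition congruence S, its direction D and (lambda/v^1) a_4 form such a null frame:
   dD = (1/lambda - 1) v^1 (alpha^2_1 e_2 + alpha^3_1 e_3) and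
   d((lambda/v^1) a_4) = (lambda/v^1) (alpha^1_2 e_2 + alpha^1_3 e_3), where
   e_j = a_j + (lambda v^j/v^1) a_4.  The gauge change from the second framing back to the
   first one is that of lambda' = lambda/(lambda - 1), v' = (v^1, -v^2/v^4, -v^3/v^4, 1/v^4) and
   r' = -r/v^4, and its superposition is the same null line; lambda = 1 is excluded, since it
   would make the second envelope of the second framing have a constant normal. *)

Require Import Defs.
From mathcomp Require Import all_boot all_order all_algebra.
From mathcomp Require Import complex ring lra.
From mathcomp Require Import all_classical all_reals all_analysis.
Set Implicit Arguments.
Unset Strict Implicit.
Unset Printing Implicit Defensive.
Import Order.TTheory GRing.Theory Num.Theory.
Import numFieldNormedType.Exports.
Local Open Scope classical_set_scope.
Local Open Scope ring_scope.

(** * Smooth maps on a surface *)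

(** The notion of null frame carries all demands on the superposition at once. It applies because dv
    = - alpha'_lambda v cancels, in the derivative of the direction, every term except those in
    alpha^2_1 and alpha^3_1, while the derivative of a multiple of a_4 only involves alpha^1_2 and
    alpha^1_3; the curved flat equations of the framing are thus merely multiplied by a function.
    What a null frame does not provide is the injectivity of dN1 and dN2. It comes from the third
    fundamental forms: a tangent vector annihilated by alpha^2_1 and alpha^3_1 makes a_1 stationary,
    against positivity for F, and one annihilated by alpha^1_2 and alpha^1_3 makes a_4 stationary,
    against positivity for F1. The factor 1/lambda - 1 is nonzero by positivity for F2. The relation
    with F2 is the relation with F1 for the reversed gauge change. Its constant is forced: the
    second framing has alpha^1_j multiplied by (1 - lambda) v^4, and v'^1 = v^1 then requires
    lambda' (1 - lambda) = - lambda. *)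

Section Derive.
Context {R : realType} {U V : normedModType R}.
Implicit Types (x w : U).

(** The differential of [f] is also a first order approximation of [g], and such an approximation is
    unique. *)
Lemma near_eq_differentiable (f g : U -> V) x :
  (\forall y \near x, f y = g y) -> differentiable f x -> differentiable g x.
Proof.
move=> fg df.
have ex : f x = g x by exact: nbhs_singleton fg.
have h : g \o shift x = cst (g x) + 'd f x +o_ 0 id.
  have/diff_locallyP[_ /eqaddoP h] := df.
  apply/eqaddoP => e e0.
  have fg0 : \forall y \near 0, f (y + x) = g (y + x).
    have sx : (y + x) @[y --> (0 : U)] --> x.
      by rewrite -[X in _ --> X]add0r; apply: cvgD; [exact: cvg_id|exact: cvg_cst].
    exact: sx fg.
  near=> y.
  have -> : (g \o shift x - (cst (g x) + 'd f x)) y =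
            (f \o shift x - (cst (f x) + 'd f x)) y.
    by rewrite !fctE /= /shift ex; congr (_ - _); near: y; apply: filterS fg0.
  by near: y; exact: h.
apply/diff_locallyP.
suff -> : 'd g x = 'd f x :> (U -> V) by split => //; exact: diff_continuous.
apply: diff_unique h; exact: diff_continuous.
Unshelve. all: by end_near. Qed.

Lemma derive_add (f g : U -> V) x w : differentiable f x -> differentiable g x ->
  'D_w (fun y => f y + g y) x = 'D_w f x + 'D_w g x.
Proof. by move=> df dg; apply: deriveD; exact: diff_derivable. Qed.

Lemma derive_opp (f : U -> V) x w : differentiable f x ->
  'D_w (fun y => - f y) x = - 'D_w f x.
Proof. by move=> df; apply: deriveN; exact: diff_derivable. Qed.

Lemma derive_mul (f g : U -> R) x w : differentiable f x -> differentiable g x ->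
  'D_w (fun y => f y * g y) x = 'D_w f x * g x + f x * 'D_w g x.
Proof.
move=> df dg.
have fw : derivable f x w by exact: diff_derivable.
have gw : derivable g x w by exact: diff_derivable.
by rewrite (deriveM fw gw) addrC; congr (_ + _); exact: mulrC.
Qed.

Lemma derive_inv (f : U -> R) x w : differentiable f x -> f x != 0 ->
  'D_w (fun y => (f y)^-1) x = - ((f x)^-1 * (f x)^-1 * 'D_w f x).
Proof.
move=> df f0; rewrite deriveV //; last exact: diff_derivable.
by rewrite scaleNr -exprVn expr2.
Qed.

Lemma derive_entry {m n} (f : U -> 'M[R]_(m, n)) x w i j : differentiable f x ->
  'D_w f x i j = 'D_w (fun y => f y i j) x.
Proof. by move=> df; rewrite derive_mx ?mxE //; exact: diff_derivable. Qed.

Lemma differentiable_entry {m n} (f : U -> 'M[R]_(m, n)) x i j :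
  differentiable f x -> differentiable (fun y => f y i j) x.
Proof.
move=> df; apply: (differentiable_comp (g := fun A : 'M[R]_(m, n) => A i j)) => //.
exact: differentiable_coord.
Qed.

Lemma differentiable_mx {m n} (f : U -> 'M[R]_(m, n)) x :
  (forall i j, differentiable (fun y => f y i j) x) -> differentiable f x.
Proof.
move=> df.
have -> : f = \sum_i \sum_j (fun y => f y i j *: delta_mx i j).
  apply/funext => y; rewrite {1}[f y]matrix_sum_delta fct_sumE.
  by apply: eq_bigr => i _; rewrite fct_sumE.
apply: differentiable_sum => i; apply: differentiable_sum => j.
exact: differentiableZl.
Qed.

End Derive.

Section ClassC.
Context {R : realType} (O : set 'rV[R]_2).
Hypothesis openO : open O.
Implicit Types (k : nat).

(** Openness of [O] turns equality on [O] into equality near each point, which passes to all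
    derivatives. *)
Lemma eq_class_C {V : normedModType R} k (f g : 'rV[R]_2 -> V) :
  (forall x, O x -> f x = g x) -> class_C k O f -> class_C k O g.
Proof.
have nearO (h h' : 'rV[R]_2 -> V) : (forall x, O x -> h x = h' x) ->
    forall x, O x -> \forall y \near x, h y = h' y.
  by move=> hh' x Ox; apply: filterS hh' _; exact: open_nbhs_nbhs.
elim: k f g => [|k IH] f g fg /=.
  move=> cf x Ox; rewrite /prop_for /continuous_at -(fg x Ox).
  exact: cvg_trans (near_eq_cvg (nearO _ _ fg x Ox)) (cf x Ox).
move=> [df cf]; split=> [x Ox|w].
  by apply: near_eq_differentiable (df x Ox); exact: nearO.
by apply: IH (cf w) => x Ox; apply: near_eq_derive; exact: nearO.
Qed.

Lemma class_CS {V : normedModType R} k (f : 'rV[R]_2 -> V) :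
  class_C k.+1 O f -> class_C k O f.
Proof.
elim: k f => [|k IH] f /= [df cf]; first by move=> x /df /differentiable_continuous.
by split=> // w; exact: IH (cf w).
Qed.

Lemma class_C_cst {V : normedModType R} k (a : V) : class_C k O (fun=> a).
Proof.
elim: k a => [|k IH] a /=; first by move=> x _; exact: cst_continuous.
split=> [x _|w]; first exact: differentiable_cst.
by apply: eq_class_C (IH 0) => x _; rewrite derive_cst.
Qed.

Lemma class_CD {V : normedModType R} k (f g : 'rV[R]_2 -> V) :
  class_C k O f -> class_C k O g -> class_C k O (fun x => f x + g x).
Proof.
elim: k f g => [|k IH] f g /=; first by move=> cf cg x Ox; exact: cvgD (cf x Ox) (cg x Ox).
move=> [df cf] [dg cg]; split=> [x Ox|w]; first exact: differentiableD (df x Ox) (dg x Ox).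
by apply: eq_class_C (IH _ _ (cf w) (cg w)) => x Ox; rewrite (derive_add w (df x Ox) (dg x Ox)).
Qed.

Lemma class_CN {V : normedModType R} k (f : 'rV[R]_2 -> V) :
  class_C k O f -> class_C k O (fun x => - f x).
Proof.
elim: k f => [|k IH] f /=; first by move=> cf x Ox; exact: cvgN (cf x Ox).
move=> [df cf]; split=> [x Ox|w]; first exact: differentiableN (df x Ox).
by apply: eq_class_C (IH _ (cf w)) => x Ox; rewrite (derive_opp w (df x Ox)).
Qed.

(** The product rule puts [f] and [g] beside their derivatives, so the induction lowers their class
    with [class_CS]. *)
Lemma class_CM k (f g : 'rV[R]_2 -> R) :
  class_C k O f -> class_C k O g -> class_C k O (fun x => f x * g x).
Proof.
elim: k f g => [|k IH] f g; first by move=> cf cg x Ox; exact: cvgM (cf x Ox) (cg x Ox).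
move=> Cf Cg; have [df cf] := Cf; have [dg cg] := Cg.
split=> [x Ox|w]; first exact: differentiableM (df x Ox) (dg x Ox).
apply: eq_class_C (class_CD (IH _ _ (cf w) (class_CS Cg))
                            (IH _ _ (class_CS Cf) (cg w))) => x Ox.
by rewrite (derive_mul w (df x Ox) (dg x Ox)).
Qed.

Lemma class_CV k (f : 'rV[R]_2 -> R) : (forall x, O x -> f x != 0) ->
  class_C k O f -> class_C k O (fun x => (f x)^-1).
Proof.
move=> f0; elim: k => [|k IH]; first by move=> cf x Ox; exact: cvgV (f0 x Ox) (cf x Ox).
move=> Cf; have [df cf] := Cf; have iC := IH (class_CS Cf).
split=> [x Ox|w]; first exact: differentiableV (df x Ox) (f0 x Ox).
apply: eq_class_C (class_CN (class_CM (class_CM iC iC) (cf w))) => x Ox.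
by rewrite (derive_inv w (df x Ox) (f0 x Ox)).
Qed.

Lemma class_C_entry {m n} k (f : 'rV[R]_2 -> 'M[R]_(m, n)) i j :
  class_C k O f -> class_C k O (fun x => f x i j).
Proof.
elim: k f => [|k IH] f /=.
  move=> cf x Ox.
  have cA : {for f x, continuous (fun A : 'M[R]_(m, n) => A i j)}.
    by apply: differentiable_continuous; exact: differentiable_coord.
  exact: cvg_comp (cf x Ox) cA.
move=> [df cf]; split=> [x Ox|w]; first exact: differentiable_entry (df x Ox).
by apply: eq_class_C (IH _ (cf w)) => x Ox; rewrite (derive_entry w i j (df x Ox)).
Qed.

Lemma class_C_mx {m n} k (f : 'rV[R]_2 -> 'M[R]_(m, n)) :
  (forall i j, class_C k O (fun x => f x i j)) -> class_C k O f.
Proof.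
elim: k f => [|k IH] f /= cf.
  move=> x Ox; apply/(proj2 (@cvgrPdist_lt _ _ _ (nbhs x) (nbhs_filter x) _ _)) => e e0.
  have h : forall i j, \forall y \near x, `|f x i j - f y i j| < e.
    move=> i j.
    exact: (proj1 (@cvgrPdist_lt _ _ _ (nbhs x) (nbhs_filter x) _ _) (cf i j x Ox)).
  have {}h : \forall y \near x, forall ij : 'I_m * 'I_n,
      `|f x ij.1 ij.2 - f y ij.1 ij.2| < e.
    exact: (filter_forall (nbhs_filter x) (fun ij => h ij.1 ij.2)).
  apply: (@filterS _ _ (nbhs_filter x)) h => y h; rewrite /Num.Def.normr/= mx_normrE.
  by apply: bigmax_lt => // -[i j] _; rewrite !mxE; exact: (h (i, j)).
split=> [x Ox|w]; first by apply: differentiable_mx => i j; exact: (cf i j).1.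
apply: IH => i j; have [_ /(_ w)] := cf i j; apply: eq_class_C => x Ox.
rewrite derive_entry //; apply: differentiable_mx => i' j'.
exact: (cf i' j').1.
Qed.

End ClassC.

(** * Symmetry of second derivatives *)

Section Schwarz.
Context {R : realType}.
Implicit Types (f : 'rV[R]_2 -> R) (x u v w : 'rV[R]_2).

Lemma is_derive_line f x w (s : R) : differentiable f (x + s *: w) ->
  is_derive s 1 (fun t : R => f (x + t *: w)) ('D_w f (x + s *: w)).
Proof.
move=> df.
have dl : is_diff s (fun t : R => x + t *: w) (fun t : R => t *: w).
  have d1 : is_diff s ( *:%R ^~ w : R -> _) ( *:%R ^~ w) by exact: is_diff_scalel.
  have d0 : is_diff s (cst x : R -> _) 0 by exact: is_diff_cst.
  by have := is_diffD d0 d1; rewrite add0r.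
have dfl : differentiable (f \o (fun t : R => x + t *: w)) s.
  by apply: differentiable_comp => //; exact: ex_diff.
apply: DeriveDef; first exact: diff_derivable.
rewrite (@deriveE _ _ _ (f \o (fun t : R => x + t *: w))) // diff_comp //.
by rewrite /= diff_val scale1r -deriveE.
Qed.

Lemma line_MVT f x w (h : R) : 0 < h ->
  (forall s, 0 <= s <= h -> differentiable f (x + s *: w)) ->
  exists2 s, 0 <= s <= h & f (x + h *: w) - f x = 'D_w f (x + s *: w) * h.
Proof.
move=> h0 df; pose g (t : R) := f (x + t *: w).
have dg s : 0 <= s <= h -> is_derive s 1 g ('D_w f (x + s *: w)).
  by move=> /df; exact: is_derive_line.
have [s sh e] : exists2 s, s \in `]0, h[%R & g h - g 0 = 'D_w f (x + s *: w) * (h - 0).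
  apply: (@MVT _ _ (fun s => 'D_w f (x + s *: w))) => //.
    by move=> s; rewrite in_itv /= => /andP[a b]; apply: dg; rewrite !ltW.
  apply: derivable_within_continuous => s; rewrite in_itv /= => sh.
  by have [] := dg s sh.
exists s; first by move: sh; rewrite in_itv /= => /andP[a b]; rewrite !ltW.
by move: e; rewrite /g scale0r addr0 subr0.
Qed.

(** The mean value theorem is used twice: along [u] for the increment [g] of [f] in the direction
    [v], then along [v] for ['D_u f]. *)
Lemma second_difference f x u v (h : R) : 0 < h ->
  (forall s t, 0 <= s <= h -> 0 <= t <= h ->
     differentiable f (x + s *: u + t *: v) /\
     differentiable ('D_u f) (x + s *: u + t *: v)) ->
  exists s t, [/\ 0 <= s <= h, 0 <= t <= h &
    f (x + h *: u + h *: v) - f (x + h *: u) - f (x + h *: v) + f x =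
    'D_v ('D_u f) (x + s *: u + t *: v) * h * h].
Proof.
move=> h0 df.
have h00 : (0 : R) <= 0 <= h by rewrite lexx ltW.
have hh : 0 <= h <= h by rewrite lexx ltW.
pose g y := f (y + h *: v) - f y.
have dv y : differentiable f (y + h *: v) ->
    is_diff y (fun z => f (z + h *: v)) ('d f (y + h *: v)).
  move=> dfy.
  have d1 : is_diff y (fun z => z + h *: v) id.
    have d0 : is_diff y (cst (h *: v) : 'rV[R]_2 -> _) 0 by exact: is_diff_cst.
    by have := is_diffD (is_diff_id y) d0; rewrite addr0.
  have d2 : is_diff (y + h *: v) f ('d f (y + h *: v)) by exact: differentiableP.
  exact: (is_diff_comp d1 d2).
have dg s : 0 <= s <= h -> is_diff (x + s *: u) g
    (('d f (x + s *: u + h *: v) : 'rV[R]_2 -> R) - ('d f (x + s *: u) : 'rV[R]_2 -> R)).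
  move=> sh; apply: is_diffB; first by apply: dv; exact: (df s h sh hh).1.
  by apply: differentiableP; have := (df s 0 sh h00).1; rewrite scale0r addr0.
have [s sh e] : exists2 s, 0 <= s <= h & g (x + h *: u) - g x = 'D_u g (x + s *: u) * h.
  by apply: (@line_MVT g x u h h0) => s /dg ds; exact: (@ex_diff _ _ _ _ _ _ _ ds).
have es : 'D_u g (x + s *: u) =
    'D_u f (x + s *: u + h *: v) - 'D_u f (x + s *: u).
  have dgs := dg s sh.
  have d1 : differentiable f (x + s *: u + h *: v) by exact: (df s h sh hh).1.
  have d2 : differentiable f (x + s *: u).
    by have := (df s 0 sh h00).1; rewrite scale0r addr0.
  apply: etrans (deriveE u (@ex_diff _ _ _ _ _ _ _ dgs)) _.
  apply: etrans (congr1 (fun l => l u) (@diff_val _ _ _ _ _ _ _ dgs)) _.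
  by congr (_ - _); apply/esym; exact: deriveE.
have [t th et] : exists2 t, 0 <= t <= h &
   'D_u f (x + s *: u + h *: v) - 'D_u f (x + s *: u) =
   'D_v ('D_u f) (x + s *: u + t *: v) * h.
  by apply: (@line_MVT ('D_u f) (x + s *: u) v h h0) => t th; exact: (df s t sh th).2.
exists s, t; split => //.
rewrite -et -es -e /g (addrAC x) opprB; ring.
Qed.

Lemma close_close (a b c e : R) : `|a - c| < e / 2 -> `|b - c| < e / 2 -> `|a - b| <= e.
Proof.
rewrite (distrC b) => h1 h2; apply: le_trans (ler_distD c _ _) _; lra.
Qed.

Lemma near_close (O : set 'rV[R]_2) (a b : 'rV[R]_2 -> R) x (e : R) :
  open O -> O x -> 0 < e -> {for x, continuous a} -> {for x, continuous b} ->
  \forall y \near x, [/\ O y, `|a x - a y| < e & `|b x - b y| < e].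
Proof.
move=> openO Ox e0 ca cb.
have h1 : nbhs x O by exact: open_nbhs_nbhs.
have h2 := proj1 (@cvgrPdist_lt _ _ _ (nbhs x) (nbhs_filter x) _ _) ca _ e0.
have h3 := proj1 (@cvgrPdist_lt _ _ _ (nbhs x) (nbhs_filter x) _ _) cb _ e0.
have : nbhs x (O `&` ([set y | `|a x - a y| < e] `&` [set y | `|b x - b y| < e])).
  exact: filterI h1 (filterI h2 h3).
by apply: filterS => y [Oy [hy hy']].
Qed.

(** The second difference is symmetric in [u] and [v], so the two mixed derivatives take a common
    value at two points of an arbitrarily small parallelogram at [x]; continuity carries this to
    [x]. *)
Lemma derive_comm (O : set 'rV[R]_2) f u v x : open O -> class_C 2 O f -> O x ->
  'D_u ('D_v f) x = 'D_v ('D_u f) x.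
Proof.
move=> openO [df cf] Ox.
have cuv a b : {for x, continuous ('D_a ('D_b f))} by apply: ((cf b).2 a).
have dfb b y : O y -> differentiable ('D_b f) y by exact: (cf b).1.
apply/eqP; rewrite -subr_eq0 -normr_le0; apply/ler_addgt0Pr => e e0; rewrite add0r.
have e2 : 0 < e / 2 by rewrite divr_gt0.
have near_x : \forall y \near x, [/\ O y, `|'D_u ('D_v f) x - 'D_u ('D_v f) y| < e / 2
    & `|'D_v ('D_u f) x - 'D_v ('D_u f) y| < e / 2].
  exact: near_close openO Ox e2 (cuv u v) (cuv v u).
have [d d0 hd] : exists2 d, 0 < d & forall s t, 0 <= s <= d -> 0 <= t <= d ->
   [/\ O (x + s *: u + t *: v),
    `|'D_u ('D_v f) x - 'D_u ('D_v f) (x + s *: u + t *: v)| < e / 2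
    & `|'D_v ('D_u f) x - 'D_v ('D_u f) (x + s *: u + t *: v)| < e / 2].
  move/nbhs_ballP : near_x => [r /= r0 hr].
  pose c := 1 + `|u| + `|v|.
  have c0 : 0 < c by rewrite /c -addrA ltr_pwDl// addr_ge0.
  (* Since [c] exceeds |u| + |v|, all points of the parallelogram with parameters up to [r / c / 2]
     are within [r] of [x]; the summand 1 keeps [c] positive when [u] and [v] vanish. *)
  exists (r / c / 2); first by rewrite !divr_gt0.
  move=> s t /andP[s0 sd] /andP[t0 td]; apply: hr.
  rewrite -ball_normE /ball_ /= -addrA opprD addrA subrr sub0r normrN.
  apply: le_lt_trans (ler_normD _ _) _; rewrite !normrZ !ger0_norm //.
  have hs : s * `|u| <= r / c / 2 * `|u| by rewrite ler_wpM2r.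
  have ht : t * `|v| <= r / c / 2 * `|v| by rewrite ler_wpM2r.
  apply: le_lt_trans (lerD hs ht) _; rewrite -mulrDr.
  have -> : r / c / 2 * (`|u| + `|v|) = r * ((`|u| + `|v|) / (2 * c)).
    by rewrite invfM; ring.
  rewrite -[X in _ < X]mulr1 ltr_pM2l // ltr_pdivrMr ?mulr_gt0 // mul1r.
  have := normr_ge0 u; have := normr_ge0 v; rewrite /c; lra.
have [s [t [sd td E1]]] : exists s t, [/\ 0 <= s <= d, 0 <= t <= d &
    f (x + d *: u + d *: v) - f (x + d *: u) - f (x + d *: v) + f x =
    'D_v ('D_u f) (x + s *: u + t *: v) * d * d].
  apply: second_difference => // s t sd td.
  by have [Oy _ _] := hd s t sd td; split; [exact: df|exact: dfb].
have [s' [t' [sd' td' E2]]] : exists s t, [/\ 0 <= s <= d, 0 <= t <= d &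
    f (x + d *: v + d *: u) - f (x + d *: v) - f (x + d *: u) + f x =
    'D_u ('D_v f) (x + s *: v + t *: u) * d * d].
  apply: second_difference => // s' t' sd' td'; rewrite addrAC.
  by have [Oy _ _] := hd t' s' td' sd'; split; [exact: df|exact: dfb].
have {E2}E : 'D_u ('D_v f) (x + t' *: u + s' *: v) = 'D_v ('D_u f) (x + s *: u + t *: v).
  apply: (mulIf (lt0r_neq0 d0)); apply: (mulIf (lt0r_neq0 d0)).
  apply: etrans E1; apply: etrans; last apply: (etrans (esym E2)).
    exact: (congr1 (fun y => 'D_u ('D_v f) y * d * d) (addrAC _ _ _)).
  by rewrite (addrAC x (d *: v)); ring.
have [_ h1 _] := hd t' s' td' sd'; have [_ _ h2] := hd s t sd td.
rewrite E in h1; exact: close_close h1 h2.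
Qed.

End Schwarz.

Lemma is_derive_cvg (K : numFieldType) (V W : normedModType K) (f : V -> W) a v l :
  (fun h => h^-1 *: ((f \o shift a) (h *: v) - f a)) @ 0^' --> l -> is_derive a v f l.
Proof. by move=> H; apply: DeriveDef; [apply/cvg_ex; exists l|exact: cvg_lim H]. Qed.

(** * Complex differentiability from the Cauchy-Riemann equations *)

Section CauchyRiemann.
Context {R : realType}.
Implicit Types (h : 'rV[R]_2 -> 'rV[R]_2) (x : 'rV[R]_2) (z : R[i]).
Local Open Scope complex_scope.

Lemma complex_ofK : cancel (@complex_of R) of_complex.
Proof.
move=> x; apply/rowP => j; rewrite mxE; case: (eqVneq j 0) => [->|] //=.
by case: j => [[|[]]] //= ? _; congr (x _ _); exact: val_inj.
Qed.

Lemma of_complexK : cancel (@of_complex R) complex_of.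
Proof. by case=> a b; rewrite /complex_of !mxE. Qed.

Lemma norm_complex_of x : `|complex_of x| <= (2 * `|x|)%:C.
Proof.
rewrite normc_def lecR /=.
have le_n i j : `|x i j| <= `|x|.
  rewrite [in X in _ <= X]/Num.Def.normr/= mx_normrE.
  by apply/bigmax_geP; right; exists (i, j).
rewrite -(@ler_pXn2r _ 2) ?nnegrE ?sqrtr_ge0 ?mulr_ge0 //.
rewrite sqr_sqrtr ?addr_ge0 ?sqr_ge0 //.
have sq i j : x i j ^+ 2 <= `|x| ^+ 2.
  by rewrite -real_normK ?num_real // ler_pXn2r ?nnegrE.
have := sq 0 0; have := sq 0 1; have := sqr_ge0 `|x|; nra.
Qed.

Lemma norm_of_complex z : (`|of_complex z|)%:C <= `|z|.
Proof.
rewrite normc_def lecR [in X in X <= _]/Num.Def.normr/= mx_normrE.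
apply: bigmax_le; first exact: sqrtr_ge0.
move=> [i j] _; rewrite mxE; case: ifP => _.
  by rewrite -sqrtr_sqr ler_sqrt ?addr_ge0 ?sqr_ge0 // lerDl sqr_ge0.
by rewrite -sqrtr_sqr ler_sqrt ?addr_ge0 ?sqr_ge0 // lerDr sqr_ge0.
Qed.

Lemma diff_close h x (e : R) : differentiable h x -> 0 < e -> exists2 d : R, 0 < d &
  forall k, `|k| < d -> `|h (k + x) - (h x + 'd h x k)| <= e * `|k|.
Proof.
move=> /diff_locallyP[_ /eqaddoP hx] e0.
have /nbhs_ballP [d /= d0 hd] := hx e e0.
exists d => // k kd; apply: hd; by rewrite -ball_normE /ball_ /= sub0r normrN.
Qed.

(** The Cauchy-Riemann equations make the real differential the multiplication by [complex_of d0],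
    so the first order error of [h], divided by [k], is the error of the complex difference
    quotient. *)
Lemma CauchyRiemann_derive h x (d0 d1 : 'rV[R]_2) : differentiable h x ->
  'D_(bvec 0) h x = d0 -> 'D_(bvec 1) h x = d1 ->
  d1 0 0 = - d0 0 1 -> d1 0 1 = d0 0 0 ->
  is_derive (complex_of x : R[i]^o) (1 : R[i]^o)
    (complex_of \o h \o of_complex : R[i]^o -> R[i]^o) (complex_of d0).
Proof.
move=> dh e0 e1 CR0 CR1.
have dE k : complex_of ('d h x k) = complex_of d0 * complex_of k.
  have -> : k = k 0 0 *: bvec 0 + k 0 1 *: bvec 1.
    rewrite [LHS]row_sum_delta !big_ord_recl big_ord0 addr0.
    by congr (_ + _ *: bvec _); first congr (k _ _); exact: val_inj.
  rewrite linearD !linearZ.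
  have -> : 'd h x (bvec 0) = d0 by rewrite -e0; apply/esym; exact: deriveE.
  have -> : 'd h x (bvec 1) = d1 by rewrite -e1; apply/esym; exact: deriveE.
  rewrite /complex_of /bvec !mxE /= CR0 CR1.
  apply/eqP; rewrite eq_complex /=; apply/andP; split; apply/eqP; ring.
apply: is_derive_cvg; apply/cvgrPdist_le => -[e ei] /=; rewrite ltcE /= => /andP[/eqP -> {ei} ep].
(* Half of [e], because [norm_complex_of] costs a factor 2. *)
have [d dp hd] := diff_close dh (divr_gt0 ep (ltr0Sn _ 1)).
have dC : 0 < (d%:C : R[i]) by rewrite ltcR.
near=> k.
have k0 : k != 0 by near: k; rewrite -[nbhs _]/(dnbhs _); exact: withinT.
have kd : `|k| < d%:C by near: k; exact: (@dnbhs0_lt _ R[i]^o).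
rewrite /shift /= complex_ofK.
have kE : k *: (1 : R[i]^o) = k by rewrite /GRing.scale /= mulr1.
rewrite kE.
have hk : `|of_complex k| < d.
  by rewrite -ltcR; apply: le_lt_trans kd; exact: norm_of_complex.
have := hd _ hk.
have -> : of_complex (k + complex_of x) = of_complex k + x.
  by apply: (can_inj complex_ofK); rewrite of_complexK; case: (k) => a b; rewrite /complex_of !mxE.
set err := _ - _ => herr.
have -> : complex_of d0 - k^-1 *: (complex_of (h (of_complex k + x)) - complex_of (h x)) =
   - (k^-1 * complex_of err).
  have -> : complex_of err = complex_of (h (of_complex k + x)) - complex_of (h x) - complex_of d0 * k.
    rewrite -[X in _ * X]of_complexK -dE /complex_of /err !mxE.
    by apply/eqP; rewrite eq_complex /=; apply/andP; split; apply/eqP; ring.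
  by rewrite mulrBr mulrCA mulVf // mulr1 opprB /GRing.scale /=.
rewrite normrN normrM normfV ler_pdivrMl ?normr_gt0 //.
apply: le_trans (norm_complex_of _) _.
have H2 : (2 * `|err|) <= `|of_complex k| * e.
  by move: herr; rewrite mulrAC ler_pdivlMr // mulrC (mulrC e).
apply: le_trans (_ : ((`|of_complex k| * e)%:C <= _)); first by rewrite lecR.
rewrite rmorphM /= ler_wpM2r //; last exact: norm_of_complex.
by rewrite lecR ltW.
Unshelve. all: by end_near. Qed.

End CauchyRiemann.

(** * Minkowski space and contact elements *)

Section Minkowski.
Context {R : realType}.
Implicit Types (u w a : 'cV[R]_4) (y z : 'cV[R]_3).

Lemma forall_ord4 (P : 'I_4 -> Prop) : P k1 -> P k2 -> P k3 -> P k4 -> forall i, P i.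
Proof.
move=> h1 h2 h3 h4 [[|[|[|[|//]]]] H].
- by rewrite (_ : Ordinal H = k1) //; exact: val_inj.
- by rewrite (_ : Ordinal H = k2) //; exact: val_inj.
- by rewrite (_ : Ordinal H = k3) //; exact: val_inj.
- by rewrite (_ : Ordinal H = k4) //; exact: val_inj.
Qed.

Lemma sum_ord4 (V : nmodType) (f : 'I_4 -> V) :
  \sum_i f i = f k1 + f k2 + f k3 + f k4.
Proof.
rewrite !big_ord_recl big_ord0 addr0 !addrA.
by do !congr (_ + _); congr f; exact: val_inj.
Qed.

Lemma forall_ord3 (P : 'I_3 -> Prop) : P 0 -> P 1 -> P 2%:R -> forall i, P i.
Proof.
move=> h1 h2 h3 [[|[|[|//]]] H].
- by rewrite (_ : Ordinal H = 0) //; exact: val_inj.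
- by rewrite (_ : Ordinal H = 1) //; exact: val_inj.
- by rewrite (_ : Ordinal H = 2%:R) //; exact: val_inj.
Qed.

Lemma sum_ord3 (V : nmodType) (f : 'I_3 -> V) : \sum_i f i = f 0 + f 1 + f 2%:R.
Proof.
rewrite !big_ord_recl big_ord0 addr0 !addrA.
by do !congr (_ + _); congr f; exact: val_inj.
Qed.

Lemma minkC u w : mink u w = mink w u.
Proof. by rewrite /mink; ring. Qed.

Lemma minkDl u u' w : mink (u + u') w = mink u w + mink u' w.
Proof. by rewrite /mink !mxE; ring. Qed.

Lemma minkDr u w w' : mink u (w + w') = mink u w + mink u w'.
Proof. by rewrite /mink !mxE; ring. Qed.

Lemma minkZl (c : R) u w : mink (c *: u) w = c * mink u w.
Proof. by rewrite /mink !mxE; ring. Qed.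

Lemma minkZr (c : R) u w : mink u (c *: w) = c * mink u w.
Proof. by rewrite /mink !mxE; ring. Qed.

Lemma mink0l u : mink 0 u = 0.
Proof. by rewrite /mink !mxE; ring. Qed.

Lemma mink0r u : mink u 0 = 0.
Proof. by rewrite minkC mink0l. Qed.

(** The space part (u^1, u^2, u^3) in u-coordinates; [tau] below is the time coordinate u^4. *)
Definition sp u : 'cV[R]_3 :=
  \col_i nth 0 [:: (u k1 0 - u k4 0) / Num.sqrt 2; u k2 0; u k3 0] i.

Definition tau u : R := (u k1 0 + u k4 0) / Num.sqrt 2.

Lemma spD u w : sp (u + w) = sp u + sp w.
Proof. by apply/colP; elim/forall_ord3; rewrite !mxE /=; ring. Qed.

Lemma spZ (c : R) u : sp (c *: u) = c *: sp u.
Proof. by apply/colP; elim/forall_ord3; rewrite !mxE /=; ring. Qed.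

Lemma tauD u w : tau (u + w) = tau u + tau w.
Proof. by rewrite /tau !mxE; ring. Qed.

Lemma tauZ (c : R) u : tau (c *: u) = c * tau u.
Proof. by rewrite /tau !mxE; ring. Qed.

Lemma div_sqrt2 (c : R) : c / Num.sqrt 2 / Num.sqrt 2 = c / 2.
Proof. by rewrite -mulrA -invfM -expr2 sqr_sqrtr. Qed.

Lemma sp_of_u y (t : R) : sp (of_u y t) = y.
Proof.
apply/colP; elim/forall_ord3; rewrite !mxE /= ?mxE //= -mulrBl div_sqrt2; by field.
Qed.

Lemma tau_of_u y (t : R) : tau (of_u y t) = t.
Proof. by rewrite /tau !mxE /= -mulrDl div_sqrt2; field. Qed.

Lemma of_u_sp_tau u : of_u (sp u) (tau u) = u.
Proof.
apply/colP; elim/forall_ord4; rewrite /tau !mxE /= ?mxE //=.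
  by rewrite -mulrDl div_sqrt2; field.
by rewrite -mulrBl div_sqrt2; field.
Qed.

Lemma eq_sp_tau u w : sp u = sp w -> tau u = tau w -> u = w.
Proof. by move=> e1 e2; rewrite -(of_u_sp_tau u) e1 e2 of_u_sp_tau. Qed.

Lemma mink_sp_tau u w : mink u w = dot (sp u) (sp w) - tau u * tau w.
Proof.
rewrite /mink /dot sum_ord3 /tau !mxE /=.
set i := (Num.sqrt 2)^-1; have ii : i * i = 2^-1.
  by rewrite /i -[2^-1]mul1r -div_sqrt2 mul1r.
transitivity (((u k1 0 - u k4 0) * (w k1 0 - w k4 0) -
   (u k1 0 + u k4 0) * (w k1 0 + w k4 0)) * (i * i) + u k2 0 * w k2 0 + u k3 0 * w k3 0).
  by rewrite ii; field.
ring.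
Qed.

Lemma dot_eq0 y : dot y y = 0 -> y = 0.
Proof.
move=> /eqP; rewrite psumr_eq0; last by move=> i _; rewrite -expr2 sqr_ge0.
move=> /allP h; apply/colP => i; rewrite mxE.
by have := h i (mem_index_enum _); rewrite /= mulf_eq0 orbb => /eqP.
Qed.

(** At time component 0 the form is the Euclidean square of the space part. *)
Lemma null_tau_eq0 u : mink u u = 0 -> tau u = 0 -> u = 0.
Proof.
rewrite mink_sp_tau => + t0; rewrite t0 mulr0 subr0 => /dot_eq0 s0.
by apply: eq_sp_tau; rewrite ?s0 ?t0 /tau ?mxE ?addr0 ?mul0r //; apply/colP; elim/forall_ord3; rewrite !mxE /= ?subrr ?mul0r.
Qed.

(** The points of the null line at times 0 and 1 are x and x - n, which determine x and n.
    Conversely the parameter [(t - tau a) / tau w] gives the point at time [t] of the line through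
    [a]. *)
Lemma is_contactP (L : contact R) a w : is_contact L a w <->
  [/\ tau w != 0, cnormal L = - (tau w)^-1 *: sp w &
      Defs.cpoint L = sp a + tau a *: cnormal L].
Proof.
split=> [h|[w0 nE pE]].
  have [t0 _ e0] : [set a + t *: w | t in setT] (of_u (Defs.cpoint L - 0 *: cnormal L) 0).
    by rewrite -h; exists 0.
  have [t1 _ e1] : [set a + t *: w | t in setT] (of_u (Defs.cpoint L - 1 *: cnormal L) 1).
    by rewrite -h; exists 1.
  have := congr1 tau e0; have := congr1 tau e1; have := congr1 sp e0; have := congr1 sp e1.
  rewrite !sp_of_u !tau_of_u !spD !tauD !spZ !tauZ scale1r scale0r subr0.
  move=> s1 s0 T1 T0.
  have Ts : (t1 - t0) * tau w = 1 by rewrite -T1 -[RHS]subr0 -{1}T0; ring.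
  have w0 : tau w != 0 by apply: contraTneq (oner_neq0 R) => z; rewrite -Ts z mulr0 eqxx.
  have iw : (tau w)^-1 = t1 - t0 by rewrite -[LHS]mul1r -Ts mulfK.
  have nE : cnormal L = - (tau w)^-1 *: sp w.
    rewrite iw; have -> : cnormal L = Defs.cpoint L - (Defs.cpoint L - cnormal L) by rewrite opprB addrC subrK.
    by rewrite -s1 -s0 opprD addrACA subrr add0r -scalerBl opprB.
  split=> //; rewrite nE -s0; congr (_ + _).
  rewrite scalerA; congr (_ *: _).
  have := T0 => /eqP; rewrite addr_eq0 => /eqP ->; by rewrite mulrNN mulfK.
have key t : of_u (Defs.cpoint L - t *: cnormal L) t = a + ((t - tau a) / tau w) *: w.
  apply: eq_sp_tau; rewrite ?sp_of_u ?tau_of_u ?spD ?tauD ?spZ ?tauZ; last first.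
    by rewrite divfK // addrC subrK.
  rewrite pE -addrA -scalerBl nE scalerA; congr (_ + _ *: _); ring.
apply/seteqP; split=> u [t _ <-].
  by exists ((t - tau a) / tau w) => //; rewrite key.
exists (tau a + t * tau w) => //; rewrite key; congr (_ + _ *: _).
by rewrite addrAC subrr add0r mulfK.
Qed.

Lemma unit_sp w : mink w w = 0 -> tau w != 0 ->
  dot (- (tau w)^-1 *: sp w) (- (tau w)^-1 *: sp w) = 1.
Proof.
rewrite mink_sp_tau => /eqP; rewrite subr_eq0 => /eqP h w0.
have -> : dot (- (tau w)^-1 *: sp w) (- (tau w)^-1 *: sp w) =
   (tau w)^-1 ^+ 2 * dot (sp w) (sp w) by rewrite /dot !sum_ord3 !mxE; ring.
by rewrite h -expr2 -exprMn mulVf // expr1n.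
Qed.

Definition contact_of a w (w0 : mink w w = 0) (tw : tau w != 0) : contact R :=
  Contact (sp a + tau a *: (- (tau w)^-1 *: sp w)) (unit_sp w0 tw).

Lemma contact_ofP a w (w0 : mink w w = 0) (tw : tau w != 0) :
  is_contact (contact_of a w0 tw) a w.
Proof. by apply/is_contactP. Qed.

Lemma is_contact_change (L : contact R) a w a' w' (t k : R) : k != 0 ->
  w' = k *: w -> a' = a + t *: w -> is_contact L a w -> is_contact L a' w'.
Proof.
move=> k0 -> -> /is_contactP[w0 nE pE]; apply/is_contactP; rewrite tauZ spZ.
split; first by rewrite mulf_neq0.
  rewrite nE scalerA; congr (_ *: _); field; exact/andP.
rewrite pE spD tauD spZ tauZ scalerDl -!addrA; congr (_ + _).
rewrite addrCA -[LHS]addr0; congr (_ + _).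
rewrite nE scalerA -scalerDl -[LHS](scale0r (sp w)); congr (_ *: _); field; exact: w0.
Qed.

Lemma mink_nondeg u : (forall w, mink u w = 0) -> u = 0.
Proof.
move=> h; have E i := h (delta_mx i 0).
apply/colP; elim/forall_ord4; rewrite mxE.
- by have := E k4; rewrite /mink !mxE /= ; lra.
- by have := E k2; rewrite /mink !mxE /= ; lra.
- by have := E k3; rewrite /mink !mxE /= ; lra.
- by have := E k1; rewrite /mink !mxE /= ; lra.
Qed.

Lemma SO0_isometry (g : 'M[R]_4) : SO0 g ->
  forall y z : 'cV[R]_4, mink (g *m y) (g *m z) = mink y z.
Proof. by move=> /connected_component_sub. Qed.

(** A vector killed by [g] is orthogonal to everything, hence zero. *)
Lemma isometry_unit (g : 'M[R]_4) :
  (forall y z : 'cV[R]_4, mink (g *m y) (g *m z) = mink y z) -> g \in unitmx.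
Proof.
move=> iso; rewrite -unitmx_tr -row_free_unit -kermx_eq0; apply/eqP/row_matrixP => i.
rewrite row0; set k := row i _.
have kg : g *m k^T = 0.
  by apply: (can_inj trmxK); rewrite trmx_mul trmxK trmx0 -row_mul mulmx_ker row0.
apply: (can_inj trmxK); rewrite trmx0; apply: mink_nondeg => w.
by rewrite -iso kg mink0l.
Qed.

End Minkowski.

(** * Calculus of smooth maps in charts and on the surface *)

Section SmoothOn.
Context {R : realType} (O : set 'rV[R]_2).
Hypothesis openO : open O.

Lemma eq_smooth_on {V : normedModType R} (f g : 'rV[R]_2 -> V) :
  (forall x, O x -> f x = g x) -> smooth_on O f -> smooth_on O g.
Proof. by move=> fg sf k; apply: eq_class_C fg (sf k). Qed.

Lemma smooth_on_derive {V : normedModType R} (f : 'rV[R]_2 -> V) w :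
  smooth_on O f -> smooth_on O ('D_w f).
Proof. by move=> sf k; have [_] := sf k.+1; exact. Qed.

Lemma smooth_on_differentiable {V : normedModType R} (f : 'rV[R]_2 -> V) x :
  smooth_on O f -> O x -> differentiable f x.
Proof. by move=> /(_ 1%N)[+ _]; exact. Qed.

Lemma smooth_onM (f g : 'rV[R]_2 -> R) :
  smooth_on O f -> smooth_on O g -> smooth_on O (fun x => f x * g x).
Proof. by move=> sf sg k; apply: class_CM. Qed.

Lemma smooth_onD {V : normedModType R} (f g : 'rV[R]_2 -> V) :
  smooth_on O f -> smooth_on O g -> smooth_on O (fun x => f x + g x).
Proof. by move=> sf sg k; apply: class_CD. Qed.

Lemma smooth_onN {V : normedModType R} (f : 'rV[R]_2 -> V) :
  smooth_on O f -> smooth_on O (fun x => - f x).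
Proof. by move=> sf k; apply: class_CN. Qed.

Lemma smooth_onV (f : 'rV[R]_2 -> R) : (forall x, O x -> f x != 0) ->
  smooth_on O f -> smooth_on O (fun x => (f x)^-1).
Proof. by move=> f0 sf k; apply: class_CV. Qed.

Lemma smooth_on_cst {V : normedModType R} (a : V) : smooth_on O (fun=> a).
Proof. by move=> k; apply: class_C_cst. Qed.

Lemma smooth_on_entry {m n} (f : 'rV[R]_2 -> 'M[R]_(m, n)) i j :
  smooth_on O f -> smooth_on O (fun x => f x i j).
Proof. by move=> sf k; apply: class_C_entry. Qed.

Lemma smooth_on_mx {m n} (f : 'rV[R]_2 -> 'M[R]_(m, n)) :
  (forall i j, smooth_on O (fun x => f x i j)) -> smooth_on O f.
Proof. by move=> sf k; apply: class_C_mx => // i j; exact: sf. Qed.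

End SmoothOn.

Section Surface.
Context {R : realType} {M : orientedSurface R}.
Implicit Types (c : chart R M) (p : M) (w : 'rV[R]_2).

Lemma open_cod c : atlas c -> open (cod c).
Proof. by case/atlas_chart => -[]. Qed.

Lemma to_cod c p : atlas c -> dom c p -> cod c (to c p).
Proof. by case/atlas_chart => _ h _ _ _ /h[]. Qed.

Lemma from_to c p : atlas c -> dom c p -> from c (to c p) = p.
Proof. by case/atlas_chart => _ h _ _ _ /h[]. Qed.

Lemma from_dom c x : atlas c -> cod c x -> dom c (from c x).
Proof. by case/atlas_chart => _ _ h _ _ /h[]. Qed.

Lemma to_from c x : atlas c -> cod c x -> to c (from c x) = x.
Proof. by case/atlas_chart => _ _ h _ _ /h[]. Qed.

Lemma dmap_from {V : normedModType R} (f : M -> V) c x w : atlas c -> cod c x ->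
  dmap c f (from c x) w = 'D_w (f \o from c) x.
Proof. by move=> ac cx; rewrite /dmap to_from. Qed.

Section Rules.
Variables (V : normedModType R).
Implicit Types (f g : M -> V) (a b : M -> R).

Lemma smooth_cst (v : V) : smooth (fun _ : M => v).
Proof. by move=> c ac; apply: smooth_on_cst; exact: open_cod. Qed.

Lemma smoothD f g : smooth f -> smooth g -> smooth (fun p => f p + g p).
Proof. by move=> sf sg c ac; apply: (smooth_onD (open_cod ac) (sf c ac) (sg c ac)). Qed.

Lemma smoothN f : smooth f -> smooth (fun p => - f p).
Proof. by move=> sf c ac; apply: (smooth_onN (open_cod ac) (sf c ac)). Qed.

Lemma smoothM a b : smooth a -> smooth b -> smooth (fun p => a p * b p).
Proof. by move=> sf sg c ac; apply: (smooth_onM (open_cod ac) (sf c ac) (sg c ac)). Qed.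

Lemma smoothV a : (forall p, a p != 0) -> smooth a -> smooth (fun p => (a p)^-1).
Proof.
move=> a0 sa c ac.
by apply: (@smooth_onV _ _ (open_cod ac) _ _ (sa c ac)) => x _; exact: a0.
Qed.

Lemma smooth_entry {m n} (f : M -> 'M[R]_(m, n)) i j :
  smooth f -> smooth (fun p => f p i j).
Proof. by move=> sf c ac; apply: (smooth_on_entry (open_cod ac) i j (sf c ac)). Qed.

Lemma smooth_mx {m n} (f : M -> 'M[R]_(m, n)) :
  (forall i j, smooth (fun p => f p i j)) -> smooth f.
Proof.
by move=> sf c ac; apply: (smooth_on_mx (open_cod ac)) => i j; exact: (sf i j c ac).
Qed.

Lemma smooth_differentiable f c p : smooth f -> atlas c -> dom c p ->
  differentiable (f \o from c) (to c p).
Proof.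
move=> sf ac cp.
exact: (smooth_on_differentiable (sf c ac) (to_cod ac cp)).
Qed.

Variables (c : chart R M) (p : M).
Hypotheses (ac : atlas c) (cp : dom c p).

Lemma dmap_cst (v : V) w : dmap c (fun _ : M => v) p w = 0.
Proof. exact: derive_cst. Qed.

Lemma dmapD f g w : smooth f -> smooth g ->
  dmap c (fun q => f q + g q) p w = dmap c f p w + dmap c g p w.
Proof.
move=> sf sg; exact: (@derive_add _ _ _ (f \o from c) (g \o from c) _ w
  (smooth_differentiable sf ac cp) (smooth_differentiable sg ac cp)).
Qed.

Lemma dmapN f w : smooth f -> dmap c (fun q => - f q) p w = - dmap c f p w.
Proof.
move=> sf; exact: (@derive_opp _ _ _ (f \o from c) _ w (smooth_differentiable sf ac cp)).
Qed.

Lemma dmap_entry {m n} (f : M -> 'M[R]_(m, n)) w i j : smooth f ->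
  dmap c f p w i j = dmap c (fun q => f q i j) p w.
Proof.
move=> sf; apply: (@derive_entry _ _ _ _ (f \o from c) _ w i j).
exact: (smooth_on_differentiable (sf c ac) (to_cod ac cp)).
Qed.

Lemma dmap_linear f w w' (k : R) : smooth f ->
  dmap c f p (k *: w + w') = k *: dmap c f p w + dmap c f p w'.
Proof.
move=> sf; have df := smooth_differentiable sf ac cp.
have E u : dmap c f p u = 'd (f \o from c) (to c p) u by exact: deriveE.
by rewrite !E linearP.
Qed.

End Rules.

Section ScalarRules.
Variables (c : chart R M) (p : M).
Hypotheses (ac : atlas c) (cp : dom c p).
Implicit Types (a b : M -> R).

Lemma dmapM a b w : smooth a -> smooth b ->
  dmap c (fun q => a q * b q) p w = dmap c a p w * b p + a p * dmap c b p w.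
Proof.
(* The undifferentiated factors are written as coordinate expressions at [to c p]. *)
move=> sa sb; rewrite -{3 4}(from_to ac cp).
exact: (@derive_mul _ _ (a \o from c) (b \o from c) _ w
  (smooth_differentiable sa ac cp) (smooth_differentiable sb ac cp)).
Qed.

Lemma dmapV a w : (forall q, a q != 0) -> smooth a ->
  dmap c (fun q => (a q)^-1) p w = - ((a p)^-1 * (a p)^-1 * dmap c a p w).
Proof.
move=> a0 sa; rewrite -{2 3}(from_to ac cp).
exact: (@derive_inv _ _ (a \o from c) _ w (smooth_differentiable sa ac cp) (a0 _)).
Qed.

End ScalarRules.

(** The expression of [f] in [c] is the one in [c'] composed with the transition map only near
    [to c p], where [from c] stays in [dom c']; a derivative sees no more than that. *)
Lemma dmap_chain {V : normedModType R} (f : M -> V) c c' p w :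
  smooth f -> atlas c -> atlas c' -> dom c p -> dom c' p ->
  dmap c f p w = dmap c' f p ('D_w (to c' \o from c) (to c p)).
Proof.
move=> sf ac ac' cp c'p; pose h := to c' \o from c; pose x := to c p.
have [so _] := atlas_compatible ac ac'.
have dh : differentiable h x.
  by apply: (smooth_on_differentiable so); exists p.
have hx : h x = to c' p by rewrite /h /x /= from_to.
have df : differentiable (f \o from c') (h x).
  by rewrite hx; exact: smooth_differentiable.
have eqf : \forall y \near x, ((f \o from c') \o h) y = (f \o from c) y.
  have [[_ _] _ _ _ cf] := atlas_chart ac.
  have [[od _] _ _ _ _] := atlas_chart ac'.
  have n1 : nbhs x (from c @^-1` dom c').
    apply: (cf x (to_cod ac cp)); rewrite /x from_to //.
    exact: open_nbhs_nbhs.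
  by apply: filterS n1 => y /= dy; rewrite /h /= from_to.
apply: etrans (_ : 'D_w ((f \o from c') \o h) x = _).
  by apply: near_eq_derive; apply: filterS eqf => y ->.
have dfh : differentiable ((f \o from c') \o h) x by exact: differentiable_comp.
apply: etrans (deriveE w dfh) _.
apply: etrans (congr1 (fun l => l w) (diff_comp dh df)) _.
rewrite /=; apply: etrans (esym (deriveE _ df)) _; rewrite hx /dmap.
by congr ('D_ _ _ _); apply/esym; exact: deriveE.
Qed.

End Surface.

(** * Product rules for vector-valued maps *)

Section VectorRules.
Context {R : realType}.

Lemma derive_mink {U : normedModType R} (f g : U -> 'cV[R]_4) x w :
  differentiable f x -> differentiable g x ->
  'D_w (fun y => mink (f y) (g y)) x = mink ('D_w f x) (g x) + mink (f x) ('D_w g x).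
Proof.
move=> df dg; rewrite /mink !derive_entry //.
have dm i j : differentiable (fun y => f y i 0 * g y j 0) x.
  by apply: differentiableM; exact: differentiable_entry.
have eM i j : 'D_w (fun y => f y i 0 * g y j 0) x =
    'D_w (fun y => f y i 0) x * g x j 0 + f x i 0 * 'D_w (fun y => g y j 0) x.
  by apply: derive_mul; exact: differentiable_entry.
have d12 := differentiableN (differentiableD (dm k1 k4) (dm k4 k1)).
have d3 := differentiableD d12 (dm k2 k2).
apply: etrans (derive_add w d3 (dm k3 k3)) _; rewrite eM.
apply: etrans (congr1 (fun t => t + _) (derive_add w d12 (dm k2 k2))) _; rewrite eM.
apply: etrans (congr1 (fun t => t + _ + _) (derive_opp w (differentiableD (dm k1 k4) (dm k4 k1)))) _.
apply: etrans (congr1 (fun t => - t + _ + _) (derive_add w (dm k1 k4) (dm k4 k1))) _.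
rewrite !eM; ring.
Qed.

Lemma smooth_on_mink (O : set 'rV[R]_2) (f g : 'rV[R]_2 -> 'cV[R]_4) : open O ->
  smooth_on O f -> smooth_on O g -> smooth_on O (fun x => mink (f x) (g x)).
Proof.
move=> oO sf sg.
have sm i j : smooth_on O (fun y => f y i 0 * g y j 0).
  by apply: (smooth_onM oO); apply: smooth_on_entry.
have s1 := smooth_onN oO (smooth_onD oO (sm k1 k4) (sm k4 k1)).
exact: (smooth_onD oO (smooth_onD oO s1 (sm k2 k2)) (sm k3 k3)).
Qed.

Lemma derive_comm_mx {m n} (O : set 'rV[R]_2) (f : 'rV[R]_2 -> 'M[R]_(m, n)) u v x :
  open O -> smooth_on O f -> O x -> 'D_u ('D_v f) x = 'D_v ('D_u f) x.
Proof.
move=> oO sf Ox; apply/matrixP => i j.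
have dd w : differentiable ('D_w f) x.
  exact: (smooth_on_differentiable (smooth_on_derive w sf) Ox).
have eq_entry a b : 'D_a (fun y => 'D_b f y i j) x = 'D_a ('D_b (fun y => f y i j)) x.
  apply: near_eq_derive; near=> y; apply: derive_entry.
  by apply: (smooth_on_differentiable sf); near: y; exact: open_nbhs_nbhs.
apply: etrans (derive_entry u i j (dd v)) _.
apply: etrans (eq_entry u v) _.
apply: etrans (derive_comm u v oO (smooth_on_entry oO i j sf 2%N) Ox) _.
apply: etrans (esym (eq_entry v u)) _.
exact: (esym (derive_entry v i j (dd u))).
Unshelve. all: by end_near. Qed.

Context {M : orientedSurface R}.
Implicit Types (c : chart R M) (p : M) (f g : M -> 'cV[R]_4) (a : M -> R).

Lemma smoothZ {m n} a (f : M -> 'M[R]_(m, n)) :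
  smooth a -> smooth f -> smooth (fun p => a p *: f p).
Proof.
move=> sa sf; apply: smooth_mx => i j.
have -> : (fun p => (a p *: f p) i j) = (fun p => a p * f p i j).
  by apply/funext => p; rewrite mxE.
by apply: smoothM => //; exact: smooth_entry.
Qed.

Lemma smooth_tau f : smooth f -> smooth (fun p => tau (f p)).
Proof.
move=> sf; apply: smoothM; last exact: smooth_cst.
by apply: smoothD; exact: smooth_entry.
Qed.

Lemma smooth_sp f : smooth f -> smooth (fun p => sp (f p)).
Proof.
move=> sf; apply: smooth_mx => i j.
have -> : (fun p => sp (f p) i j) = (fun p => nth 0 [:: (f p k1 0 - f p k4 0) / Num.sqrt 2; f p k2 0; f p k3 0] i).
  by apply/funext => p; rewrite mxE.
elim/forall_ord3: i => /=; try exact: smooth_entry.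
apply: smoothM; last exact: smooth_cst.
by apply: smoothD; [|apply: smoothN]; exact: smooth_entry.
Qed.

Variables (c : chart R M) (p : M).
Hypotheses (ac : atlas c) (cp : dom c p).

Lemma dmap_mink f g w : smooth f -> smooth g ->
  dmap c (fun q => mink (f q) (g q)) p w = mink (dmap c f p w) (g p) + mink (f p) (dmap c g p w).
Proof.
move=> sf sg; rewrite -{3 4}(from_to ac cp).
exact: (@derive_mink _ (f \o from c) (g \o from c) _ w
  (smooth_differentiable sf ac cp) (smooth_differentiable sg ac cp)).
Qed.

Lemma dmapZ {m n} a (f : M -> 'M[R]_(m, n)) w : smooth a -> smooth f ->
  dmap c (fun q => a q *: f q) p w = dmap c a p w *: f p + a p *: dmap c f p w.
Proof.
move=> sa sf; apply/matrixP => i j.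
rewrite (dmap_entry ac cp w i j (smoothZ sa sf)) !mxE (dmap_entry ac cp w i j sf).
apply: etrans (dmapM ac cp w sa (smooth_entry i j sf)).
have -> : (fun q => (a q *: f q) i j) = (fun q => a q * f q i j) by apply/funext => q; rewrite mxE.
by [].
Qed.

Lemma dmap_col {m n} (f : M -> 'M[R]_(m, n)) w j : smooth f ->
  dmap c (fun q => col j (f q)) p w = col j (dmap c f p w).
Proof.
move=> sf; apply/matrixP => i k.
have sc : smooth (fun q => col j (f q)).
  apply: smooth_mx => i' k'.
  have -> : (fun q => col j (f q) i' k') = (fun q => f q i' j) by apply/funext => q; rewrite mxE.
  exact: smooth_entry.
rewrite (dmap_entry ac cp w i k sc) [RHS]mxE (dmap_entry ac cp w i j sf).
have -> : (fun q => col j (f q) i k) = (fun q => f q i j) by apply/funext => q; rewrite mxE.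
by [].
Qed.

Lemma dmap_tau f w : smooth f -> dmap c (fun q => tau (f q)) p w = tau (dmap c f p w).
Proof.
move=> sf.
rewrite (dmapM ac cp w (smoothD (smooth_entry k1 0 sf) (smooth_entry k4 0 sf)) (smooth_cst _)).
rewrite dmap_cst mulr0 addr0 (dmapD ac cp w (smooth_entry k1 0 sf) (smooth_entry k4 0 sf)).
by rewrite -!(dmap_entry ac cp).
Qed.

Lemma dmap_sp f w : smooth f -> dmap c (fun q => sp (f q)) p w = sp (dmap c f p w).
Proof.
move=> sf; apply/matrixP => i j; rewrite (ord1 j).
rewrite (dmap_entry ac cp w i 0 (smooth_sp sf)) [RHS]mxE.
rewrite (_ : (fun q => sp (f q) i 0) = (fun q => nth 0 [:: (f q k1 0 - f q k4 0) / Num.sqrt 2; f q k2 0; f q k3 0] i)); last first.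
  by apply/funext => q; rewrite mxE.
elim/forall_ord3: i => /=; rewrite ?(dmap_entry ac cp) //.
rewrite (dmapM ac cp w (smoothD (smooth_entry k1 0 sf) (smoothN (smooth_entry k4 0 sf))) (smooth_cst _)).
rewrite dmap_cst mulr0 addr0 (dmapD ac cp w (smooth_entry k1 0 sf) (smoothN (smooth_entry k4 0 sf))).
by rewrite (dmapN ac cp w (smooth_entry k4 0 sf)).
Qed.

End VectorRules.

(** * The curved flat condition as linear algebra in the plane *)

Section PlaneAlgebra.
Context {R : realType}.
Variables y02 y03 y12 y13 z02 z03 z12 z13 : R.
(* In complex notation [y = y2 + i y3], [z = z2 + i z3] the next two hypotheses
   say that the 2-form [conj y /\ z] vanishes, that is, [z = k * conj y]. *)
Hypothesis flat1 : z02 * y12 - z12 * y02 + (z03 * y13 - z13 * y03) = 0.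
Hypothesis flat2 : z02 * y13 - z12 * y03 + (y02 * z13 - y12 * z03) = 0.
Hypothesis dy : y02 * y13 - y03 * y12 != 0.
Hypothesis dz : z02 * z13 - z03 * z12 != 0.

Lemma plane_y0_gt0 : 0 < y02 ^+ 2 + y03 ^+ 2.
Proof.
rewrite lt_def addr_ge0 ?sqr_ge0 // andbT; apply: contra_neq dy => /eqP.
by rewrite paddr_eq0 ?sqr_ge0 // !sqrf_eq0 => /andP[/eqP -> /eqP ->]; ring.
Qed.

Lemma plane_z0_gt0 : 0 < z02 ^+ 2 + z03 ^+ 2.
Proof.
rewrite lt_def addr_ge0 ?sqr_ge0 // andbT; apply: contra_neq dz => /eqP.
by rewrite paddr_eq0 ?sqr_ge0 // !sqrf_eq0 => /andP[/eqP -> /eqP ->]; ring.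
Qed.

(** In [y02], [y13] and the like the first index is the coordinate vector field and the second the
    frame vector. Conjugation reverses orientation: z = k conj y gives det z = - |k|^2 det y, proved
    here with the denominator |y_0|^2 cleared. *)
Lemma plane_orientation :
  (y02 * y13 - y03 * y12) * (z02 * z13 - z03 * z12) < 0.
Proof.
have E : (y02 ^+ 2 + y03 ^+ 2) * (z02 * z13 - z03 * z12) =
     - (z02 ^+ 2 + z03 ^+ 2) * (y02 * y13 - y03 * y12).
  apply/eqP; rewrite -subr_eq0; apply/eqP.
  transitivity ((y02 * z02 + y03 * z03) *
      (z02 * y13 - z12 * y03 + (y02 * z13 - y12 * z03)) -
    (z02 * y03 - z03 * y02) * (z02 * y12 - z12 * y02 + (z03 * y13 - z13 * y03))).
    ring.
  by rewrite flat1 flat2 !mulr0 subr0.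
rewrite -(pmulr_rlt0 _ plane_y0_gt0) mulrCA E mulrCA mulNr oppr_lt0.
by rewrite pmulr_rgt0 ?plane_z0_gt0 // -expr2 exprn_even_gt0.
Qed.

(** This is |k|^2 in z = k conj y, computed at the first coordinate vector. *)
Let rho := (z02 ^+ 2 + z03 ^+ 2) / (y02 ^+ 2 + y03 ^+ 2).

Lemma plane_ratio_gt0 : 0 < rho.
Proof. exact: divr_gt0 plane_z0_gt0 plane_y0_gt0. Qed.

Lemma plane_conformal :
  [/\ z02 * z02 + z03 * z03 = rho * (y02 * y02 + y03 * y03),
      z02 * z12 + z03 * z13 = rho * (y02 * y12 + y03 * y13) &
      z12 * z12 + z13 * z13 = rho * (y12 * y12 + y13 * y13)].
Proof.
have Y := lt0r_neq0 plane_y0_gt0.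
split; rewrite /rho -mulrAC; apply: (canRL (mulfK Y)).
- ring.
- apply/eqP; rewrite -subr_eq0; apply/eqP.
  transitivity (- (z02 * y03 - z03 * y02) *
      (z02 * y13 - z12 * y03 + (y02 * z13 - y12 * z03)) +
    - (z02 * y02 + z03 * y03) * (z02 * y12 - z12 * y02 + (z03 * y13 - z13 * y03))).
    ring.
  by rewrite flat1 flat2 !mulr0 addr0.
- apply/eqP; rewrite -subr_eq0; apply/eqP.
  transitivity ((z02 * y13 - z12 * y03 + (y02 * z13 - y12 * z03)) *
      (y02 * z13 - y03 * z12 - (y13 * z02 - y12 * z03)) +
     - (z02 * y12 - z12 * y02 + (z03 * y13 - z13 * y03)) *
      (y02 * z12 + y03 * z13 + (y12 * z02 + y13 * z03))).
    ring.
  by rewrite flat1 flat2 oppr0 !mul0r addr0.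
Qed.

(** With X_0 = p + i q and X_1 = r + i s the hypotheses say that conj X /\ y and conj X /\ z vanish.
    A nonzero X would make y and z complex proportional, but y_1 z_0 - y_0 z_1 = m + i n is 2 i k
    det y, which is nonzero. *)
Lemma plane_uniq (p q r s : R) :
  p * y12 + q * y13 = r * y02 + s * y03 -> p * z12 + q * z13 = r * z02 + s * z03 ->
  p * y13 - q * y12 = r * y03 - s * y02 -> p * z13 - q * z12 = r * z03 - s * z02 ->
  [/\ p = 0, q = 0, r = 0 & s = 0].
Proof.
move=> e1 e2 e3 e4.
have Y := lt0r_neq0 plane_y0_gt0; have Z := lt0r_neq0 plane_z0_gt0.
pose m := y12 * z02 - y13 * z03 - y02 * z12 + y03 * z13.
pose n := y12 * z03 + y13 * z02 - y02 * z13 - y03 * z12.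
have Em : (y02 ^+ 2 + y03 ^+ 2) * m =
    - (2 * (y02 * y13 - y03 * y12) * (z02 * y03 + z03 * y02)).
  transitivity (- (2 * (y02 * y13 - y03 * y12) * (z02 * y03 + z03 * y02)) +
     (y02 ^+ 2 - y03 ^+ 2) * (z02 * y12 - z12 * y02 + (z03 * y13 - z13 * y03)) +
     2 * y02 * y03 * (z02 * y13 - z12 * y03 + (y02 * z13 - y12 * z03))).
    by rewrite /m; ring.
  by rewrite flat1 flat2 !mulr0 !addr0.
have En : (y02 ^+ 2 + y03 ^+ 2) * n =
    2 * (y02 * y13 - y03 * y12) * (z02 * y02 - z03 * y03).
  transitivity (2 * (y02 * y13 - y03 * y12) * (z02 * y02 - z03 * y03) +
     2 * y02 * y03 * (z02 * y12 - z12 * y02 + (z03 * y13 - z13 * y03)) -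
     (y02 ^+ 2 - y03 ^+ 2) * (z02 * y13 - z12 * y03 + (y02 * z13 - y12 * z03))).
    by rewrite /n; ring.
  by rewrite flat1 flat2 !mulr0 subr0 addr0.
have mn : m ^+ 2 + n ^+ 2 != 0.
  have : (y02 ^+ 2 + y03 ^+ 2) ^+ 2 * (m ^+ 2 + n ^+ 2) =
     4 * (y02 * y13 - y03 * y12) ^+ 2 * (y02 ^+ 2 + y03 ^+ 2) * (z02 ^+ 2 + z03 ^+ 2).
    by rewrite mulrDr -!exprMn Em En; ring.
  apply: contra_eq_neq => ->; rewrite mulr0 eq_sym.
  by rewrite !mulf_neq0 ?expf_neq0 ?dy.
have E1 : p * m + q * n = 0.
  rewrite /m /n; have -> : p * (y12 * z02 - y13 * z03 - y02 * z12 + y03 * z13) +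
    q * (y12 * z03 + y13 * z02 - y02 * z13 - y03 * z12) =
    z02 * (p * y12 + q * y13) - z03 * (p * y13 - q * y12)
    - (y02 * (p * z12 + q * z13) - y03 * (p * z13 - q * z12)) by ring.
  by rewrite e1 e2 e3 e4; ring.
have E2 : p * n - q * m = 0.
  rewrite /m /n; have -> : p * (y12 * z03 + y13 * z02 - y02 * z13 - y03 * z12) -
    q * (y12 * z02 - y13 * z03 - y02 * z12 + y03 * z13) =
    z03 * (p * y12 + q * y13) + z02 * (p * y13 - q * y12)
    - (y03 * (p * z12 + q * z13) + y02 * (p * z13 - q * z12)) by ring.
  by rewrite e1 e2 e3 e4; ring.
have p0 : p = 0.
  apply: (mulfI mn); rewrite mulr0.
  by transitivity (m * (p * m + q * n) + n * (p * n - q * m)); [ring|rewrite E1 E2 !mulr0 addr0].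
have q0 : q = 0.
  apply: (mulfI mn); rewrite mulr0.
  by transitivity (n * (p * m + q * n) - m * (p * n - q * m)); [ring|rewrite E1 E2 !mulr0 subr0].
rewrite p0 q0 !mul0r !addr0 ?subr0 in e1 e3; split=> //; apply: (mulfI Y); rewrite mulr0.
  by transitivity (y02 * (r * y02 + s * y03) + y03 * (r * y03 - s * y02)); [ring|rewrite -e1 -e3 !mulr0 addr0].
by transitivity (y03 * (r * y02 + s * y03) - y02 * (r * y03 - s * y02)); [ring|rewrite -e1 -e3 !mulr0 subr0].
Qed.

Variables x02 x03 x12 x13 : R.
Hypothesis sxy : x02 * y12 + x03 * y13 = x12 * y02 + x13 * y03.
Hypothesis sxz : x02 * z12 + x03 * z13 = x12 * z02 + x13 * z03.

Let r1 := (x02 * y13 - x03 * y12 - (x12 * y03 - x13 * y02)) / (2 * (y02 * y13 - y03 * y12)).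
Let r2 := (x02 * z13 - x03 * z12 - (x12 * z03 - x13 * z02)) / (2 * (z02 * z13 - z03 * z12)).

(** [plane_uniq] applies to X = x - r1 y - r2 z. The forms conj y /\ z and conj z /\ y vanish, the
    real parts of conj x /\ y and conj x /\ z vanish by [sxy] and [sxz], and [r1], [r2] are chosen
    to cancel the imaginary parts. *)
Lemma plane_decomposition :
  [/\ x02 = r1 * y02 + r2 * z02, x03 = r1 * y03 + r2 * z03,
      x12 = r1 * y12 + r2 * z12 & x13 = r1 * y13 + r2 * z13].
Proof.
have R1 : r1 * (2 * (y02 * y13 - y03 * y12)) = x02 * y13 - x03 * y12 - (x12 * y03 - x13 * y02).
  by rewrite /r1 divfK // mulf_neq0 // pnatr_eq0.
have R2 : r2 * (2 * (z02 * z13 - z03 * z12)) = x02 * z13 - x03 * z12 - (x12 * z03 - x13 * z02).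
  by rewrite /r2 divfK // mulf_neq0 // pnatr_eq0.
have [] := @plane_uniq (x02 - (r1 * y02 + r2 * z02)) (x03 - (r1 * y03 + r2 * z03))
  (x12 - (r1 * y12 + r2 * z12)) (x13 - (r1 * y13 + r2 * z13)).
- apply/eqP; rewrite -subr_eq0; apply/eqP.
  transitivity ((x02 * y12 + x03 * y13 - (x12 * y02 + x13 * y03)) -
    r2 * (z02 * y12 - z12 * y02 + (z03 * y13 - z13 * y03))); first ring.
  by rewrite flat1 sxy subrr mulr0 subr0.
- apply/eqP; rewrite -subr_eq0; apply/eqP.
  transitivity ((x02 * z12 + x03 * z13 - (x12 * z02 + x13 * z03)) +
    r1 * (z02 * y12 - z12 * y02 + (z03 * y13 - z13 * y03))); first ring.
  by rewrite flat1 sxz subrr mulr0 addr0.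
- apply/eqP; rewrite -subr_eq0; apply/eqP.
  transitivity ((x02 * y13 - x03 * y12 - (x12 * y03 - x13 * y02)) - r1 * (2 * (y02 * y13 - y03 * y12)) -
    r2 * (z02 * y13 - z12 * y03 + (y02 * z13 - y12 * z03))); first ring.
  by rewrite flat2 R1 subrr mulr0 subr0.
- apply/eqP; rewrite -subr_eq0; apply/eqP.
  transitivity ((x02 * z13 - x03 * z12 - (x12 * z03 - x13 * z02)) - r2 * (2 * (z02 * z13 - z03 * z12)) -
    r1 * (z02 * y13 - z12 * y03 + (y02 * z13 - y12 * z03))); first ring.
  by rewrite flat2 R2 subrr mulr0 subr0.
by move=> h1 h2 h3 h4; split; apply/eqP; rewrite -subr_eq0 ?h1 ?h2 ?h3 ?h4.
Qed.

(** The endomorphism y^-1 z of the tangent plane is trace-free by [flat2] and has negative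
    determinant by [plane_orientation], so its eigenvalues are real and opposite, s and - s. *)
Lemma plane_common_directions : exists u0 u1 v0 v1 k l : R,
  [/\ u0 * v1 - u1 * v0 != 0, k != 0, l != 0,
    [/\ u0 * z02 + u1 * z12 = k * (u0 * y02 + u1 * y12) &
      u0 * z03 + u1 * z13 = k * (u0 * y03 + u1 * y13)] &
    [/\ v0 * z02 + v1 * z12 = l * (v0 * y02 + v1 * y12) &
      v0 * z03 + v1 * z13 = l * (v0 * y03 + v1 * y13)]].
Proof.
have D : y02 * y13 - y03 * y12 != 0 by exact: dy.
pose a := (z02 * y13 - z03 * y12) / (y02 * y13 - y03 * y12).
pose b := (y02 * z03 - y03 * z02) / (y02 * y13 - y03 * y12).
pose g := (z12 * y13 - z13 * y12) / (y02 * y13 - y03 * y12).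
have h02 : z02 = a * y02 + b * y12 by rewrite /a /b; field.
have h03 : z03 = a * y03 + b * y13 by rewrite /a /b; field.
have a' : - a = (y02 * z13 - y03 * z12) / (y02 * y13 - y03 * y12).
  rewrite /a -mulNr; congr (_ / _); apply/eqP; rewrite eq_sym -subr_eq0; apply/eqP.
  by rewrite -flat2; ring.
have h12 : z12 = g * y02 + - a * y12 by rewrite a' /g; field.
have h13 : z13 = g * y03 + - a * y13 by rewrite a' /g; field.
have ab : 0 < a ^+ 2 + b * g.
  have := plane_orientation.
  have -> : (y02 * y13 - y03 * y12) * (z02 * z13 - z03 * z12) =
      - ((a ^+ 2 + b * g) * (y02 * y13 - y03 * y12) ^+ 2) by rewrite h02 h03 h12 h13; ring.
  by rewrite oppr_lt0 pmulr_lgt0 // exprn_even_gt0.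
pose s := Num.sqrt (a ^+ 2 + b * g).
have s0 : s != 0 by rewrite lt0r_neq0 // sqrtr_gt0.
have ss : s ^+ 2 = a ^+ 2 + b * g by rewrite sqr_sqrtr // ltW.
have Ns0 : - s != 0 by rewrite oppr_eq0.
have sol u0 u1 t : u0 * a + u1 * g = t * u0 -> u0 * b - u1 * a = t * u1 ->
   u0 * z02 + u1 * z12 = t * (u0 * y02 + u1 * y12) /\
   u0 * z03 + u1 * z13 = t * (u0 * y03 + u1 * y13).
  move=> e1 e2; rewrite h02 h03 h12 h13; split.
    transitivity ((u0 * a + u1 * g) * y02 + (u0 * b - u1 * a) * y12); first ring.
    by rewrite e1 e2; ring.
  transitivity ((u0 * a + u1 * g) * y03 + (u0 * b - u1 * a) * y13); first ring.
  by rewrite e1 e2; ring.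
have two0 : 2 != 0 :> R by rewrite pnatr_eq0.
(* Eigenvectors are read off from an off-diagonal entry that does not vanish; if both vanish the
   matrix is already diagonal. *)
have [b0|bN0] := eqVneq b 0; last first.
  exists (s + a), b, (- s + a), b, s, (- s).
  have -> : (s + a) * b - b * (- s + a) = 2 * s * b by ring.
  split=> //; first by do 2 apply: mulf_neq0 => //.
    by apply: sol; [transitivity (s ^+ 2 + s * a); [rewrite ss|]; ring|ring].
  by apply: sol; [transitivity (s ^+ 2 - s * a); [rewrite ss|]; ring|ring].
have [g0|gN0] := eqVneq g 0; last first.
  exists g, (s - a), g, (- s - a), s, (- s).
  have -> : g * (- s - a) - (s - a) * g = - (2 * s * g) by ring.
  split=> //; first by rewrite oppr_eq0; do 2 apply: mulf_neq0 => //.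
    by apply: sol; [ring|transitivity (s ^+ 2 - s * a); [rewrite ss|]; ring].
  by apply: sol; [ring|transitivity (s ^+ 2 + s * a); [rewrite ss|]; ring].
exists 1, 0, 0, 1, a, (- a).
have a0 : a != 0 by move: ab; rewrite b0 mul0r addr0; apply: contraTneq => ->; rewrite expr0n ltxx.
split; [by rewrite mulr1 mul0r subr0 oner_neq0|done|by rewrite oppr_eq0| |].
  by apply: sol; [ring|rewrite b0; ring].
by apply: sol; [rewrite g0; ring|ring].
Qed.

End PlaneAlgebra.

(** * Fundamental forms of an envelope *)

Section Envelope.
Context {R : realType} {M : orientedSurface R}.
Implicit Types (c : chart R M) (p : M) (w : 'rV[R]_2).

Lemma dotDl (x y z : 'cV[R]_3) : dot (x + y) z = dot x z + dot y z.
Proof. by rewrite /dot !sum_ord3 !mxE; ring. Qed.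

Lemma dotZl (k : R) (x z : 'cV[R]_3) : dot (k *: x) z = k * dot x z.
Proof. by rewrite /dot !sum_ord3 !mxE; ring. Qed.

Lemma dot0l (z : 'cV[R]_3) : dot 0 z = 0.
Proof. by rewrite /dot !sum_ord3 !mxE; ring. Qed.

Lemma dot_sp (u v : 'cV[R]_4) : dot (sp u) (sp v) = mink u v + tau u * tau v.
Proof. by rewrite mink_sp_tau subrK. Qed.

(** Used with [U] = dS, [m] the null normal of time component -1 and [d], [d'] values of dm: the
    first factor is then the differential of the point map sp S + (tau S) sp m. *)
Lemma dot_front (U m d d' : 'cV[R]_4) (s : R) : tau d' = 0 -> mink m d' = 0 ->
  dot (sp U + (tau U *: sp m + s *: sp d)) (sp d') = mink U d' + s * dot (sp d) (sp d').
Proof. by move=> t0 m0; rewrite !dotDl !dotZl !dot_sp t0 m0; ring. Qed.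

Lemma dot_front_normal (U m d : 'cV[R]_4) (s : R) : tau m = -1 -> tau d = 0 ->
  mink m m = 0 -> mink U m = 0 -> mink m d = 0 ->
  dot (sp U + (tau U *: sp m + s *: sp d)) (sp m) = 0.
Proof.
move=> tm td mm Um md; rewrite !dotDl !dotZl !dot_sp tm td mm Um (minkC d) md; ring.
Qed.

Local Opaque dmap sp tau dot mink.

Lemma dmap_null (N : M -> 'cV[R]_4) c p w : smooth N -> (forall q, mink (N q) (N q) = 0) ->
  atlas c -> dom c p -> mink (N p) (dmap c N p w) = 0.
Proof.
move=> sN N0 ac cp; have := dmap_mink ac cp w sN sN.
have -> : (fun q => mink (N q) (N q)) = (fun=> 0) by apply/funext.
rewrite dmap_cst (minkC (dmap _ _ _ _)) => h; lra.
Qed.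

Variables (F : M -> contact R) (S N : M -> 'cV[R]_4).
Hypotheses (sS : smooth S) (sN : smooth N).
Hypothesis N_null : forall p, mink (N p) (N p) = 0.
Hypothesis N_normal : for_all_tangent (fun c p w => mink (N p) (dmap c S p w) = 0).
Hypothesis F_contact : forall p, is_contact (F p) (S p) (N p).

Lemma envelope_tau p : tau (N p) != 0.
Proof. by have /is_contactP[] := F_contact p. Qed.

(* The multiple of [N] with time component -1: its space part is the unit normal. *)
Let m p := (- (tau (N p))^-1) *: N p.

Let s_nu : smooth (fun p => - (tau (N p))^-1).
Proof. by apply/smoothN/smoothV; [exact: envelope_tau|exact: smooth_tau]. Qed.

Let sm : smooth m.
Proof. exact: smoothZ. Qed.

Let m_null p : mink (m p) (m p) = 0.
Proof. by rewrite /m minkZl minkZr N_null !mulr0. Qed.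

Let tau_m p : tau (m p) = -1.
Proof. by rewrite /m tauZ mulNr mulVf // envelope_tau. Qed.

Lemma envelope_normal : normalmap F = (fun p => sp (m p)).
Proof. by apply/funext => p; have /is_contactP[_ h _] := F_contact p; rewrite /normalmap h /m spZ. Qed.

Lemma envelope_point : pointmap F = (fun p => sp (S p) + tau (S p) *: sp (m p)).
Proof.
apply/funext => p; have /is_contactP[_ h h'] := F_contact p.
by rewrite /pointmap h' h /m spZ.
Qed.

Section At.
Variables (c : chart R M) (p : M).
Hypotheses (ac : atlas c) (cp : dom c p).

Let dm w : dmap c m p w = dmap c (fun q => - (tau (N q))^-1) p w *: N p
  + (- (tau (N p))^-1) *: dmap c N p w.
Proof. exact: dmapZ. Qed.

Let tau_dm w : tau (dmap c m p w) = 0.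
Proof.
rewrite -(dmap_tau ac cp w sm).
have -> : (fun q => tau (m q)) = (fun=> -1) by apply/funext.
exact: dmap_cst.
Qed.

Let m_dm w : mink (m p) (dmap c m p w) = 0.
Proof. exact: dmap_null. Qed.

Let m_dS w : mink (m p) (dmap c S p w) = 0.
Proof. by rewrite /m minkZl N_normal // mulr0. Qed.

Let dn w : dmap c (normalmap F) p w = sp (dmap c m p w).
Proof. by rewrite envelope_normal; exact: dmap_sp. Qed.

Let df w : dmap c (pointmap F) p w =
  sp (dmap c S p w) + (tau (dmap c S p w) *: sp (m p) + tau (S p) *: sp (dmap c m p w)).
Proof.
rewrite envelope_point.
rewrite (dmapD ac cp w (smooth_sp sS) (smoothZ (smooth_tau sS) (smooth_sp sm))).
rewrite (dmapZ ac cp w (smooth_tau sS) (smooth_sp sm)).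
by rewrite (dmap_sp ac cp w sS) (dmap_sp ac cp w sm) (dmap_tau ac cp w sS).
Qed.

Let dm_dm w w' : mink (dmap c m p w) (dmap c m p w') =
  mink (dmap c N p w) (dmap c N p w') / tau (N p) ^+ 2.
Proof.
have h u : mink (dmap c N p u) (N p) = 0 by rewrite minkC; exact: dmap_null.
rewrite !dm !minkDl !minkDr !minkZl !minkZr N_null h (minkC (N p)) h -exprVn.
ring.
Qed.

(** The values of dm have time component 0, so their Euclidean and Minkowski products agree; and dm
    differs from - dN / tau N by a multiple of [N], which is null and orthogonal to dN. *)
Lemma envelope_III w w' : III F c p w w' =
  mink (dmap c N p w) (dmap c N p w') / tau (N p) ^+ 2.
Proof. by rewrite /III (dn w) (dn w') dot_sp (tau_dm w) (tau_dm w') mulr0 addr0 dm_dm. Qed.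

Lemma envelope_II w w' : II F c p w w' =
  mink (dmap c S p w) (dmap c N p w') / tau (N p) - tau (S p) * III F c p w w'.
Proof.
have h : mink (dmap c S p w) (dmap c m p w') =
    - (tau (N p))^-1 * mink (dmap c S p w) (dmap c N p w').
  rewrite (dm w') minkDr !minkZr (minkC (dmap c S p w) (N p)).
  by rewrite (N_normal w ac cp) mulr0 add0r.
rewrite /II /III (df w) (dn w) (dn w') (dot_front _ _ _ (tau_dm w') (m_dm w')) h.
by rewrite opprD mulNr opprK mulrC.
Qed.

Lemma envelope_legendre_at w : dot (dmap c (pointmap F) p w) (normalmap F p) = 0.
Proof.
rewrite (df w) envelope_normal; apply: dot_front_normal => //.
by rewrite minkC; exact: m_dS.
Qed.

(** If dS = s dm + t m, the time components give tau(dS) = - t, so the terms along [m] cancel in the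
    differential of the point map, which becomes (s + tau S) dn. *)
Lemma envelope_curvature_direction w (k : R) : w != 0 ->
  dmap c S p w = k *: (dmap c N p w : 'cV[R]_4) -> curvature_direction F c p w.
Proof.
move=> w0 h; split=> //.
have t0 := envelope_tau p.
have [s [t E]] : exists s t, dmap c S p w = s *: dmap c m p w + t *: m p.
  (* Found by solving the formula [dm] for dN. *)
  exists (- (tau (N p)) * k), (- (tau (N p)) * k *  (- (tau (N p) * - dmap c (fun q => - (tau (N q))^-1) p w))).
  rewrite (dm w) h /m scalerDr !scalerA addrAC -scalerDl.
  have -> : - tau (N p) * k * - (tau (N p))^-1 = k by field.
  rewrite [X in X *: N p + _](_ : _ = 0) ?scale0r ?add0r //.
  by field.
have tE := congr1 tau E; rewrite tauD (tauZ s) (tauZ t) (tau_dm w) tau_m mulr0 add0r mulrN1 in tE.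
exists (1, - (s + tau (S p))); split; first by rewrite xpair_eqE oner_eq0.
rewrite /= scale1r (df w) (dn w) tE E spD (spZ s) (spZ t).
move: (sp _) (sp _) (tau _) => x y k'.
by apply/colP => i; rewrite !mxE; ring.
Qed.

End At.

Lemma envelope_legendre : legendre F.
Proof.
split.
- rewrite envelope_point; apply: smoothD; first exact: smooth_sp.
  by apply: smoothZ; [exact: smooth_tau|exact: smooth_sp].
- by rewrite envelope_normal; exact: smooth_sp.
- by move=> c p w ac cp; exact: envelope_legendre_at.
Qed.

End Envelope.

(** * Null frames *)

Section NullFrame.
Context {R : realType} {M : orientedSurface R}.
Implicit Types (c : chart R M) (p : M) (w : 'rV[R]_2).

(* [S] is a space-like surface with null normals [N1], [N2], normalized so that the
   normal connection form vanishes; [e2], [e3] is an orthonormal frame of the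
   plane orthogonal to [N1] and [N2].  The last field is the curved flat condition. *)
Record null_frame (S N1 N2 e2 e3 : M -> 'cV[R]_4) : Prop := NullFrame {
  nf_smooth : [/\ smooth S, smooth N1 & smooth N2];
  nf_smooth_plane : smooth e2 /\ smooth e3;
  nf_null : forall p,
    [/\ mink (N1 p) (N1 p) = 0, mink (N2 p) (N2 p) = 0 & mink (N1 p) (N2 p) = -1];
  nf_orthonormal : forall p,
    [/\ mink (e2 p) (e2 p) = 1, mink (e3 p) (e3 p) = 1 & mink (e2 p) (e3 p) = 0];
  nf_normal1 : forall p, mink (N1 p) (e2 p) = 0 /\ mink (N1 p) (e3 p) = 0;
  nf_normal2 : forall p, mink (N2 p) (e2 p) = 0 /\ mink (N2 p) (e3 p) = 0;
  nf_tangent : for_all_tangent (fun c p w =>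
    [/\ exists a b, dmap c S p w = a *: e2 p + b *: e3 p,
        exists a b, dmap c N1 p w = a *: e2 p + b *: e3 p &
        exists a b, dmap c N2 p w = a *: e2 p + b *: e3 p]);
  nf_flat : forall c p, atlas c -> dom c p ->
    let y e w := mink (dmap c N1 p w) (e p) in
    let z e w := mink (dmap c N2 p w) (e p) in
    wedge (z e2) (y e2) + wedge (z e3) (y e3) = 0 /\
    wedge (z e2) (y e3) + wedge (y e2) (z e3) = 0 }.

(** Differentiating <N, D_b S> = 0 gives <D_a N, D_b S> = - <N, D_a D_b S>, which is symmetric in a
    and b. *)
Lemma shape_sym (S N : M -> 'cV[R]_4) : smooth S -> smooth N ->
  for_all_tangent (fun c p w => mink (N p) (dmap c S p w) = 0) ->
  forall c p u v, atlas c -> dom c p ->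
  mink (dmap c N p u) (dmap c S p v) = mink (dmap c N p v) (dmap c S p u).
Proof.
move=> sS sN SN c p u v ac cp.
have oc := open_cod ac; have x0 := to_cod ac cp.
have key a b : mink ('D_a (N \o from c) (to c p)) ('D_b (S \o from c) (to c p)) =
   - mink ((N \o from c) (to c p)) ('D_a ('D_b (S \o from c)) (to c p)).
  have dN := smooth_differentiable sN ac cp.
  have dS := smooth_on_differentiable (smooth_on_derive b (sS c ac)) x0.
  have := derive_mink a dN dS.
  have -> : 'D_a (fun y => mink ((N \o from c) y) ('D_b (S \o from c) y)) (to c p) = 0.
    have <- : 'D_a (cst (0 : R)) (to c p) = 0 by exact: derive_cst.
    apply: near_eq_derive; near=> x.
    have cx : cod c x by near: x; exact: open_nbhs_nbhs.
    rewrite /= -{2}(to_from ac cx).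
    exact: (SN c (from c x) b ac (from_dom ac cx)).
  by move=> /esym /eqP; rewrite addr_eq0 => /eqP.
apply: etrans (key u v) _; apply: etrans (esym (key v u)).
exact: (congr1 (fun t => - mink ((N \o from c) (to c p)) t)
  (derive_comm_mx u v oc (sS c ac) x0)).
Unshelve. all: by end_near. Qed.

Lemma tangent_components (u : 'cV[R]_4) (f2 f3 : 'cV[R]_4) :
  [/\ mink f2 f2 = 1, mink f3 f3 = 1 & mink f2 f3 = 0] ->
  (exists a b, u = a *: f2 + b *: f3) -> u = mink u f2 *: f2 + mink u f3 *: f3.
Proof.
move=> [h2 h3 h23] [a [b ->]].
by rewrite !minkDl !minkZl h2 h3 (minkC f3) h23 !mulr0 !mulr1 addr0 add0r.
Qed.

Lemma tangent_mink (u v f2 f3 : 'cV[R]_4) :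
  [/\ mink f2 f2 = 1, mink f3 f3 = 1 & mink f2 f3 = 0] ->
  (exists a b, v = a *: f2 + b *: f3) -> 
  mink u v = mink u f2 * mink v f2 + mink u f3 * mink v f3.
Proof.
move=> h hv; rewrite {1}(tangent_components h hv) minkDr !minkZr; ring.
Qed.

(* The coordinate vector fields and the components of a tangent vector, made
   opaque below: comparing the indices 0 and 1 of ['I_2] is costly. *)
Definition ux : 'rV[R]_2 := bvec 0.
Definition uy : 'rV[R]_2 := bvec 1.
Definition cx w : R := w 0 0.
Definition cy w : R := w 0 1.
Definition vec2 (a b : R) : 'rV[R]_2 := \row_j (if j == 0 then a else b).

Lemma cx_vec2 a b : cx (vec2 a b) = a.
Proof. by rewrite /cx mxE. Qed.

Lemma cy_vec2 a b : cy (vec2 a b) = b.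
Proof. by rewrite /cy mxE. Qed.

Lemma cxZ (k : R) w : cx (k *: w) = k * cx w.
Proof. by rewrite /cx mxE. Qed.

Lemma cyZ (k : R) w : cy (k *: w) = k * cy w.
Proof. by rewrite /cy mxE. Qed.

Lemma cx_ux : cx ux = 1. Proof. by rewrite /cx /ux /bvec mxE. Qed.

Lemma cx0 : cx 0 = 0. Proof. by rewrite /cx mxE. Qed.
Lemma cy0 : cy 0 = 0. Proof. by rewrite /cy mxE. Qed.

Lemma rV2E w : w = cx w *: ux + cy w *: uy.
Proof.
rewrite [LHS]row_sum_delta !big_ord_recl big_ord0 addr0.
by congr (_ + _ *: bvec _); first congr (w _ _); exact: val_inj.
Qed.

Lemma dmap_rV2 {m n} (f : M -> 'M[R]_(m, n)) c p w : smooth f -> atlas c -> dom c p ->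
  dmap c f p w = cx w *: (dmap c f p ux : 'M[R]_(m, n)) +
    cy w *: (dmap c f p uy : 'M[R]_(m, n)) :> 'M[R]_(m, n).
Proof.
move=> sf ac cp; rewrite {1}(rV2E w) (dmap_linear ac cp _ _ _ sf); congr (_ + _).
rewrite -[cy w *: uy]addr0 (dmap_linear ac cp _ _ _ sf).
rewrite (_ : dmap c f p 0 = 0) ?addr0 //.
by have := dmap_linear ac cp 0 0 (-1) sf; rewrite scaler0 addr0 scaleN1r addNr.
Qed.

Lemma vec2E w : w = vec2 (cx w) (cy w).
Proof.
apply/rowP => j; rewrite mxE /cx /cy; case: (eqVneq j 0) => [->//|].
by case: j => [[|[]]] //= ? _; congr (w _ _); exact: val_inj.
Qed.

Lemma differentiable_vec2 (a b : 'rV[R]_2 -> R) x :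
  differentiable a x -> differentiable b x -> differentiable (fun y => vec2 (a y) (b y)) x.
Proof.
move=> da db; apply: differentiable_mx => i j.
have -> : (fun y => vec2 (a y) (b y) i j) = (fun y => if j == 0 then a y else b y).
  by apply/funext => y; rewrite mxE.
by case: (j == 0).
Qed.

Lemma derive_vec2 (a b : 'rV[R]_2 -> R) x w :
  differentiable a x -> differentiable b x ->
  'D_w (fun y => vec2 (a y) (b y)) x = vec2 ('D_w a x) ('D_w b x).
Proof.
move=> da db; apply/matrixP => i j.
apply: etrans (derive_entry w i j (differentiable_vec2 da db)) _.
have -> : (fun y => vec2 (a y) (b y) i j) = (fun y => if j == 0 then a y else b y).
  by apply/funext => y; rewrite mxE.
by rewrite mxE; case: (j == 0).
Qed.

Lemma CauchyRiemann_vec2 (h : 'rV[R]_2 -> 'rV[R]_2) x (a b : R) : differentiable h x ->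
  'D_ux h x = vec2 a b -> 'D_uy h x = vec2 (- b) a ->
  is_derive (complex_of x : R[i]^o) (1 : R[i]^o)
    (complex_of \o h \o of_complex : R[i]^o -> R[i]^o) (a +i* b)%C.
Proof.
move=> dh e0 e1; have -> : (a +i* b)%C = complex_of (vec2 a b) by rewrite /complex_of !mxE.
by apply: (CauchyRiemann_derive dh e0 e1); rewrite !mxE.
Qed.

Definition xi (f : M -> 'cV[R]_4) (e : M -> 'cV[R]_4) w c p : R :=
  mink (dmap c f p w) (e p).

Lemma swap_factors (a b d e a' b' d' e' : R) :
  a * b + d * e = a' * b' + d' * e' -> b * a + e * d = b' * a' + e' * d'.
Proof. by rewrite !(mulrC b) !(mulrC e) !(mulrC b') !(mulrC e'). Qed.

Section At.
Variables (S N1 N2 e2 e3 : M -> 'cV[R]_4).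
Hypothesis nf : null_frame S N1 N2 e2 e3.

Lemma nf_S_normal1 : for_all_tangent (fun c p w => mink (N1 p) (dmap c S p w) = 0).
Proof.
move=> c p w ac cp; have [[a [b ->]] _ _] := nf_tangent nf w ac cp.
by have [h h'] := nf_normal1 nf p; rewrite minkDr !minkZr h h' !mulr0 addr0.
Qed.

Lemma nf_S_normal2 : for_all_tangent (fun c p w => mink (N2 p) (dmap c S p w) = 0).
Proof.
move=> c p w ac cp; have [[a [b ->]] _ _] := nf_tangent nf w ac cp.
by have [h h'] := nf_normal2 nf p; rewrite minkDr !minkZr h h' !mulr0 addr0.
Qed.

Variables (c : chart R M) (p : M).
Hypotheses (ac : atlas c) (cp : dom c p).

Lemma nf_minkE (u : 'cV[R]_4) (f : M -> 'cV[R]_4) w :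
  f = S \/ f = N1 \/ f = N2 ->
  mink u (dmap c f p w) = mink u (e2 p) * xi f e2 w c p + mink u (e3 p) * xi f e3 w c p.
Proof.
move=> hf; apply: tangent_mink (nf_orthonormal nf p) _.
by have [hS h1 h2] := nf_tangent nf w ac cp; case: hf => [->|[->|->]].
Qed.

Lemma nf_flat1 : xi N2 e2 ux c p * xi N1 e2 uy c p - xi N2 e2 uy c p * xi N1 e2 ux c p +
  (xi N2 e3 ux c p * xi N1 e3 uy c p - xi N2 e3 uy c p * xi N1 e3 ux c p) = 0.
Proof. by have [h _] := nf_flat nf ac cp. Qed.

Lemma nf_flat2 : xi N2 e2 ux c p * xi N1 e3 uy c p - xi N2 e2 uy c p * xi N1 e3 ux c p +
  (xi N1 e2 ux c p * xi N2 e3 uy c p - xi N1 e2 uy c p * xi N2 e3 ux c p) = 0.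
Proof. by have [_ h] := nf_flat nf ac cp. Qed.

Lemma nf_sym1 : xi S e2 ux c p * xi N1 e2 uy c p + xi S e3 ux c p * xi N1 e3 uy c p =
  xi S e2 uy c p * xi N1 e2 ux c p + xi S e3 uy c p * xi N1 e3 ux c p.
Proof.
have [sS s1 s2] := nf_smooth nf.
have h := shape_sym sS s1 nf_S_normal1 uy ux ac cp.
have h1 := nf_minkE (dmap c N1 p uy) ux (or_introl (erefl S)).
have h0 := nf_minkE (dmap c N1 p ux) uy (or_introl (erefl S)).
exact: (swap_factors (etrans (etrans (esym h1) h) h0)).
Qed.

Lemma nf_sym2 : xi S e2 ux c p * xi N2 e2 uy c p + xi S e3 ux c p * xi N2 e3 uy c p =
  xi S e2 uy c p * xi N2 e2 ux c p + xi S e3 uy c p * xi N2 e3 ux c p.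
Proof.
have [sS s1 s2] := nf_smooth nf.
have h := shape_sym sS s2 nf_S_normal2 uy ux ac cp.
have h1 := nf_minkE (dmap c N2 p uy) ux (or_introl (erefl S)).
have h0 := nf_minkE (dmap c N2 p ux) uy (or_introl (erefl S)).
exact: (swap_factors (etrans (etrans (esym h1) h) h0)).
Qed.

End At.

(** The determinant of dN followed by the projection to the plane of [e2] and [e3]. *)
Definition frame_det (N e2 e3 : M -> 'cV[R]_4) c p : R :=
  xi N e2 ux c p * xi N e3 uy c p - xi N e3 ux c p * xi N e2 uy c p.

Lemma det2x2 (A : 'M[R]_2) : \det A = A 0 0 * A 1 1 - A 0 1 * A 1 0.
Proof.
rewrite (expand_det_row _ 0) !big_ord_recl big_ord0 addr0 /cofactor !det_mx11 !mxE /=.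
rewrite !expr0 !expr1 mul1r mulN1r mulrN; congr (_ * A _ _ - A _ _ * A _ _); exact: val_inj.
Qed.

Lemma envelope_orientationE (S N : M -> 'cV[R]_4) c p :
  envelope_orientation S N c p =
  mink (dmap c N p ux) (dmap c S p ux) * mink (dmap c N p uy) (dmap c S p uy) -
  mink (dmap c N p ux) (dmap c S p uy) * mink (dmap c N p uy) (dmap c S p ux).
Proof. by rewrite /envelope_orientation det2x2 !mxE. Qed.

Lemma holomorphic_chartE (F : M -> contact R) c : holomorphic_chart F c ->
  forall p, dom c p -> III F c p ux ux = III F c p uy uy /\ III F c p ux uy = 0.
Proof. by case. Qed.

Lemma II20E (F : M -> contact R) c p : II20 F c p =
  ((II F c p ux ux - II F c p uy uy) / 4 +i* - ((II F c p ux uy + II F c p uy ux) / 4))%C.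
Proof. by []. Qed.

Lemma det_jacobian (h : 'rV[R]_2 -> 'rV[R]_2) x : differentiable h x ->
  \det (jacobian h x) = cx ('D_ux h x) * cy ('D_uy h x) - cy ('D_ux h x) * cx ('D_uy h x).
Proof.
move=> dh; rewrite det2x2 /cx /cy.
have E i j : jacobian h x i j = 'D_(bvec i) h x 0 j.
  apply: esym.
  apply: etrans (congr1 (fun t : 'rV[R]_2 => t 0 j) (deriveEjacobian (bvec i) dh)) _.
  by rewrite /bvec -rowE mxE.
by rewrite !E.
Qed.

Lemma wedgeE (a b : 'rV[R]_2 -> R) : wedge a b = a ux * b uy - a uy * b ux.
Proof. by []. Qed.

End NullFrame.

Local Opaque ux uy cx cy derive.

(** * Null frames give nondegenerate Darboux congruences *)

Section NullFrameDarboux.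
Context {R : realType} {M : orientedSurface R}.
Implicit Types (c : chart R M) (p : M) (w : 'rV[R]_2).

Lemma mink_lin2 (a b : R) (u v e : 'cV[R]_4) :
  mink (a *: u + b *: v) e = a * mink u e + b * mink v e.
Proof. by rewrite minkDl !minkZl. Qed.

Lemma xi_bvec (f e : M -> 'cV[R]_4) c p w : smooth f -> atlas c -> dom c p ->
  mink (dmap c f p w) (e p) = cx w * xi f e ux c p + cy w * xi f e uy c p.
Proof.
move=> sf ac cp.
exact: etrans (congr1 (fun t => mink t (e p)) (dmap_rV2 w sf ac cp)) (mink_lin2 _ _ _ _ _).
Qed.

Lemma linear_combination (a b r r' x x' y y' z z' X Y Z : R) :
  x = r * y + r' * z -> x' = r * y' + r' * z' ->
  X = a * x + b * x' -> Y = a * y + b * y' -> Z = a * z + b * z' ->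
  X = r * Y + r' * Z.
Proof. by move=> -> -> -> -> ->; ring. Qed.

Lemma conformal_bilinear (r a b a' b' y02 y03 y12 y13 z02 z03 z12 z13 : R)
    (Y2 Y3 Y2' Y3' Z2 Z3 Z2' Z3' : R) :
  [/\ z02 * z02 + z03 * z03 = r * (y02 * y02 + y03 * y03),
      z02 * z12 + z03 * z13 = r * (y02 * y12 + y03 * y13) &
      z12 * z12 + z13 * z13 = r * (y12 * y12 + y13 * y13)] ->
  Y2 = a * y02 + b * y12 -> Y3 = a * y03 + b * y13 ->
  Y2' = a' * y02 + b' * y12 -> Y3' = a' * y03 + b' * y13 ->
  Z2 = a * z02 + b * z12 -> Z3 = a * z03 + b * z13 ->
  Z2' = a' * z02 + b' * z12 -> Z3' = a' * z03 + b' * z13 ->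
  Z2 * Z2' + Z3 * Z3' = r * (Y2 * Y2' + Y3 * Y3').
Proof.
move=> [h0 h01 h1] -> -> -> -> -> -> -> ->.
transitivity (a * a' * (z02 * z02 + z03 * z03) + (a * b' + b * a') * (z02 * z12 + z03 * z13)
  + b * b' * (z12 * z12 + z13 * z13)); first ring.
by rewrite h0 h01 h1; ring.
Qed.

Lemma det_mul2 (y02 y03 y12 y13 x02 x03 x12 x13 m00 m01 m10 m11 : R) :
  m00 = y02 * x02 + y03 * x03 -> m01 = y02 * x12 + y03 * x13 ->
  m10 = y12 * x02 + y13 * x03 -> m11 = y12 * x12 + y13 * x13 ->
  m00 * m11 - m01 * m10 = (y02 * y13 - y03 * y12) * (x02 * x13 - x03 * x12).
Proof. by move=> -> -> -> ->; ring. Qed.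

Lemma dependent_det0 (a b d e : R) : a * e - b * d = 0 ->
  ~ (forall s t, s * a + t * d = 0 -> s * b + t * e = 0 -> s = 0 /\ t = 0).
Proof.
move=> D h.
(* The cofactor pairs (d, - a) and (e, - b) solve the system when the determinant vanishes. *)
have [d0 /eqP a0] : d = 0 /\ - a = 0 by apply: h; [ring|rewrite -[RHS]oppr0 -D; ring].
have [e0 /eqP b0] : e = 0 /\ - b = 0 by apply: h; [rewrite -D; ring|ring].
rewrite !oppr_eq0 in a0 b0.
have [/eqP] : (1 : R) = 0 /\ (0 : R) = 0.
  by apply: h; rewrite ?(eqP a0) ?(eqP b0); ring.
by rewrite oner_eq0.
Qed.

Lemma scale_combination (X Y Z r r' k : R) : X = r * Y + r' * Z -> Z = k * Y ->
  X = (r + r' * k) * Y.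
Proof. by move=> -> ->; ring. Qed.

Lemma scale_combination_inv (X Y Z r r' k : R) : k != 0 -> X = r * Y + r' * Z -> Z = k * Y ->
  X = (r / k + r') * Z.
Proof. by move=> k0 -> ->; field. Qed.

Variables (S N1 N2 e2 e3 : M -> 'cV[R]_4) (G H : M -> contact R).
Hypothesis nf : null_frame S N1 N2 e2 e3.
Hypothesis G_contact : forall p, is_contact (G p) (S p) (N1 p).
Hypothesis H_contact : forall p, is_contact (H p) (S p) (N2 p).

Let sS : smooth S. Proof. by have [] := nf_smooth nf. Qed.
Let s1 : smooth N1. Proof. by have [] := nf_smooth nf. Qed.
Let s2 : smooth N2. Proof. by have [] := nf_smooth nf. Qed.

Lemma nf_proportional (u v : 'cV[R]_4) p (k : R) :
  (exists a b, u = a *: e2 p + b *: e3 p) -> (exists a b, v = a *: e2 p + b *: e3 p) ->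
  mink u (e2 p) = k * mink v (e2 p) -> mink u (e3 p) = k * mink v (e3 p) -> u = k *: v.
Proof.
move=> hu hv h2 h3; rewrite (tangent_components (nf_orthonormal nf p) hu).
rewrite [in RHS](tangent_components (nf_orthonormal nf p) hv) h2 h3.
by rewrite scalerDr !scalerA.
Qed.

Lemma nf_spacelike : immersion S -> spacelike S.
Proof.
move=> imS c p w ac cp w0; have [hS _ _] := nf_tangent nf w ac cp.
have := imS c p w ac cp w0; have E := tangent_components (nf_orthonormal nf p) hS.
rewrite (tangent_mink (dmap c S p w) (nf_orthonormal nf p) hS) => d0.
rewrite lt_def addr_ge0 -?expr2 ?sqr_ge0 // andbT; apply: contra_neq d0 => /eqP.
rewrite paddr_eq0 ?sqr_ge0 // !sqrf_eq0 => /andP[/eqP a0 /eqP b0].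
by rewrite E a0 b0 !scale0r addr0.
Qed.

Lemma nf_null_normal1 : null_normal S N1.
Proof.
split=> //; last exact: (nf_S_normal1 nf).
move=> p; have [h _ h12] := nf_null nf p; split=> //.
apply/eqP => N0; move: h12; rewrite N0 mink0l => /esym/eqP.
by rewrite oppr_eq0 oner_eq0.
Qed.

Lemma nf_null_normal2 : null_normal S N2.
Proof.
split=> //; last exact: (nf_S_normal2 nf).
move=> p; have [_ h h12] := nf_null nf p; split=> //.
apply/eqP => N0; move: h12; rewrite N0 mink0r => /esym/eqP.
by rewrite oppr_eq0 oner_eq0.
Qed.

Lemma nf_normals_independent p (k : R) : N1 p != k *: N2 p.
Proof.
apply/eqP => e; have [_ h h12] := nf_null nf p; move: h12.
by rewrite e minkZl h mulr0 => /esym/eqP; rewrite oppr_eq0 oner_eq0.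
Qed.

Section At.
Variables (c : chart R M) (p : M).
Hypotheses (ac : atlas c) (cp : dom c p).
Hypothesis det1 : frame_det N1 e2 e3 c p != 0.
Hypothesis det2 : frame_det N2 e2 e3 c p != 0.

Let flat1 := nf_flat1 nf ac cp.
Let flat2 := nf_flat2 nf ac cp.

(** The coefficient r2 of dN2 in dS = r1 dN1 + r2 dN2, as an explicit quotient from which smoothness
    and independence of the chart can be read off. *)
Definition curvature_ratio : R :=
  (xi S e2 ux c p * xi N2 e3 uy c p - xi S e3 ux c p * xi N2 e2 uy c p -
   (xi S e2 uy c p * xi N2 e3 ux c p - xi S e3 uy c p * xi N2 e2 ux c p)) /
  (2 * frame_det N2 e2 e3 c p).

Lemma nf_decomposition : exists r1 : R, forall w,
  mink (dmap c S p w) (e2 p) = r1 * mink (dmap c N1 p w) (e2 p) +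
    curvature_ratio * mink (dmap c N2 p w) (e2 p) /\
  mink (dmap c S p w) (e3 p) = r1 * mink (dmap c N1 p w) (e3 p) +
    curvature_ratio * mink (dmap c N2 p w) (e3 p).
Proof.
have [h02 h03 h12 h13] := plane_decomposition flat1 flat2 det1 det2
  (nf_sym1 nf ac cp) (nf_sym2 nf ac cp).
eexists => w; split.
  exact: (linear_combination h02 h12 (xi_bvec e2 w sS ac cp) (xi_bvec e2 w s1 ac cp)
    (xi_bvec e2 w s2 ac cp)).
exact: (linear_combination h03 h13 (xi_bvec e3 w sS ac cp) (xi_bvec e3 w s1 ac cp)
    (xi_bvec e3 w s2 ac cp)).
Qed.

(** Where dN2 = k dN1, the decomposition makes dS a multiple of each, which is the curvature
    condition for either envelope. *)
Lemma nf_common_direction w (k : R) : w != 0 -> k != 0 ->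
  mink (dmap c N2 p w) (e2 p) = k * mink (dmap c N1 p w) (e2 p) ->
  mink (dmap c N2 p w) (e3 p) = k * mink (dmap c N1 p w) (e3 p) ->
  curvature_direction G c p w /\ curvature_direction H c p w.
Proof.
move=> w0 k0 h2 h3; have [r1 /(_ w)[d2 d3]] := nf_decomposition.
have [hS hN1 hN2] := nf_tangent nf w ac cp.
have E1 := nf_proportional hS hN1 (scale_combination d2 h2) (scale_combination d3 h3).
have E2 := nf_proportional hS hN2 (scale_combination_inv k0 d2 h2) (scale_combination_inv k0 d3 h3).
split.
  exact: (envelope_curvature_direction sS s1 G_contact ac cp w0 E1).
exact: (envelope_curvature_direction sS s2 H_contact ac cp w0 E2).
Qed.

Lemma nf_common_directions : exists w1 w2 : 'rV[R]_2,
  [/\ w1 != 0, forall k : R, w2 != k *: w1,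
      curvature_direction H c p w1 /\ curvature_direction H c p w2 &
      curvature_direction G c p w1 /\ curvature_direction G c p w2].
Proof.
have [u0 [u1 [v0 [v1 [k [l [uv k0 l0 [hu2 hu3] [hv2 hv3]]]]]]]] :=
  plane_common_directions flat1 flat2 det1 det2.
have w0 : vec2 u0 u1 != 0.
  apply/eqP => e; have := congr1 cx e; have := congr1 cy e; rewrite cx_vec2 cy_vec2 cx0 cy0 => e1 e0.
  by move: uv; rewrite e1 e0 !mul0r subrr eqxx.
have w0' : vec2 v0 v1 != 0.
  apply/eqP => e; have := congr1 cx e; have := congr1 cy e; rewrite cx_vec2 cy_vec2 cx0 cy0 => e1 e0.
  by move: uv; rewrite e1 e0 !mulr0 subrr eqxx.
have [] := @nf_common_direction (vec2 u0 u1) k w0 k0.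
- by rewrite (xi_bvec e2 _ s2 ac cp) (xi_bvec e2 _ s1 ac cp) cx_vec2 cy_vec2.
- by rewrite (xi_bvec e3 _ s2 ac cp) (xi_bvec e3 _ s1 ac cp) cx_vec2 cy_vec2.
move=> Gu Hu; have [] := @nf_common_direction (vec2 v0 v1) l w0' l0.
- by rewrite (xi_bvec e2 _ s2 ac cp) (xi_bvec e2 _ s1 ac cp) cx_vec2 cy_vec2.
- by rewrite (xi_bvec e3 _ s2 ac cp) (xi_bvec e3 _ s1 ac cp) cx_vec2 cy_vec2.
move=> Gv Hv; exists (vec2 u0 u1), (vec2 v0 v1); split=> // t.
apply/eqP => e; have := congr1 cx e; have := congr1 cy e.
rewrite cxZ cyZ !cx_vec2 !cy_vec2 => e1 e0.
by move: uv; rewrite e1 e0 mulrCA (mulrC u1) mulrA subrr eqxx.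
Qed.

Lemma nf_conformal : exists2 rho : R, 0 < rho & forall w w',
  mink (dmap c N2 p w) (dmap c N2 p w') = rho * mink (dmap c N1 p w) (dmap c N1 p w').
Proof.
have h := plane_conformal flat1 flat2 det1.
eexists; first exact: (plane_ratio_gt0 det1 det2).
move=> w w'; have [_ hN1 hN2] := nf_tangent nf w' ac cp.
apply: etrans (tangent_mink (dmap c N2 p w) (nf_orthonormal nf p) hN2) _.
apply: etrans (congr1 _ (esym (tangent_mink (dmap c N1 p w) (nf_orthonormal nf p) hN1))).
exact: (conformal_bilinear h (xi_bvec e2 w s1 ac cp) (xi_bvec e3 w s1 ac cp)
  (xi_bvec e2 w' s1 ac cp) (xi_bvec e3 w' s1 ac cp) (xi_bvec e2 w s2 ac cp)
  (xi_bvec e3 w s2 ac cp) (xi_bvec e2 w' s2 ac cp) (xi_bvec e3 w' s2 ac cp)).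
Qed.

Lemma nf_III_conformal : exists2 rho : R, 0 < rho & forall w w',
  III G c p w w' = rho * III H c p w w'.
Proof.
have n1 q : mink (N1 q) (N1 q) = 0 by have [] := nf_null nf q.
have n2 q : mink (N2 q) (N2 q) = 0 by have [] := nf_null nf q.
have t1 := envelope_tau G_contact p; have t2 := envelope_tau H_contact p.
have [r r0 hr] := nf_conformal.
exists (tau (N2 p) ^+ 2 / (r * tau (N1 p) ^+ 2)).
  by apply: divr_gt0; [|apply: mulr_gt0 => //]; rewrite exprn_even_gt0.
move=> w w'.
rewrite (envelope_III s1 n1 G_contact ac cp w w') (envelope_III s2 n2 H_contact ac cp w w') hr.
move: (mink _ _) => t; move: t1 t2 (lt0r_neq0 r0); move: (tau _) (tau _) => a b a0 b0 rn0.
by field; rewrite a0 b0 rn0.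
Qed.

(** The matrix of the products <dN, dS> is the product of the two component matrices, one of them
    transposed. *)
Lemma nf_envelope_orientation (N : M -> 'cV[R]_4) :
  envelope_orientation S N c p = frame_det N e2 e3 c p * frame_det S e2 e3 c p.
Proof.
rewrite envelope_orientationE.
have E w w' := nf_minkE nf ac cp (dmap c N p w) w' (or_introl (erefl S)).
exact: (det_mul2 (E ux ux) (E ux uy) (E uy ux) (E uy uy)).
Qed.

Lemma nf_S_det : immersion S -> frame_det S e2 e3 c p != 0.
Proof.
move=> imS; apply/eqP => d0.
have dS0 (w : 'rV[R]_2) : cx w * xi S e2 ux c p + cy w * xi S e2 uy c p = 0 ->
    cx w * xi S e3 ux c p + cy w * xi S e3 uy c p = 0 -> w = 0.
  move=> h2 h3; apply/eqP; rewrite -[_ == _]negbK; apply/negP => w0.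
  have /eqP := imS c p w ac cp w0; apply.
  have [hS _ _] := nf_tangent nf w ac cp.
  apply: etrans (tangent_components (nf_orthonormal nf p) hS) _.
  have z2 := etrans (xi_bvec e2 w sS ac cp) h2.
  have z3 := etrans (xi_bvec e3 w sS ac cp) h3.
  by rewrite z2 z3 !scale0r addr0.
apply: (dependent_det0 d0) => s t h2 h3.
have z : vec2 s t = 0 by apply: dS0; rewrite cx_vec2 cy_vec2.
by rewrite -(cx_vec2 s t) -[X in _ /\ X = 0](cy_vec2 s t) z cx0 cy0.
Qed.

(** The determinant of [S] enters squared, so the sign is the one of [plane_orientation]. *)
Lemma nf_opposite : immersion S ->
  envelope_orientation S N2 c p * envelope_orientation S N1 c p < 0.
Proof.
move=> /nf_S_det dS; rewrite !nf_envelope_orientation mulrACA.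
have := plane_orientation flat1 flat2 det1 det2.
rewrite -[X in X < 0]/(frame_det N1 e2 e3 c p * frame_det N2 e2 e3 c p) => h.
by rewrite pmulr_llt0 1?mulrC // -expr2 exprn_even_gt0.
Qed.

End At.

(** The envelope along [N2] is listed first: in the application it is the given transform, and the
    envelope along [N1] is the superposition. *)
Lemma nf_darboux : sphere_congruence S ->
  (forall c p, atlas c -> dom c p -> frame_det N1 e2 e3 c p != 0) ->
  (forall c p, atlas c -> dom c p -> frame_det N2 e2 e3 c p != 0) ->
  nondegenerate_darboux_congruence S N2 N1 H G.
Proof.
move=> cS d1 d2; have imS := cS.2; split.
- by split=> //; exact: nf_spacelike.
- split; [exact: nf_null_normal2|exact: nf_null_normal1|exact: nf_normals_independent].
- by split.
- split=> c p ac cp.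
    exact: nf_common_directions ac cp (d1 c p ac cp) (d2 c p ac cp).
  exact: nf_III_conformal ac cp (d1 c p ac cp) (d2 c p ac cp).
- by move=> c p ac cp; exact: nf_opposite ac cp (d1 c p ac cp) (d2 c p ac cp) imS.
Qed.

End NullFrameDarboux.

(** * The Hopf differential *)

Section ConformalPlane.
Context {R : realType}.
Variables y02 y03 y12 y13 : R.
Hypothesis iso1 : y02 * y02 + y03 * y03 = y12 * y12 + y13 * y13.
Hypothesis iso2 : y02 * y12 + y03 * y13 = 0.
Hypothesis dy : y02 * y13 - y03 * y12 != 0.

(** The rows of y are orthogonal and of equal length, so y is a multiple of an orthogonal matrix and
    its columns have the same property. *)
Lemma conformal_columns : y02 * y03 + y12 * y13 = 0 /\
  y02 ^+ 2 + y12 ^+ 2 = y02 * y02 + y03 * y03 /\ y03 ^+ 2 + y13 ^+ 2 = y02 * y02 + y03 * y03.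
Proof.
pose d := y02 * y13 - y03 * y12; pose E := y02 * y02 + y03 * y03.
have E1 : y12 * E = - y03 * d.
  by transitivity (y02 * (y02 * y12 + y03 * y13) - y03 * d); [rewrite /E /d; ring|rewrite iso2; ring].
have E2 : y13 * E = y02 * d.
  by transitivity (y03 * (y02 * y12 + y03 * y13) + y02 * d); [rewrite /E /d; ring|rewrite iso2; ring].
have dE : d ^+ 2 = E ^+ 2.
  transitivity (E * (y12 * y12 + y13 * y13) - (y02 * y12 + y03 * y13) ^+ 2).
    by rewrite /E /d; ring.
  by rewrite iso2 -iso1 expr0n subr0 expr2.
have E0 : E ^+ 2 != 0 by rewrite -dE expf_neq0.
have q1 : y12 ^+ 2 = y03 ^+ 2.
  by apply: (mulIf E0); rewrite -exprMn E1 exprMn sqrrN dE.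
have q2 : y13 ^+ 2 = y02 ^+ 2 by apply: (mulIf E0); rewrite -exprMn E2 exprMn dE.
split.
  apply: (mulIf E0); rewrite mul0r mulrDl.
  have -> : y12 * y13 * E ^+ 2 = - (y02 * y03) * d ^+ 2.
    by transitivity ((y12 * E) * (y13 * E)); [ring|rewrite E1 E2; ring].
  by rewrite dE mulNr subrr.
by rewrite q1 q2 -!expr2 [in X in _ /\ X]addrC.
Qed.

(** A conformal matrix of positive determinant is a scaled rotation, y_1 = i y_0; for the
    differential of a transition map these are the Cauchy-Riemann equations. *)
Lemma conformal_rotation : 0 < y02 * y13 - y03 * y12 -> y12 = - y03 /\ y13 = y02.
Proof.
pose d := y02 * y13 - y03 * y12; pose E := y02 * y02 + y03 * y03.
move=> d0.
have dE : d ^+ 2 = E ^+ 2.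
  transitivity (E * (y12 * y12 + y13 * y13) - (y02 * y12 + y03 * y13) ^+ 2).
    by rewrite /E /d; ring.
  by rewrite iso2 -iso1 expr0n subr0 expr2.
have Eg : 0 <= E by rewrite /E -!expr2 addr_ge0 ?sqr_ge0.
have {}dE : d = E.
  by apply/eqP; rewrite -(@eqrXn2 _ 2) ?dE // ltW.
have E0 : d != 0 by exact: dy.
split; apply: (mulIf E0).
  rewrite [in LHS]dE.
  by transitivity (y02 * (y02 * y12 + y03 * y13) - y03 * d); [rewrite /E /d; ring|rewrite iso2; ring].
rewrite [in LHS]dE.
by transitivity (y03 * (y02 * y12 + y03 * y13) + y02 * d); [rewrite /E /d; ring|rewrite iso2; ring].
Qed.

Variables z02 z03 z12 z13 : R.
Hypothesis flat1 : z02 * y12 - z12 * y02 + (z03 * y13 - z13 * y03) = 0.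
Hypothesis flat2 : z02 * y13 - z12 * y03 + (y02 * z13 - y12 * z03) = 0.

(** Since y_1 is i y_0 or - i y_0, the quantity conj y . z = k (conj y)^2 takes opposite values on
    the two coordinate vectors. *)
Lemma conformal_tracefree : y02 * z02 + y03 * z03 + (y12 * z12 + y13 * z13) = 0.
Proof.
apply: (mulfI dy); rewrite mulr0.
transitivity ((y02 * y02 + y03 * y03) * (z02 * y13 - z12 * y03 + (y02 * z13 - y12 * z03)) +
  (y12 * y12 + y13 * y13 - (y02 * y02 + y03 * y03)) * (y02 * z13 - y03 * z12) +
  (y02 * y12 + y03 * y13) * (z12 * y13 - z13 * y12 - (z02 * y03 - z03 * y02))).
  ring.
by rewrite flat2 iso2 -iso1 subrr mulr0 !mul0r !addr0.
Qed.

(** Products are expanded in y_0 and y_1, orthogonal of equal length; there flatness and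
    trace-freeness read z_1 . y_0 = z_0 . y_1 and z_1 . y_1 = - z_0 . y_0. *)
Lemma conformal_codazzi (p2 p3 q2 q3 : R) :
  p2 * y02 + p3 * y03 = q2 * y12 + q3 * y13 ->
  p2 * y12 + p3 * y13 = - (q2 * y02 + q3 * y03) ->
  p2 * z12 + p3 * z13 = q2 * z02 + q3 * z03.
Proof.
move=> h1 h2; have [c1 [c2 c3]] := conformal_columns.
pose E := y02 * y02 + y03 * y03.
have E0 : E != 0.
  apply: contra_neq dy; rewrite /E => e; have := iso1; rewrite e => /esym/eqP.
  rewrite paddr_eq0 -?expr2 ?sqr_ge0 // !sqrf_eq0 => /andP[/eqP -> /eqP ->]; ring.
have exp a b e f : E * (a * e + b * f) = (a * y02 + b * y03) * (e * y02 + f * y03) +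
     (a * y12 + b * y13) * (e * y12 + f * y13).
  transitivity (a * e * (y02 ^+ 2 + y12 ^+ 2) + b * f * (y03 ^+ 2 + y13 ^+ 2) +
    (a * f + b * e) * (y02 * y03 + y12 * y13)); last ring.
  by rewrite c1 c2 c3 /E; ring.
have s : z12 * y02 + z13 * y03 = z02 * y12 + z03 * y13.
  by apply/eqP; rewrite eq_sym -subr_eq0; apply/eqP; rewrite -flat1; ring.
have t : z12 * y12 + z13 * y13 = - (z02 * y02 + z03 * y03).
  by apply/eqP; rewrite -addr_eq0; apply/eqP; rewrite -conformal_tracefree; ring.
apply: (mulfI E0); rewrite !exp h1 h2 s t; ring.
Qed.

End ConformalPlane.

(** * Codazzi equations in isothermal coordinates *)

Section Codazzi.
Context {R : realType}.

(* [Yu], [Yv], [Zu], [Zv] are the first derivatives of two null normals, [P] and [Q]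
   the second derivatives [uu] and [uv] of the first one. *)
Lemma codazzi_vec (f2 f3 Yu Yv Zu Zv P Q : 'cV[R]_4) :
  [/\ mink f2 f2 = 1, mink f3 f3 = 1 & mink f2 f3 = 0] ->
  (exists a b, Yu = a *: f2 + b *: f3) -> (exists a b, Yv = a *: f2 + b *: f3) ->
  (exists a b, Zu = a *: f2 + b *: f3) -> (exists a b, Zv = a *: f2 + b *: f3) ->
  mink Yu f2 * mink Yv f3 - mink Yu f3 * mink Yv f2 != 0 ->
  mink Zu f2 * mink Yv f2 - mink Zv f2 * mink Yu f2 +
    (mink Zu f3 * mink Yv f3 - mink Zv f3 * mink Yu f3) = 0 ->
  mink Zu f2 * mink Yv f3 - mink Zv f2 * mink Yu f3 +
    (mink Yu f2 * mink Zv f3 - mink Yv f2 * mink Zu f3) = 0 ->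
  mink Yu Yu = mink Yv Yv -> mink Yu Yv = 0 ->
  mink P Yu = mink Q Yv -> mink P Yv = - mink Q Yu -> mink P Zv = mink Q Zu.
Proof.
move=> h tYu tYv tZu tZv d f1 f2' i1 i2 e1 e2.
rewrite (tangent_mink P h tZv) (tangent_mink Q h tZu).
rewrite (tangent_mink P h tYu) (tangent_mink Q h tYv) in e1.
rewrite (tangent_mink P h tYv) (tangent_mink Q h tYu) in e2.
rewrite (tangent_mink Yu h tYu) (tangent_mink Yv h tYv) in i1.
rewrite (tangent_mink Yu h tYv) in i2.
exact: (conformal_codazzi i1 i2 d f1 f2' e1 e2).
Qed.

Lemma half_eq (a b : R) : a + a = b + b -> a = b.
Proof. by move=> h; lra. Qed.

(** Differentiating the isothermal relations along [u] gives the two relations between P = D_u D_u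
    n1 and Q = D_u D_v n1 that [key] asks for; the terms with second derivatives of [n2] agree
    because derivatives commute. *)
Lemma codazzi_on (O : set 'rV[R]_2) (n1 n2 : 'rV[R]_2 -> 'cV[R]_4) u v x :
  open O -> smooth_on O n1 -> smooth_on O n2 -> O x ->
  (forall y, O y -> mink ('D_u n1 y) ('D_u n1 y) = mink ('D_v n1 y) ('D_v n1 y)) ->
  (forall y, O y -> mink ('D_u n1 y) ('D_v n1 y) = 0) ->
  (forall P Q, mink P ('D_u n1 x) = mink Q ('D_v n1 x) ->
    mink P ('D_v n1 x) = - mink Q ('D_u n1 x) ->
    mink P ('D_v n2 x) = mink Q ('D_u n2 x)) ->
  'D_u (fun y => mink ('D_u n1 y) ('D_v n2 y)) x =
  'D_v (fun y => mink ('D_u n1 y) ('D_u n2 y)) x.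
Proof.
move=> oO s1 s2 Ox iso1 iso2 key.
have d1 w : differentiable ('D_w n1) x.
  exact: (smooth_on_differentiable (smooth_on_derive w s1) Ox).
have d2 w : differentiable ('D_w n2) x.
  exact: (smooth_on_differentiable (smooth_on_derive w s2) Ox).
have nO : nbhs x O by exact: open_nbhs_nbhs.
have E1 : mink ('D_u ('D_u n1) x) ('D_u n1 x) = mink ('D_u ('D_v n1) x) ('D_v n1 x).
  have h : 'D_u (fun y => mink ('D_u n1 y) ('D_u n1 y)) x =
           'D_u (fun y => mink ('D_v n1 y) ('D_v n1 y)) x.
    by apply: near_eq_derive; apply: filterS nO => y /iso1.
  have {}h := etrans (etrans (esym (derive_mink u (d1 u) (d1 u))) h) (derive_mink u (d1 v) (d1 v)).
  apply: half_eq.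
  apply: etrans (congr1 (fun t => _ + t) (minkC _ _)) _.
  apply: etrans h _.
  exact: (congr1 (fun t => _ + t) (minkC _ _)).
have E2 : mink ('D_u ('D_u n1) x) ('D_v n1 x) = - mink ('D_u ('D_v n1) x) ('D_u n1 x).
  have h : 'D_u (fun y => mink ('D_u n1 y) ('D_v n1 y)) x = 0.
    have <- : 'D_u (cst (0 : R)) x = 0 by exact: derive_cst.
    by apply: near_eq_derive; apply: filterS nO => y /iso2.
  have {}h := etrans (esym (derive_mink u (d1 u) (d1 v))) h.
  apply/eqP; rewrite -addr_eq0; apply/eqP; apply: etrans h.
  exact: (congr1 (fun t => _ + t) (minkC _ _)).
have E3 := key _ _ E1 E2.
apply: etrans (derive_mink u (d1 u) (d2 v)) _.
apply: etrans (esym (derive_mink v (d1 u) (d2 u))).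
apply: etrans (congr1 (fun t => t + _) E3) _.
have c1 := derive_comm_mx u v oO s1 Ox.
have c2 := derive_comm_mx u v oO s2 Ox.
exact: (congr2 (fun a b => mink a ('D_u n2 x) + mink ('D_u n1 x) b) c1 c2).
Qed.

End Codazzi.

(** * Holomorphy of the (2,0)-part of <dN1, dN2> *)

Section Hopf.
Context {R : realType} {M : orientedSurface R}.
Implicit Types (c : chart R M) (p : M) (w : 'rV[R]_2).
Local Open Scope complex_scope.

Definition pairing (N1 N2 : M -> 'cV[R]_4) u v c p : R :=
  mink (dmap c N1 p u) (dmap c N2 p v).

(* The coefficient of dz^2 in the (2,0)-part of <dN1, dN2>. *)
Definition hopf (N1 N2 : M -> 'cV[R]_4) c p : R[i] :=
  ((pairing N1 N2 ux ux c p - pairing N1 N2 uy uy c p) / 4 +i*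
   - ((pairing N1 N2 ux uy c p + pairing N1 N2 uy ux c p) / 4)).

Lemma flat1_sym (y02 y03 y12 y13 z02 z03 z12 z13 : R) :
  z02 * y12 - z12 * y02 + (z03 * y13 - z13 * y03) = 0 ->
  y02 * z12 + y03 * z13 = y12 * z02 + y13 * z03.
Proof. by move=> h; apply/eqP; rewrite -subr_eq0; apply/eqP; rewrite -[RHS]oppr0 -h; ring. Qed.

Lemma double_half (a b : R) : a + b = 0 -> (a - b) / 4 = a / 2.
Proof. by move=> /eqP; rewrite addr_eq0 => /eqP ->; field. Qed.

Lemma neq0_swap (y02 y03 y12 y13 : R) : y02 * y13 - y03 * y12 != 0 ->
  y12 * y03 - y13 * y02 != 0.
Proof. by apply: contra_neq => h; rewrite -[RHS]oppr0 -h; ring. Qed.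

Lemma flat1_swap (y02 y03 y12 y13 z02 z03 z12 z13 : R) :
  z02 * y12 - z12 * y02 + (z03 * y13 - z13 * y03) = 0 ->
  z12 * y02 - z02 * y12 + (z13 * y03 - z03 * y13) = 0.
Proof. by move=> h; rewrite -[RHS]oppr0 -h; ring. Qed.

Lemma flat2_swap (y02 y03 y12 y13 z02 z03 z12 z13 : R) :
  z02 * y13 - z12 * y03 + (y02 * z13 - y12 * z03) = 0 ->
  z12 * y03 - z02 * y13 + (y12 * z03 - y02 * z13) = 0.
Proof. by move=> h; rewrite -[RHS]oppr0 -h; ring. Qed.

Lemma CauchyRiemann_half (h : 'rV[R]_2 -> 'rV[R]_2) (a b : 'rV[R]_2 -> R) x :
  differentiable h x ->
  (forall w, 'D_w h x = vec2 (2^-1 * 'D_w a x) (- 2^-1 * 'D_w b x)) ->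
  'D_ux b x = 'D_uy a x -> 'D_uy b x = - 'D_ux a x ->
  is_derive (complex_of x : R[i]^o) (1 : R[i]^o)
    (complex_of \o h \o of_complex : R[i]^o -> R[i]^o)
    (2^-1 * 'D_ux a x +i* (- 2^-1 * 'D_ux b x)).
Proof.
move=> dh Dh I1 I2; apply: CauchyRiemann_vec2 => //.
apply: etrans (Dh uy) _.
have -> : - 2^-1 * 'D_uy b x = 2^-1 * 'D_ux a x by rewrite I2 mulrNN.
by rewrite I1 mulNr opprK.
Qed.

Lemma complexE (a b a' b' : R) : a = a' -> b = b' -> a +i* b = a' +i* b'.
Proof. by move=> -> ->. Qed.

Variables (S N1 N2 e2 e3 : M -> 'cV[R]_4) (G : M -> contact R).
Hypothesis nf : null_frame S N1 N2 e2 e3.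
Hypothesis G_contact : forall p, is_contact (G p) (S p) (N1 p).
Hypothesis det1 : forall c p, atlas c -> dom c p -> frame_det N1 e2 e3 c p != 0.

Let s1 : smooth N1. Proof. by have [] := nf_smooth nf. Qed.
Let s2 : smooth N2. Proof. by have [] := nf_smooth nf. Qed.
Let null1 q : mink (N1 q) (N1 q) = 0. Proof. by have [] := nf_null nf q. Qed.

Lemma holomorphic_chart_metric c p : holomorphic_chart G c -> dom c p ->
  mink (dmap c N1 p ux) (dmap c N1 p ux) = mink (dmap c N1 p uy) (dmap c N1 p uy) /\
  mink (dmap c N1 p ux) (dmap c N1 p uy) = 0.
Proof.
move=> hc cp; have [ac _] := hc; have [h1 h2] := holomorphic_chartE hc cp.
have t0 : tau (N1 p) ^+ 2 != 0 by exact: expf_neq0 2 (envelope_tau G_contact p).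
have E w w' := envelope_III s1 null1 G_contact ac cp w w'.
have i0 := invr_neq0 t0.
split; apply: (mulIf i0).
  exact: etrans (etrans (esym (E ux ux)) h1) (E uy uy).
by rewrite mul0r; exact: etrans (esym (E ux uy)) h2.
Qed.

Lemma pairing_sym c p : atlas c -> dom c p ->
  pairing N1 N2 ux uy c p = pairing N1 N2 uy ux c p.
Proof.
move=> ac cp.
have E w w' := nf_minkE nf ac cp (dmap c N1 p w) w' (or_intror (or_intror (erefl N2))).
have h := nf_flat1 nf ac cp.
apply: etrans (E ux uy) _; apply: etrans (esym (E uy ux)).
exact: (flat1_sym h).
Qed.

Section At.
Variables (c : chart R M) (p : M).
Hypotheses (hc : holomorphic_chart G c) (cp : dom c p).
Let ac : atlas c := proj1 hc.

Lemma holomorphic_chart_xi :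
  xi N1 e2 ux c p * xi N1 e2 ux c p + xi N1 e3 ux c p * xi N1 e3 ux c p =
  xi N1 e2 uy c p * xi N1 e2 uy c p + xi N1 e3 uy c p * xi N1 e3 uy c p /\
  xi N1 e2 ux c p * xi N1 e2 uy c p + xi N1 e3 ux c p * xi N1 e3 uy c p = 0.
Proof.
have [h1 h2] := holomorphic_chart_metric hc cp.
have E w w' := nf_minkE nf ac cp (dmap c N1 p w) w' (or_intror (or_introl (erefl N1))).
split; first exact: etrans (etrans (esym (E ux ux)) h1) (E uy uy).
exact: etrans (esym (E ux uy)) h2.
Qed.

Lemma pairing_tracefree : pairing N1 N2 ux ux c p + pairing N1 N2 uy uy c p = 0.
Proof.
have [h1 h2] := holomorphic_chart_xi.
have E w w' := nf_minkE nf ac cp (dmap c N1 p w) w' (or_intror (or_intror (erefl N2))).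
apply: etrans (congr2 +%R (E ux ux) (E uy uy)) _.
exact: (conformal_tracefree h1 h2 (det1 ac cp) (nf_flat2 nf ac cp)).
Qed.

Lemma hopf_isothermal : hopf N1 N2 c p =
  (pairing N1 N2 ux ux c p / 2 +i* - (pairing N1 N2 ux uy c p / 2)).
Proof.
apply: complexE; first exact: double_half pairing_tracefree.
by congr (- _); rewrite -(pairing_sym ac cp); move: (pairing _ _ _ _ _ _) => t; field.
Qed.

End At.

Section OnChart.
Variable c : chart R M.
Hypothesis hc : holomorphic_chart G c.
Let ac : atlas c := proj1 hc.
Let O := cod c.
Let oO : open O := open_cod ac.
Let m1 := N1 \o from c.
Let m2 := N2 \o from c.
Let sm1 : smooth_on O m1 := s1 ac.
Let sm2 : smooth_on O m2 := s2 ac.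

Let pairingE u v x : O x -> pairing N1 N2 u v c (from c x) = mink ('D_u m1 x) ('D_v m2 x).
Proof.
by move=> Ox; rewrite /pairing (dmap_from N1 u ac Ox) (dmap_from N2 v ac Ox).
Qed.

Let metric x : O x -> mink ('D_ux m1 x) ('D_ux m1 x) = mink ('D_uy m1 x) ('D_uy m1 x) /\
  mink ('D_ux m1 x) ('D_uy m1 x) = 0.
Proof.
move=> Ox; have := holomorphic_chart_metric hc (from_dom ac Ox).
by rewrite (dmap_from N1 ux ac Ox) (dmap_from N1 uy ac Ox).
Qed.

Let pairing_diff u v x : O x -> differentiable (fun y => mink ('D_u m1 y) ('D_v m2 y)) x.
Proof.
move=> Ox; apply: (smooth_on_differentiable _ Ox).
exact: (smooth_on_mink oO (smooth_on_derive u sm1) (smooth_on_derive v sm2)).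
Qed.

Lemma hopf_codazzi x : O x ->
  'D_ux (fun y => mink ('D_ux m1 y) ('D_uy m2 y)) x =
  'D_uy (fun y => mink ('D_ux m1 y) ('D_ux m2 y)) x /\
  'D_uy (fun y => mink ('D_uy m1 y) ('D_ux m2 y)) x =
  'D_ux (fun y => mink ('D_uy m1 y) ('D_uy m2 y)) x.
Proof.
move=> Ox; pose p := from c x; have cp : dom c p := from_dom ac Ox.
have tY u : exists a b, 'D_u m1 x = a *: e2 p + b *: e3 p.
  by have [_ [a [b E]] _] := nf_tangent nf u ac cp; exists a, b; rewrite -E -(dmap_from N1 u ac Ox).
have tZ u : exists a b, 'D_u m2 x = a *: e2 p + b *: e3 p.
  by have [_ _ [a [b E]]] := nf_tangent nf u ac cp; exists a, b; rewrite -E -(dmap_from N2 u ac Ox).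
have on := nf_orthonormal nf p.
have xY e u : xi N1 e u c p = mink ('D_u m1 x) (e p).
  by rewrite /xi (dmap_from N1 u ac Ox).
have xZ e u : xi N2 e u c p = mink ('D_u m2 x) (e p).
  by rewrite /xi (dmap_from N2 u ac Ox).
have f1 := nf_flat1 nf ac cp; have f2 := nf_flat2 nf ac cp; have d := det1 ac cp.
rewrite !xY !xZ in f1; rewrite !xY !xZ in f2; rewrite /frame_det !xY in d.
have i1 y Oy := proj1 (metric (x := y) Oy); have i2 y Oy := proj2 (metric (x := y) Oy).
split.
  apply: (codazzi_on oO sm1 sm2 Ox i1 i2) => P Q.
  exact: (codazzi_vec on (tY ux) (tY uy) (tZ ux) (tZ uy) d f1 f2 (i1 x Ox) (i2 x Ox)).
(* The second equation is the first one with the coordinates exchanged, which reverses the signs of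
   the determinant and of both flatness expressions. *)
have i2' y : O y -> mink ('D_uy m1 y) ('D_ux m1 y) = 0 by move=> Oy; rewrite minkC i2.
apply: (codazzi_on oO sm1 sm2 Ox (fun y Oy => esym (i1 y Oy)) i2') => P Q.
apply: (codazzi_vec on (tY uy) (tY ux) (tZ uy) (tZ ux) _ _ _ (esym (i1 x Ox)) (i2' x Ox)).
- exact: neq0_swap d.
- exact: flat1_swap f1.
- exact: flat2_swap f2.
Qed.

(** In an isothermal chart the coefficient is (a - i b)/2. The first Codazzi equation is b_x = a_y;
    symmetry and trace-freeness of the pairing turn the second into b_y = - a_x. *)
Lemma hopf_holomorphic : holomorphic_on [set z | cod c (of_complex z)]
  (fun z => hopf N1 N2 c (from c (of_complex z))).
Proof.
move=> z /= Oz; set x := of_complex z in Oz *.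
pose a y := mink ('D_ux m1 y) ('D_ux m2 y); pose b y := mink ('D_ux m1 y) ('D_uy m2 y).
have da : differentiable a x := pairing_diff ux ux Oz.
have db : differentiable b x := pairing_diff ux uy Oz.
have nO : nbhs x O by exact: open_nbhs_nbhs.
pose h (y : 'rV[R]_2) : 'rV[R]_2 := of_complex (hopf N1 N2 c (from c y)).
pose a' y : R := 2^-1 * a y; pose b' y : R := - 2^-1 * b y.
have half_d (k : R) (f : 'rV[R]_2 -> R) : differentiable f x ->
    differentiable (fun y => k * f y) x /\ forall w, 'D_w (fun y => k * f y) x = k * 'D_w f x.
  move=> df; have dk : differentiable (fun _ : 'rV[R]_2 => k) x by exact: differentiable_cst.
  split=> [|w]; first exact: differentiableM dk df.
  apply: etrans (derive_mul w dk df) _.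
  by rewrite (_ : 'D_w (fun=> k) x = 0) ?mul0r ?add0r //; exact: derive_cst.
have [da' Da] := half_d 2^-1 a da; have [db' Db] := half_d (- 2^-1) b db.
have hE : \forall y \near x, vec2 (a' y) (b' y) = h y.
  apply: filterS nO => y Oy.
  rewrite /h (hopf_isothermal hc (from_dom ac Oy)) (pairingE _ _ Oy) (pairingE _ _ Oy).
  apply: (can_inj complex_ofK); rewrite of_complexK /complex_of !mxE /=.
  by apply: complexE; rewrite /a' /b' /a /b mulrC // mulrN.
have dv := differentiable_vec2 da' db'.
have dh : differentiable h x := near_eq_differentiable hE dv.
have Dh w : 'D_w h x = vec2 (2^-1 * 'D_w a x) (- 2^-1 * 'D_w b x).
  apply: etrans (esym (near_eq_derive w hE)) _.
  apply: etrans (derive_vec2 w da' db') _.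
  exact: (congr2 (@vec2 R) (Da w) (Db w)).
have [I1 I2] := hopf_codazzi Oz.
have I2' : 'D_uy b x = - 'D_ux a x.
  have e1 : 'D_uy b x = 'D_uy (fun y => mink ('D_uy m1 y) ('D_ux m2 y)) x.
    apply: near_eq_derive; apply: filterS nO => y Oy.
    apply: etrans (esym (pairingE ux uy Oy)) _.
    by apply: etrans (pairing_sym ac (from_dom ac Oy)) _; exact: pairingE.
  have e2' : 'D_ux (fun y => - a y) x = 'D_ux (fun y => mink ('D_uy m1 y) ('D_uy m2 y)) x.
    apply: near_eq_derive; apply: filterS nO => y Oy.
    apply: etrans _ (pairingE uy uy Oy); rewrite /a -(pairingE ux ux Oy).
    by apply/eqP; rewrite eq_sym -addr_eq0 addrC; apply/eqP; exact: pairing_tracefree hc (from_dom ac Oy).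
  by apply: etrans e1 _; apply: etrans I2 _; apply: etrans (esym e2') _; exact: (derive_opp ux da).
have := CauchyRiemann_half dh Dh I1 I2'.
have -> : complex_of x = z by rewrite of_complexK.
have -> : complex_of \o h \o of_complex = (fun z => hopf N1 N2 c (from c (of_complex z))).
  by apply/funext => z'; rewrite /= /h of_complexK.
by case.
Qed.

End OnChart.

End Hopf.

(** * The envelope along N1 is L-isothermic *)

Section Isothermic.
Context {R : realType} {M : orientedSurface R}.
Implicit Types (c : chart R M) (p : M) (w : 'rV[R]_2).
Local Open Scope complex_scope.

Lemma mink_bilin (a b a' b' : R) (u v u' v' : 'cV[R]_4) :
  mink (a *: u + b *: v) (a' *: u' + b' *: v') =
  a * a' * mink u u' + a * b' * mink u v' + b * a' * mink v u' + b * b' * mink v v'.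
Proof. by rewrite !minkDl !minkDr !minkZl !minkZr; ring. Qed.

Lemma dmap_mink_bilin (f g : M -> 'cV[R]_4) c p u v : smooth f -> smooth g ->
  atlas c -> dom c p ->
  mink (dmap c f p u) (dmap c g p v) =
  cx u * cx v * mink (dmap c f p ux) (dmap c g p ux) +
  cx u * cy v * mink (dmap c f p ux) (dmap c g p uy) +
  cy u * cx v * mink (dmap c f p uy) (dmap c g p ux) +
  cy u * cy v * mink (dmap c f p uy) (dmap c g p uy).
Proof.
move=> sf sg ac cp.
apply: etrans (congr2 (@mink R) (dmap_rV2 u sf ac cp) (dmap_rV2 v sg ac cp)) _.
exact: mink_bilin.
Qed.

Lemma rotation_of_isometry (a b a' b' E0 E1 F F' : R) :
  E0 = E1 -> F = 0 -> F' = 0 -> E0 != 0 -> 0 < a * b' - b * a' ->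
  a * a * E0 + a * b * F + b * a * F' + b * b * E1 =
  a' * a' * E0 + a' * b' * F + b' * a' * F' + b' * b' * E1 ->
  a * a' * E0 + a * b' * F + b * a' * F' + b * b' * E1 = 0 ->
  a' = - b /\ b' = a.
Proof.
move=> <- -> -> E0n d h1 h2.
apply: (@conformal_rotation _ a b a' b') => //; last by rewrite lt0r_neq0.
  by apply: (mulfI E0n); move: h1; rewrite !mulr0 !addr0 => h1; lra.
by apply: (mulfI E0n); move: h2; rewrite !mulr0 !addr0 => h2; lra.
Qed.

Lemma rotate_hopf (a b a' b' P00 P01 P10 P11 : R) :
  a' = - b -> b' = a -> P10 = P01 -> P00 + P11 = 0 ->
  forall Q00 Q01 Q10 Q11 : R,
  Q00 = a * a * P00 + a * b * P01 + b * a * P10 + b * b * P11 ->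
  Q01 = a * a' * P00 + a * b' * P01 + b * a' * P10 + b * b' * P11 ->
  Q10 = a' * a * P00 + a' * b * P01 + b' * a * P10 + b' * b * P11 ->
  Q11 = a' * a' * P00 + a' * b' * P01 + b' * a' * P10 + b' * b' * P11 ->
  (Q00 - Q11) / 4 +i* - ((Q01 + Q10) / 4) =
  ((P00 - P11) / 4 +i* - ((P01 + P10) / 4)) * (a +i* b) ^+ 2.
Proof.
move=> -> -> -> /eqP; rewrite addrC addr_eq0 => /eqP -> Q00 Q01 Q10 Q11 -> -> -> ->.
by apply/eqP; rewrite expr2 eq_complex /=; apply/andP; split; apply/eqP; field.
Qed.

Lemma decompose_mink (r rho S2 S3 A2 A3 B2 B3 C2 C3 X Y Z : R) :
  S2 = r * A2 + rho * B2 -> S3 = r * A3 + rho * B3 ->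
  X = S2 * C2 + S3 * C3 -> Y = A2 * C2 + A3 * C3 -> Z = B2 * C2 + B3 * C3 ->
  X = r * Y + rho * Z.
Proof. by move=> -> -> -> -> ->; ring. Qed.

Lemma det_neq0_independent (a b d e s t : R) : a * e - b * d != 0 ->
  s * a + t * d = 0 -> s * b + t * e = 0 -> s = 0 /\ t = 0.
Proof.
move=> D h1 h2; split; apply: (mulfI D); rewrite mulr0.
  by transitivity (e * (s * a + t * d) - d * (s * b + t * e)); [ring|rewrite h1 h2 !mulr0 subr0].
by transitivity (a * (s * b + t * e) - b * (s * a + t * d)); [ring|rewrite h1 h2 !mulr0 subr0].
Qed.

(** Numerator and denominator are alternating in the two tangent vectors, so a change of basis
    multiplies both by its determinant. *)
Lemma ratio_change (a b a' b' x02 x03 x12 x13 z02 z03 z12 z13 : R)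
    (X02 X03 X12 X13 Z02 Z03 Z12 Z13 : R) :
  X02 = a * x02 + b * x12 -> X12 = a' * x02 + b' * x12 ->
  X03 = a * x03 + b * x13 -> X13 = a' * x03 + b' * x13 ->
  Z02 = a * z02 + b * z12 -> Z12 = a' * z02 + b' * z12 ->
  Z03 = a * z03 + b * z13 -> Z13 = a' * z03 + b' * z13 ->
  Z02 * Z13 - Z03 * Z12 != 0 ->
  (X02 * Z13 - X03 * Z12 - (X12 * Z03 - X13 * Z02)) / (2 * (Z02 * Z13 - Z03 * Z12)) =
  (x02 * z13 - x03 * z12 - (x12 * z03 - x13 * z02)) / (2 * (z02 * z13 - z03 * z12)).
Proof.
move=> -> -> -> -> -> -> -> ->.
set D := a * b' - b * a'.
have -> : (a * z02 + b * z12) * (a' * z03 + b' * z13) -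
  (a * z03 + b * z13) * (a' * z02 + b' * z12) = D * (z02 * z13 - z03 * z12).
  by rewrite /D; ring.
rewrite mulf_eq0 negb_or => /andP[D0 d0].
have -> : (a * x02 + b * x12) * (a' * z03 + b' * z13) -
  (a * x03 + b * x13) * (a' * z02 + b' * z12) -
  ((a' * x02 + b' * x12) * (a * z03 + b * z13) -
  (a' * x03 + b' * x13) * (a * z02 + b * z12)) =
  D * (x02 * z13 - x03 * z12 - (x12 * z03 - x13 * z02)) by rewrite /D; ring.
by rewrite (mulrCA 2) -mulf_div divff // mul1r.
Qed.

Variables (S N1 N2 e2 e3 : M -> 'cV[R]_4) (G : M -> contact R).
Hypothesis nf : null_frame S N1 N2 e2 e3.
Hypothesis G_contact : forall p, is_contact (G p) (S p) (N1 p).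
Hypothesis det1 : forall c p, atlas c -> dom c p -> frame_det N1 e2 e3 c p != 0.
Hypothesis det2 : forall c p, atlas c -> dom c p -> frame_det N2 e2 e3 c p != 0.

Let sS : smooth S. Proof. by have [] := nf_smooth nf. Qed.
Let s1 : smooth N1. Proof. by have [] := nf_smooth nf. Qed.
Let s2 : smooth N2. Proof. by have [] := nf_smooth nf. Qed.
Let null1 q : mink (N1 q) (N1 q) = 0. Proof. by have [] := nf_null nf q. Qed.

Lemma mink_dN1_gt0 c p w : atlas c -> dom c p -> w != 0 ->
  0 < mink (dmap c N1 p w) (dmap c N1 p w).
Proof.
move=> ac cp w0; have [_ hN _] := nf_tangent nf w ac cp.
have E := tangent_mink (dmap c N1 p w) (nf_orthonormal nf p) hN.
suff : 0 < mink (dmap c N1 p w) (e2 p) ^+ 2 + mink (dmap c N1 p w) (e3 p) ^+ 2.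
  by move=> h; rewrite E -!expr2.
rewrite lt_def addr_ge0 ?sqr_ge0 // andbT; apply: contra_neq w0 => /eqP.
rewrite paddr_eq0 ?sqr_ge0 // !sqrf_eq0 => /andP[/eqP h2 /eqP h3].
have z2 := etrans (esym (xi_bvec e2 w s1 ac cp)) h2.
have z3 := etrans (esym (xi_bvec e3 w s1 ac cp)) h3.
have [a0 b0] := det_neq0_independent (det1 ac cp) z2 z3.
by rewrite (rV2E w) a0 b0 !scale0r addr0.
Qed.

Lemma ux_neq0 : ux != 0 :> 'rV[R]_2.
Proof.
apply/eqP => h; have := congr1 cx h; rewrite cx_ux cx0 => /eqP.
by rewrite oner_eq0.
Qed.

Lemma envelope_III_posdef : III_posdef G.
Proof.
move=> c p w ac cp w0; have t0 := envelope_tau G_contact p.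
rewrite (envelope_III s1 null1 G_contact ac cp w w).
by apply: divr_gt0; [exact: mink_dN1_gt0|rewrite exprn_even_gt0].
Qed.

Lemma envelope_immersion : contact_immersion G.
Proof.
move=> c p w ac cp w0 [_ dn0]; have := envelope_III_posdef ac cp w0.
by rewrite /III dn0 dot0l ltxx.
Qed.

Section Transition.
Variables (c c' : chart R M) (p : M).
Hypotheses (hc : holomorphic_chart G c) (hc' : holomorphic_chart G c').
Hypotheses (cp : dom c p) (cp' : dom c' p).
Let ac : atlas c := proj1 hc.
Let ac' : atlas c' := proj1 hc'.
Let h := to c' \o from c.
Let tx : 'rV[R]_2 := 'D_ux h (to c p).
Let ty : 'rV[R]_2 := 'D_uy h (to c p).

Let dh : differentiable h (to c p).
Proof.
have [so _] := atlas_compatible ac ac'.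
by apply: (smooth_on_differentiable so); exists p.
Qed.

(** The transition map between two isothermal charts has a conformal differential, and compatibility
    of the charts makes its determinant positive. *)
Lemma holomorphic_transition : cx ty = - cy tx /\ cy ty = cx tx.
Proof.
have [_ so] := atlas_compatible ac ac'.
have detp : 0 < cx tx * cy ty - cy tx * cx ty.
  by rewrite -(det_jacobian dh); apply: so; exists p.
have [i1 i2] := holomorphic_chart_metric nf G_contact hc cp.
have [i1' i2'] := holomorphic_chart_metric nf G_contact hc' cp'.
have E00 := mink_dN1_gt0 ac' cp' ux_neq0.
have chain u := dmap_chain u s1 ac ac' cp cp'.
have bil u v := dmap_mink_bilin u v s1 s1 ac' cp'.
have i2'' := etrans (minkC (dmap c' N1 p uy) (dmap c' N1 p ux)) i2'.
apply: (rotation_of_isometry i1' i2' i2'' (lt0r_neq0 E00) detp).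
  apply: etrans (etrans (esym (bil tx tx)) _) (bil ty ty).
  apply: etrans (congr2 (@mink R) (esym (chain ux)) (esym (chain ux))) _.
  apply: etrans i1 _.
  exact: (congr2 (@mink R) (chain uy) (chain uy)).
apply: etrans (esym (bil tx ty)) _.
exact: etrans (congr2 (@mink R) (esym (chain ux)) (esym (chain uy))) i2.
Qed.

Lemma transition_derivE : transition_deriv c c' p = (cx tx +i* cy tx).
Proof.
have [h1 h2] := holomorphic_transition.
have D0 : 'D_ux h (to c p) = vec2 (cx tx) (cy tx) by exact: vec2E.
have D1 : 'D_uy h (to c p) = vec2 (- cy tx) (cx tx).
  exact: etrans (vec2E ty) (congr2 (@vec2 R) h1 h2).
have [_ E] := CauchyRiemann_vec2 dh D0 D1.
exact: E.
Qed.

Lemma hopf_transition : hopf N1 N2 c p = hopf N1 N2 c' p * transition_deriv c c' p ^+ 2.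
Proof.
rewrite transition_derivE; have [h1 h2] := holomorphic_transition.
have chain1 u := dmap_chain u s1 ac ac' cp cp'.
have chain2 u := dmap_chain u s2 ac ac' cp cp'.
have bil u v : pairing N1 N2 u v c p = mink (dmap c' N1 p ('D_u h (to c p)))
   (dmap c' N2 p ('D_v h (to c p))) by exact: (congr2 (@mink R) (chain1 u) (chain2 v)).
have B u v := etrans (bil u v) (dmap_mink_bilin _ _ s1 s2 ac' cp').
exact: (rotate_hopf h1 h2 (esym (pairing_sym nf ac' cp'))
  (pairing_tracefree nf G_contact det1 hc' cp') (B ux ux) (B ux uy) (B uy ux) (B uy uy)).
Qed.

End Transition.

Lemma curvature_ratio_chart c c' p : atlas c -> atlas c' -> dom c p -> dom c' p ->
  curvature_ratio S N2 e2 e3 c p = curvature_ratio S N2 e2 e3 c' p.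
Proof.
move=> ac ac' cp cp'.
have E f e u (sf : smooth f) : xi f e u c p =
    cx ('D_u (to c' \o from c) (to c p)) * xi f e ux c' p +
    cy ('D_u (to c' \o from c) (to c p)) * xi f e uy c' p.
  apply: etrans (congr1 (fun t => mink t (e p)) (dmap_chain u sf ac ac' cp cp')) _.
  exact: xi_bvec.
exact: (ratio_change (E S e2 ux sS) (E S e2 uy sS) (E S e3 ux sS) (E S e3 uy sS)
  (E N2 e2 ux s2) (E N2 e2 uy s2) (E N2 e3 ux s2) (E N2 e3 uy s2) (det2 ac cp)).
Qed.

Let chart_at p : chart R M := s2val (cid2 (atlas_cover p)).
Let chart_atP p : atlas (chart_at p) /\ dom (chart_at p) p.
Proof. by rewrite /chart_at; case: cid2. Qed.

Definition isothermic_factor p : R :=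
  curvature_ratio S N2 e2 e3 (chart_at p) p / tau (N1 p).

(** [chart_at] may jump from point to point; as the ratio does not depend on the chart, a fixed
    chart replaces it locally, where the factor is a quotient of smooth functions. *)
Lemma smooth_isothermic_factor : smooth isothermic_factor.
Proof.
have [se2 se3] := nf_smooth_plane nf.
apply: smoothM; last by apply: smoothV; [exact: (envelope_tau G_contact)|exact: smooth_tau].
move=> c ac; have oc := open_cod ac.
have xs f e u : smooth f -> smooth e ->
    smooth_on (cod c) (fun x => xi f e u c (from c x)).
  move=> sf se.
  have := smooth_on_mink oc (smooth_on_derive u (sf c ac)) (se c ac).
  apply: (eq_smooth_on oc) => x Ox.
  by apply: (congr1 (fun t => mink t (e (from c x)))); apply/esym; exact: dmap_from.
have m f e f' e' u v (sf : smooth f) (se : smooth e) (sf' : smooth f') (se' : smooth e') :=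
  smooth_onM oc (xs f e u sf se) (xs f' e' v sf' se').
have N' (f g : 'rV[R]_2 -> R) (sf : smooth_on (cod c) f) (sg : smooth_on (cod c) g) :=
  smooth_onD oc sf (smooth_onN oc sg).
have num := N' _ _ (N' _ _ (m _ _ _ _ ux uy sS se2 s2 se3) (m _ _ _ _ ux uy sS se3 s2 se2))
  (N' _ _ (m _ _ _ _ uy ux sS se2 s2 se3) (m _ _ _ _ uy ux sS se3 s2 se2)).
have den := smooth_onM oc (smooth_on_cst oc (2 : R))
  (N' _ _ (m _ _ _ _ ux uy s2 se2 s2 se3) (m _ _ _ _ ux uy s2 se3 s2 se2)).
have den0 x : cod c x -> 2 * frame_det N2 e2 e3 c (from c x) != 0.
  by move=> Ox; apply: mulf_neq0; [rewrite pnatr_eq0|exact: det2 ac (from_dom ac Ox)].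
have := smooth_onM oc num (smooth_onV oc den0 den).
apply: (eq_smooth_on oc) => x Ox.
have [a1 a2] := chart_atP (from c x).
exact: (curvature_ratio_chart ac a1 (from_dom ac Ox) a2).
Qed.

Lemma factor_algebra (r rho t T gxx gxy gyx gyy Pxx Pxy Pyx Pyy IIxx IIxy IIyx IIyy
    IIIxx IIIxy IIIyx IIIyy : R) :
  gxx = gyy -> gxy = 0 -> gyx = 0 -> IIIxx = IIIyy -> IIIxy = 0 -> IIIyx = 0 ->
  IIxx = (r * gxx + rho * Pxx) / t - T * IIIxx ->
  IIxy = (r * gxy + rho * Pyx) / t - T * IIIxy ->
  IIyx = (r * gyx + rho * Pxy) / t - T * IIIyx ->
  IIyy = (r * gyy + rho * Pyy) / t - T * IIIyy ->
  (IIxx - IIyy) / 4 +i* - ((IIxy + IIyx) / 4) =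
  (rho / t)%:C * ((Pxx - Pyy) / 4 +i* - ((Pxy + Pyx) / 4)).
Proof.
move=> -> -> -> -> -> -> -> -> -> ->.
apply/eqP; rewrite eq_complex /=; apply/andP; split; apply/eqP; ring.
Qed.

(** In II the terms r1 <dN1, dN1> / tau N1 and (tau S) III are multiples of the conformal metric and
    have no (2,0)-part, which leaves r2 <dN1, dN2> / tau N1. *)
Lemma II20_factor c p : holomorphic_chart G c -> dom c p ->
  II20 G c p = (isothermic_factor p)%:C * hopf N1 N2 c p.
Proof.
move=> hc cp; have ac := proj1 hc.
have [a1 a2] := chart_atP p.
have -> : isothermic_factor p = curvature_ratio S N2 e2 e3 c p / tau (N1 p).
  exact: (congr1 (fun t => t / tau (N1 p)) (curvature_ratio_chart a1 ac a2 cp)).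
have [r hr] := nf_decomposition nf ac cp (det1 ac cp) (det2 ac cp).
have [g1 g2] := holomorphic_chart_metric nf G_contact hc cp.
have g3 := etrans (minkC (dmap c N1 p uy) (dmap c N1 p ux)) g2.
have [i1 i2] := holomorphic_chartE hc cp.
have III_C u v : III G c p u v = III G c p v u.
  apply: etrans (envelope_III s1 null1 G_contact ac cp u v) _.
  apply: etrans (esym (envelope_III s1 null1 G_contact ac cp v u)).
  exact: (congr1 (fun t => t / _) (minkC _ _)).
have i3 := etrans (III_C uy ux) i2.
have E u v : II G c p u v = (r * mink (dmap c N1 p u) (dmap c N1 p v) +
    curvature_ratio S N2 e2 e3 c p * pairing N1 N2 v u c p) / tau (N1 p) -
    tau (S p) * III G c p u v.
  apply: etrans (envelope_II sS s1 null1 (nf_S_normal1 nf) G_contact ac cp u v) _.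
  congr (_ / _ - _); have [hS hN hN2] := nf_tangent nf v ac cp.
  have [hu2 hu3] := hr u.
  have T1 := tangent_mink (dmap c S p u) (nf_orthonormal nf p) hN.
  have T2 := tangent_mink (dmap c N1 p u) (nf_orthonormal nf p) hN.
  have T3 := tangent_mink (dmap c N2 p u) (nf_orthonormal nf p) hN.
  have C : pairing N1 N2 v u c p = mink (dmap c N2 p u) (dmap c N1 p v) by exact: minkC.
  exact: (decompose_mink hu2 hu3 T1 T2 (etrans C T3)).
apply: etrans (II20E G c p) _.
exact: (factor_algebra g1 g2 g3 i1 i2 i3 (E ux ux) (E ux uy) (E uy ux) (E uy uy)).
Qed.

Lemma envelope_L_isothermic : L_isothermic_immersion G.
Proof.
split.
- exact: (envelope_legendre sS s1 null1 (nf_S_normal1 nf) G_contact).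
- exact: envelope_immersion.
- exact: envelope_III_posdef.
exists (hopf N1 N2), isothermic_factor; split.
- split=> [c hc|c c' p hc hc' cp cp']; first exact: (hopf_holomorphic nf G_contact det1 hc).
  exact: hopf_transition.
- exact: smooth_isothermic_factor.
- by move=> c p hc cp; exact: II20_factor.
Qed.

End Isothermic.

(** * Superposition *)

Section FrameCoordinates.
Context {R : realType} {M : orientedSurface R}.
Implicit Types (c : chart R M) (p : M) (w : 'rV[R]_2).

Definition col4 (a b d e : R) : 'cV[R]_4 := \col_i nth 0 [:: a; b; d; e] i.

Lemma col4E (u : 'cV[R]_4) : u = col4 (u k1 0) (u k2 0) (u k3 0) (u k4 0).
Proof. by apply/colP; elim/forall_ord4; rewrite mxE. Qed.

Lemma col4_entries (a b d e : R) :
  [/\ col4 a b d e k1 0 = a, col4 a b d e k2 0 = b, col4 a b d e k3 0 = d & col4 a b d e k4 0 = e].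
Proof. by rewrite !mxE. Qed.

Transparent mink.
Lemma mink_col4 (a b d e a' b' d' e' : R) : mink (col4 a b d e) (col4 a' b' d' e') =
  - (a * e' + e * a') + b * b' + d * d'.
Proof. by rewrite /mink !mxE. Qed.

Lemma mink_delta (u : 'cV[R]_4) :
  [/\ mink u (delta_mx k1 0) = - u k4 0, mink u (delta_mx k2 0) = u k2 0,
      mink u (delta_mx k3 0) = u k3 0 & mink u (delta_mx k4 0) = - u k1 0].
Proof. by rewrite /mink !mxE /=; split; ring. Qed.
Local Opaque mink.

Lemma col4D (a b d e a' b' d' e' : R) :
  col4 a b d e + col4 a' b' d' e' = col4 (a + a') (b + b') (d + d') (e + e').
Proof. by apply/colP; elim/forall_ord4; rewrite !mxE. Qed.

Lemma col4Z (k a b d e : R) : k *: col4 a b d e = col4 (k * a) (k * b) (k * d) (k * e).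
Proof. by apply/colP; elim/forall_ord4; rewrite !mxE. Qed.

Lemma smooth_col4 (a b d e : M -> R) : smooth a -> smooth b -> smooth d -> smooth e ->
  smooth (fun p => col4 (a p) (b p) (d p) (e p)).
Proof.
move=> sa sb sd se; apply: smooth_mx => i j.
have -> : (fun p => col4 (a p) (b p) (d p) (e p) i j) = (fun p => nth 0 [:: a p; b p; d p; e p] i).
  by apply/funext => p; rewrite mxE.
by elim/forall_ord4: i.
Qed.

Lemma dmap_col4 (a b d e : M -> R) c p w : smooth a -> smooth b -> smooth d -> smooth e ->
  atlas c -> dom c p ->
  dmap c (fun p => col4 (a p) (b p) (d p) (e p)) p w =
  col4 (dmap c a p w) (dmap c b p w) (dmap c d p w) (dmap c e p w).
Proof.
move=> sa sb sd se ac cp; apply/matrixP => i j.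
apply: etrans (dmap_entry ac cp w i j (smooth_col4 sa sb sd se)) _.
have -> : (fun p => col4 (a p) (b p) (d p) (e p) i j) = (fun p => nth 0 [:: a p; b p; d p; e p] i).
  by apply/funext => q; rewrite mxE.
by rewrite mxE; elim/forall_ord4: i.
Qed.

Lemma smooth_mulmx {m n k} (f : M -> 'M[R]_(m, n)) (g : M -> 'M[R]_(n, k)) :
  smooth f -> smooth g -> smooth (fun p => f p *m g p).
Proof.
move=> sf sg; apply: smooth_mx => i j.
have -> : (fun p => (f p *m g p) i j) = (fun p => \sum_l f p i l * g p l j).
  by apply/funext => p; rewrite mxE.
elim: (index_enum _) => [|l s IH].
  have -> : (fun p => \sum_(l <- [::]) f p i l * g p l j) = (fun=> 0).
    by apply/funext => p; rewrite big_nil.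
  exact: smooth_cst.
have -> : (fun p => \sum_(l <- l :: s) f p i l * g p l j) =
    (fun p => f p i l * g p l j + \sum_(l <- s) f p i l * g p l j).
  by apply/funext => p; rewrite big_cons.
by apply: smoothD => //; apply: smoothM; exact: smooth_entry.
Qed.

Lemma dmap_mulmx (f : M -> 'M[R]_4) (g : M -> 'cV[R]_4) c p w : smooth f -> smooth g ->
  atlas c -> dom c p ->
  dmap c (fun q => f q *m g q) p w =
  (dmap c f p w : 'M[R]_4) *m g p + f p *m (dmap c g p w : 'cV[R]_4).
Proof.
move=> sf sg ac cp; apply/matrixP => i j.
have sm l : smooth (fun q => f q i l * g q l j) by apply: smoothM; exact: smooth_entry.
have dm l : dmap c (fun q => f q i l * g q l j) p w =
    dmap c f p w i l * g p l j + f p i l * dmap c g p w l j.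
  apply: etrans (dmapM ac cp w (smooth_entry i l sf) (smooth_entry l j sg)) _.
  exact: (congr2 (fun a b => a * g p l j + f p i l * b)
    (esym (dmap_entry ac cp w i l sf)) (esym (dmap_entry ac cp w l j sg))).
apply: etrans (dmap_entry ac cp w i j (smooth_mulmx sf sg)) _.
have -> : (fun q => (f q *m g q) i j) =
    (fun q => f q i k1 * g q k1 j + f q i k2 * g q k2 j + f q i k3 * g q k3 j + f q i k4 * g q k4 j).
  by apply/funext => q; rewrite mxE sum_ord4.
have s12 := smoothD (sm k1) (sm k2); have s123 := smoothD s12 (sm k3).
apply: etrans (dmapD ac cp w s123 (sm k4)) _.
apply: etrans (congr1 (fun t => t + _) (dmapD ac cp w s12 (sm k3))) _.
apply: etrans (congr1 (fun t => t + _ + _) (dmapD ac cp w (sm k1) (sm k2))) _.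
rewrite (dm k1) (dm k2) (dm k3) (dm k4) !mxE !sum_ord4.
move: (dmap c f p w : 'M[R]_4) (dmap c g p w : 'cV[R]_4) => X Y; ring.
Qed.

Section Framing.
Variable A : framing M.
Hypothesis A_flat : curved_flat A.

Let s0 : smooth (fpoint A). Proof. by have [[]] := A_flat. Qed.
Let sQ : smooth (fmat A). Proof. by have [[]] := A_flat. Qed.

Lemma fmat_isometry p (y z : 'cV[R]_4) : mink (fmat A p *m y) (fmat A p *m z) = mink y z.
Proof. by have [[_ _ h] _ _ _] := A_flat; exact: SO0_isometry. Qed.

Lemma fmat_unit p : fmat A p \in unitmx.
Proof. exact: isometry_unit (@fmat_isometry p). Qed.

Lemma fvecE j p : fvec A j p = fmat A p *m delta_mx j 0.
Proof. by rewrite /fvec colE. Qed.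

Lemma fmat_col4 p (a b d e : R) : fmat A p *m col4 a b d e =
  a *: fvec A k1 p + b *: fvec A k2 p + d *: fvec A k3 p + e *: fvec A k4 p.
Proof.
by apply/colP => i; rewrite !mxE sum_ord4 !mxE /=; ring.
Qed.

Lemma fmat_inj p (y z : 'cV[R]_4) : fmat A p *m y = fmat A p *m z -> y = z.
Proof. by move=> h; rewrite -[y](mulKmx (fmat_unit p)) h mulKmx // fmat_unit. Qed.

Lemma dmap_fpoint c p w : dmap c (fpoint A) p w = fmat A p *m alpha0 A c p w.
Proof. by rewrite /alpha0 mulKVmx // fmat_unit. Qed.

Lemma dmap_fmat c p w : dmap c (fmat A) p w = fmat A p *m alpha' A c p w.
Proof. by rewrite /alpha' mulKVmx // fmat_unit. Qed.

Local Opaque alpha' alpha0.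

Section At.
Variables (c : chart R M) (p : M) (w : 'rV[R]_2).
Hypotheses (ac : atlas c) (cp : dom c p).
Let al i j := alpha' A c p w i j.

Let skew i j : mink (col i (alpha' A c p w)) (delta_mx j 0) +
  mink (col j (alpha' A c p w)) (delta_mx i 0) = 0.
Proof.
have sc k : smooth (fun q => fmat A q *m delta_mx k 0 : 'cV[R]_4).
  by apply: smooth_mulmx => //; exact: smooth_cst.
have dc k : dmap c (fun q => fmat A q *m delta_mx k 0) p w = fmat A p *m col k (alpha' A c p w).
  apply: etrans (dmap_mulmx w sQ (smooth_cst _) ac cp) _.
  rewrite dmap_cst mulmx0 addr0 colE.
  by apply: etrans (congr1 (fun X : 'M[R]_4 => X *m _) (dmap_fmat c p w)) _; rewrite mulmxA.
have h : dmap c (fun q => mink (fmat A q *m delta_mx i 0) (fmat A q *m delta_mx j 0)) p w = 0.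
  have -> : (fun q => mink (fmat A q *m delta_mx i 0) (fmat A q *m delta_mx j 0)) =
    (fun=> mink (delta_mx i 0) (delta_mx j 0)) by apply/funext => q; exact: fmat_isometry.
  exact: dmap_cst.
have := etrans (esym (dmap_mink ac cp w (sc i) (sc j))) h.
by rewrite (dc i) (dc j) !fmat_isometry (minkC (delta_mx i 0)).
Qed.

(** The products of the frame vectors are constant, so the connection form is skew for the Minkowski
    form; the normalization alpha^1_1 = 0 then gives alpha^4_4 = 0. *)
Lemma alpha'_entries :
  [/\ al k4 k1 = 0 /\ al k1 k4 = 0, al k2 k2 = 0 /\ al k3 k3 = 0,
      al k1 k1 = 0 /\ al k4 k4 = 0,
      [/\ al k4 k2 = al k2 k1, al k4 k3 = al k3 k1, al k2 k4 = al k1 k2 & al k3 k4 = al k1 k3] &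
      al k2 k3 = - al k3 k2].
Proof.
have a11 : al k1 k1 = 0 by have [_ _ h _] := A_flat; exact: h.
have E i j : col i (alpha' A c p w) j 0 = al j i by rewrite mxE.
have S i j := skew i j.
have D i := mink_delta (col i (alpha' A c p w)).
have S11 := S k1 k1; have S44 := S k4 k4; have S22 := S k2 k2; have S33 := S k3 k3.
have S12 := S k1 k2; have S13 := S k1 k3; have S42 := S k4 k2; have S43 := S k4 k3.
have S23 := S k2 k3; have S14 := S k1 k4.
have [D11 D12 D13 D14] := D k1; have [D21 D22 D23 D24] := D k2.
have [D31 D32 D33 D34] := D k3; have [D41 D42 D43 D44] := D k4.
rewrite D11 !E in S11; rewrite D44 !E in S44; rewrite D22 !E in S22; rewrite D33 !E in S33.
rewrite D12 D21 !E in S12; rewrite D13 D31 !E in S13; rewrite D42 D24 !E in S42.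
rewrite D43 D34 !E in S43; rewrite D23 D32 !E in S23; rewrite D14 D41 !E a11 in S14.
move: a11 S11 S44 S22 S33 S12 S13 S42 S43 S23 S14; clear.
move: (al k1 k1) (al k1 k2) (al k1 k3) (al k1 k4) (al k2 k1) (al k2 k2) (al k2 k3) (al k2 k4).
move: (al k3 k1) (al k3 k2) (al k3 k3) (al k3 k4) (al k4 k1) (al k4 k2) (al k4 k3) (al k4 k4).
move=> *; split; [split|split|split|split|]; lra.
Qed.

Lemma alpha0_entries : alpha0 A c p w = col4 0 (alpha0 A c p w k2 0) (alpha0 A c p w k3 0) 0.
Proof.
have [_ h _ _] := A_flat; have [h1 h4] := h c p w ac cp.
by rewrite [LHS]col4E h1 h4.
Qed.

Lemma alpha'_mul (y1 y2 y3 y4 : R) : alpha' A c p w *m col4 y1 y2 y3 y4 =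
  col4 (al k1 k2 * y2 + al k1 k3 * y3)
       (al k2 k1 * y1 - al k3 k2 * y3 + al k1 k2 * y4)
       (al k3 k1 * y1 + al k3 k2 * y2 + al k1 k3 * y4)
       (al k2 k1 * y2 + al k3 k1 * y3).
Proof.
have := alpha'_entries; rewrite /al; move: (alpha' A c p w) => X.
move=> [[h41 h14] [h22 h33] [h11 h44] [h42 h43 h24 h34] h23].
apply/colP; elim/forall_ord4; rewrite mxE sum_ord4 !mxE /=.
- by rewrite h11 h14; ring.
- by rewrite h22 h23 h24; ring.
- by rewrite h33 h34; ring.
- by rewrite h41 h42 h43 h44; ring.
Qed.

(** The rule d(a y) = a (dy + alpha' y), with the relations between the entries of alpha' already
    inserted. *)
Lemma dmap_frame (y1 y2 y3 y4 : M -> R) :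
  smooth y1 -> smooth y2 -> smooth y3 -> smooth y4 ->
  dmap c (fun q => fmat A q *m col4 (y1 q) (y2 q) (y3 q) (y4 q)) p w =
  fmat A p *m col4
    (dmap c y1 p w + (al k1 k2 * y2 p + al k1 k3 * y3 p))
    (dmap c y2 p w + (al k2 k1 * y1 p - al k3 k2 * y3 p + al k1 k2 * y4 p))
    (dmap c y3 p w + (al k3 k1 * y1 p + al k3 k2 * y2 p + al k1 k3 * y4 p))
    (dmap c y4 p w + (al k2 k1 * y2 p + al k3 k1 * y3 p)).
Proof.
move=> s1 s2 s3 s4.
apply: etrans (dmap_mulmx w sQ (smooth_col4 s1 s2 s3 s4) ac cp) _.
apply: etrans (congr2 (fun (X : 'M[R]_4) (Y : 'cV[R]_4) => X *m _ + _ *m Y)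
  (dmap_fmat c p w) (dmap_col4 w s1 s2 s3 s4 ac cp)) _.
by rewrite -mulmxA alpha'_mul -mulmxDr addrC col4D.
Qed.

End At.
End Framing.
End FrameCoordinates.

Local Opaque alpha' alpha0 mink.

(** * The null frame of a superposition *)

Section Superposition.
Context {R : realType} {M : orientedSurface R}.
Implicit Types (c : chart R M) (p : M) (w : 'rV[R]_2).

Lemma dmapMl (k : R) (a : M -> R) c p w : smooth a -> atlas c -> dom c p ->
  dmap c (fun q => k * a q) p w = k * dmap c a p w.
Proof.
move=> sa ac cp; apply: etrans (dmapM ac cp w (smooth_cst k) sa) _.
by rewrite dmap_cst mul0r add0r.
Qed.

Lemma smoothMl (k : R) (a : M -> R) : smooth a -> smooth (fun q => k * a q).
Proof. by move=> sa; apply: smoothM => //; exact: smooth_cst. Qed.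

Lemma alpha'_lam_mul (lam : R) (X : 'M[R]_4) (y : 'cV[R]_4) :
  [/\ (alpha'_lam lam X *m y) k1 0 = lam * (X k1 k2 * y k2 0 + X k1 k3 * y k3 0),
      (alpha'_lam lam X *m y) k2 0 =
        X k2 k1 * y k1 0 - X k3 k2 * y k3 0 + lam * X k1 k2 * y k4 0,
      (alpha'_lam lam X *m y) k3 0 =
        X k3 k1 * y k1 0 + X k3 k2 * y k2 0 + lam * X k1 k3 * y k4 0 &
      (alpha'_lam lam X *m y) k4 0 = X k2 k1 * y k2 0 + X k3 k1 * y k3 0].
Proof. by split; rewrite mxE sum_ord4 !mxE /=; ring. Qed.

Variables (A : framing M) (lam : R) (v : M -> 'cV[R]_4) (r : M -> R).
Hypothesis A_flat : curved_flat A.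
Hypotheses (sv : smooth v) (sr : smooth r).
Hypothesis v_cone : forall p, lightcone (v p).
Hypothesis dv : for_all_tangent (fun c p w =>
  dmap c v p w = - (alpha'_lam lam (alpha' A c p w) *m v p)).
Hypothesis dr : for_all_tangent (fun c p w =>
  dmap c r p w = v p k2 0 * alpha0 A c p w k2 0 + v p k3 0 * alpha0 A c p w k3 0).
Hypotheses (lam0 : lam != 0) (v1 : forall p, v p k1 0 != 0).

Lemma v_null p : v p k2 0 ^+ 2 + v p k3 0 ^+ 2 = 2 * v p k1 0 * v p k4 0.
Proof.
have [_ h _] := v_cone p; move: h; rewrite {1 2}(col4E (v p)) mink_col4.
by move: (v p k1 0) (v p k2 0) (v p k3 0) (v p k4 0) => a b d e h; lra.
Qed.

Lemma smooth_v i : smooth (fun q => v q i 0).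
Proof. exact: smooth_entry. Qed.

Lemma dv_entries c p w (X := alpha' A c p w) (y := v p) : atlas c -> dom c p ->
  [/\ dmap c (fun q => v q k1 0) p w = - (lam * (X k1 k2 * y k2 0 + X k1 k3 * y k3 0)),
      dmap c (fun q => v q k2 0) p w =
        - (X k2 k1 * y k1 0 - X k3 k2 * y k3 0 + lam * X k1 k2 * y k4 0),
      dmap c (fun q => v q k3 0) p w =
        - (X k3 k1 * y k1 0 + X k3 k2 * y k2 0 + lam * X k1 k3 * y k4 0) &
      dmap c (fun q => v q k4 0) p w = - (X k2 k1 * y k2 0 + X k3 k1 * y k3 0)].
Proof.
move=> ac cp; have [h1 h2 h3 h4] := alpha'_lam_mul lam X y.
have E i : dmap c (fun q => v q i 0) p w = - (alpha'_lam lam X *m y) i 0.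
  apply: etrans (esym (dmap_entry ac cp w i 0 sv)) _.
  by apply: etrans (congr1 (fun Y : 'cV[R]_4 => Y i 0) (dv w ac cp)) _; rewrite mxE.
by rewrite (E k1) (E k2) (E k3) (E k4) h1 h2 h3 h4.
Qed.

(** The multiple of a_4 whose product with the superposition direction is -1. The a_4-coefficients
    of the vectors e_2 and e_3 below are the ones that make them orthogonal to that direction. *)
Definition superposition_normal p : 'cV[R]_4 := fmat A p *m col4 0 0 0 (lam * (v p k1 0)^-1).
Definition superposition_e2 p : 'cV[R]_4 :=
  fmat A p *m col4 0 1 0 (lam * v p k2 0 * (v p k1 0)^-1).
Definition superposition_e3 p : 'cV[R]_4 :=
  fmat A p *m col4 0 0 1 (lam * v p k3 0 * (v p k1 0)^-1).

Let S := superposition_congruence A lam v r.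
Let D := superposition_direction A lam v.
Let N := superposition_normal.
Let e2 := superposition_e2.
Let e3 := superposition_e3.

Lemma superposition_directionE p : D p =
  fmat A p *m col4 (lam^-1 * v p k1 0) (v p k2 0) (v p k3 0) (lam * v p k4 0).
Proof. by rewrite fmat_col4. Qed.

Lemma superposition_congruenceE p : S p =
  fpoint A p + fmat A p *m col4 0 0 0 (lam * r p * (v p k1 0)^-1).
Proof. by rewrite fmat_col4 !scale0r !add0r. Qed.

Lemma smooth_iv1 : smooth (fun q => (v q k1 0)^-1).
Proof. by apply: smoothV => //; exact: smooth_v. Qed.

Lemma fmat_combination (Q : 'M[R]_4) (k a b : R) (y z : 'cV[R]_4) :
  k *: (a *: (Q *m y) + b *: (Q *m z)) = Q *m (k *: (a *: y + b *: z)).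
Proof. by rewrite !scalemxAr -mulmxDr scalemxAr. Qed.

(** The powers of lambda in the direction make dv cancel the terms in alpha^3_2 and alpha^1_j; the
    terms in alpha^j_1 remain, once with factor 1/lambda and once with -1. *)
Lemma dmap_superposition_direction c p w : atlas c -> dom c p ->
  dmap c D p w = ((lam^-1 - 1) * v p k1 0) *:
    (alpha' A c p w k2 k1 *: e2 p + alpha' A c p w k3 k1 *: e3 p).
Proof.
move=> ac cp; have -> : D = (fun q => fmat A q *m col4 (lam^-1 * v q k1 0) (v q k2 0)
    (v q k3 0) (lam * v q k4 0)) by apply/funext => q; exact: superposition_directionE.
apply: etrans (dmap_frame A_flat w ac cp (smoothMl lam^-1 (smooth_v k1)) (smooth_v k2)
  (smooth_v k3) (smoothMl lam (smooth_v k4))) _.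
have [h1 h2 h3 h4] := dv_entries w ac cp.
rewrite (dmapMl lam^-1 w (smooth_v k1) ac cp) (dmapMl lam w (smooth_v k4) ac cp) h1 h2 h3 h4.
rewrite /e2 /e3 /superposition_e2 /superposition_e3 fmat_combination !col4Z col4D col4Z.
congr (_ *m _); move: lam0 (v1 p).
move: (alpha' A c p w) (v p) => X y; move: (y k1 0) (y k2 0) (y k3 0) (y k4 0) => y1 y2 y3 y4.
move: (X k1 k2) (X k1 k3) (X k2 k1) (X k3 k1) (X k3 k2) => a b d e f l0 y0.
by congr col4; field; rewrite ?l0 ?y0.
Qed.

Lemma dmap_superposition_normal c p w : atlas c -> dom c p ->
  dmap c N p w = (lam / v p k1 0) *:
    (alpha' A c p w k1 k2 *: e2 p + alpha' A c p w k1 k3 *: e3 p).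
Proof.
move=> ac cp; apply: etrans (dmap_frame A_flat w ac cp (smooth_cst 0) (smooth_cst 0)
  (smooth_cst 0) (smoothMl lam smooth_iv1)) _.
have [h1 h2 h3 h4] := dv_entries w ac cp.
rewrite (dmapMl lam w smooth_iv1 ac cp) (dmapV ac cp w v1 (smooth_v k1)) h1 !dmap_cst.
rewrite /e2 /e3 /superposition_e2 /superposition_e3 fmat_combination !col4Z col4D col4Z.
congr (_ *m _); move: (v1 p).
move: (alpha' A c p w) (v p) => X y; move: (y k1 0) (y k2 0) (y k3 0) (y k4 0) => y1 y2 y3 y4.
move: (X k1 k2) (X k1 k3) (X k2 k1) (X k3 k1) (X k3 k2) => a b d e f y0.
by congr col4; field; rewrite ?y0.
Qed.

Lemma smooth_superposition : [/\ smooth S, smooth D & smooth N] /\ (smooth e2 /\ smooth e3).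
Proof.
have [[s0 sQ _] _ _ _] := A_flat; have i1 := smooth_iv1.
have z : smooth (fun _ : M => 0 : R) := smooth_cst (0 : R).
have o : smooth (fun _ : M => 1 : R) := smooth_cst (1 : R).
split; [split|split].
- have -> : S = (fun q => fpoint A q + fmat A q *m col4 0 0 0 (lam * r q * (v q k1 0)^-1)).
    by apply/funext => q; exact: superposition_congruenceE.
  apply: smoothD => //; apply: smooth_mulmx => //; apply: smooth_col4 => //.
  by apply: smoothM => //; exact: smoothMl.
- have -> : D = (fun q => fmat A q *m col4 (lam^-1 * v q k1 0) (v q k2 0)
    (v q k3 0) (lam * v q k4 0)) by apply/funext => q; exact: superposition_directionE.
  apply: smooth_mulmx => //; apply: smooth_col4; try exact: smooth_v.
    by apply: smoothMl; exact: smooth_v.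
  by apply: smoothMl; exact: smooth_v.
- by apply: smooth_mulmx => //; apply: smooth_col4 => //; exact: smoothMl.
- apply: smooth_mulmx => //; apply: smooth_col4 => //; apply: smoothM => //.
  by apply: smoothMl; exact: smooth_v.
- apply: smooth_mulmx => //; apply: smooth_col4 => //; apply: smoothM => //.
  by apply: smoothMl; exact: smooth_v.
Qed.

(** The equation for dr makes the a_4-component the one of a combination of [e2] and [e3]. The
    factor 1 gives the differential the same shape as those of [D] and [N]. *)
Lemma dmap_superposition_congruence c p w : atlas c -> dom c p ->
  dmap c S p w = 1 *:
    ((alpha0 A c p w k2 0 + lam * r p / v p k1 0 * alpha' A c p w k1 k2) *: e2 p +
     (alpha0 A c p w k3 0 + lam * r p / v p k1 0 * alpha' A c p w k1 k3) *: e3 p).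
Proof.
move=> ac cp; have [[s0 sQ _] _ _ _] := A_flat.
have sk : smooth (fun q => lam * r q * (v q k1 0)^-1).
  by apply: smoothM; [exact: smoothMl|exact: smooth_iv1].
have -> : S = (fun q => fpoint A q + fmat A q *m col4 0 0 0 (lam * r q * (v q k1 0)^-1)).
  by apply/funext => q; exact: superposition_congruenceE.
have sc : smooth (fun q => fmat A q *m col4 0 0 0 (lam * r q * (v q k1 0)^-1)).
  by apply: smooth_mulmx => //; apply: smooth_col4 => //; exact: smooth_cst.
apply: etrans (dmapD ac cp w s0 sc) _.
apply: etrans (congr2 (fun X Y : 'cV[R]_4 => X + Y) (dmap_fpoint A_flat c p w)
  (dmap_frame A_flat w ac cp (smooth_cst 0) (smooth_cst 0) (smooth_cst 0) sk)) _.
have [h1 h2 h3 h4] := dv_entries w ac cp.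
rewrite (dmapM ac cp w (smoothMl lam sr) smooth_iv1) (dmapMl lam w sr ac cp) (dr w ac cp).
rewrite (dmapV ac cp w v1 (smooth_v k1)) h1 !dmap_cst (alpha0_entries A_flat w ac cp) -mulmxDr.
rewrite /e2 /e3 /superposition_e2 /superposition_e3 fmat_combination !col4Z !col4D col4Z.
congr (_ *m _); move: (v1 p).
move: (alpha' A c p w) (alpha0 A c p w) (v p) (r p) => X x y r'.
have [_ -> -> _] := col4_entries 0 (x k2 0) (x k3 0) 0.
move: (y k1 0) (y k2 0) (y k3 0) (y k4 0) => y1 y2 y3 y4.
move: (X k1 k2) (X k1 k3) (X k2 k1) (X k3 k1) (X k3 k2) (x k2 0) (x k3 0) => a b d e f g h y0.
by congr col4; field; rewrite ?y0.
Qed.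

(** The components of dD and dN are alpha^j_1 and alpha^1_j up to one factor each, so flatness is
    that of [A] times the product of the factors; [D] is null because [v] lies on the light cone. *)
Lemma superposition_null_frame : null_frame S D N e2 e3.
Proof.
have [s s'] := smooth_superposition.
have iso := fmat_isometry A_flat.
have on p : [/\ mink (e2 p) (e2 p) = 1, mink (e3 p) (e3 p) = 1 & mink (e2 p) (e3 p) = 0].
  by rewrite /e2 /e3 !iso !mink_col4; split; ring.
have D_e p : mink (D p) (e2 p) = 0 /\ mink (D p) (e3 p) = 0.
  rewrite superposition_directionE /e2 /e3 !iso !mink_col4; move: lam0 (v1 p).
  move: (v p k1 0) (v p k2 0) (v p k3 0) (v p k4 0) => y1 y2 y3 y4 l0 y0.
  by split; field; rewrite ?l0 ?y0.
have N_e p : mink (N p) (e2 p) = 0 /\ mink (N p) (e3 p) = 0.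
  by rewrite /N /e2 /e3 !iso !mink_col4; split; ring.
have tan (k a b : R) p : exists a' b' : R, k *: (a *: e2 p + b *: e3 p) = a' *: e2 p + b' *: e3 p.
  by exists (k * a), (k * b); rewrite scalerDr !scalerA.
split=> //.
- move=> p; rewrite superposition_directionE /N !iso !mink_col4; have h := v_null p.
  move: lam0 (v1 p) h.
  move: (v p k1 0) (v p k2 0) (v p k3 0) (v p k4 0) => y1 y2 y3 y4 l0 y0 h.
  split; [|ring|by field; rewrite ?l0 ?y0].
  transitivity (y2 ^+ 2 + y3 ^+ 2 - 2 * y1 * y4); first by field.
  by rewrite h subrr.
- move=> c p w ac cp; rewrite (dmap_superposition_direction w ac cp).
  by rewrite (dmap_superposition_normal w ac cp) (dmap_superposition_congruence w ac cp); split.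
- move=> c p ac cp y z.
  have comp (k a b : R) (q := k *: (a *: e2 p + b *: e3 p)) : mink q (e2 p) = k * a /\ mink q (e3 p) = k * b.
    rewrite /q; have [h2 h3 h23] := on p; rewrite !minkZl !minkDl !minkZl h2 h3 h23 (minkC (e3 p)) h23.
    by split; ring.
  have zE w := dmap_superposition_normal w ac cp.
  have yE w := dmap_superposition_direction w ac cp.
  have y2 w : y e2 w = (lam^-1 - 1) * v p k1 0 * alpha' A c p w k2 k1.
    by rewrite /y (yE w) (comp _ _ _).1.
  have y3 w : y e3 w = (lam^-1 - 1) * v p k1 0 * alpha' A c p w k3 k1.
    by rewrite /y (yE w) (comp _ _ _).2.
  have z2 w : z e2 w = lam / v p k1 0 * alpha' A c p w k1 k2.
    by rewrite /z (zE w) (comp _ _ _).1.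
  have z3 w : z e3 w = lam / v p k1 0 * alpha' A c p w k1 k3.
    by rewrite /z (zE w) (comp _ _ _).2.
  have [_ _ _ h] := A_flat; have [f1 f2] := h c p ac cp.
  move: f1 f2; rewrite !wedgeE /= (y2 ux) (y2 uy) (y3 ux) (y3 uy) (z2 ux) (z2 uy) (z3 ux) (z3 uy).
  move: (alpha' A c p ux) (alpha' A c p uy) => X Y f1 f2; move: ((lam^-1 - 1) * _) (lam / _) => k l.
  by split; [rewrite -(mulr0 (k * l)) -f1; ring|rewrite -(mulr0 (k * l)) -f2; ring].
Qed.

End Superposition.

(** * The inverse gauge change *)

Section InverseGauge.
Context {R : realType} {M : orientedSurface R}.
Implicit Types (c : chart R M) (p : M) (w : 'rV[R]_2).

Lemma fvec_col4 (A : framing M) p :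
  [/\ fvec A k1 p = fmat A p *m col4 1 0 0 0, fvec A k2 p = fmat A p *m col4 0 1 0 0,
      fvec A k3 p = fmat A p *m col4 0 0 1 0 & fvec A k4 p = fmat A p *m col4 0 0 0 1].
Proof. by split; rewrite fmat_col4 !scale1r !scale0r ?add0r ?addr0. Qed.

Section Alpha.
Variables (A : framing M).
Hypothesis A_flat : curved_flat A.

Lemma dmap_fvec j c p w : atlas c -> dom c p ->
  dmap c (fvec A j) p w = fmat A p *m col j (alpha' A c p w).
Proof.
move=> ac cp; have [[_ sQ _] _ _ _] := A_flat.
apply: etrans (dmap_col ac cp w j sQ) _.
apply: etrans (congr1 (fun X : 'M[R]_4 => col j X) (dmap_fmat A_flat c p w)) _.
by rewrite !colE mulmxA.
Qed.

Lemma mink_dmap_fvec j c p w : atlas c -> dom c p ->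
  mink (dmap c (fvec A j) p w) (fvec A k2 p) = alpha' A c p w k2 j /\
  mink (dmap c (fvec A j) p w) (fvec A k3 p) = alpha' A c p w k3 j.
Proof.
move=> ac cp; have E := dmap_fvec j w ac cp.
have [_ h2 h3 _] := mink_delta (col j (alpha' A c p w)).
split; apply: etrans (congr1 (fun t => mink t _) E) _; rewrite fvecE fmat_isometry //.
  by rewrite h2 mxE.
by rewrite h3 mxE.
Qed.

Lemma alpha0_mink c p w : atlas c -> dom c p ->
  mink (dmap c (fpoint A) p w) (fvec A k2 p) = alpha0 A c p w k2 0 /\
  mink (dmap c (fpoint A) p w) (fvec A k3 p) = alpha0 A c p w k3 0.
Proof.
move=> ac cp; have [_ h2 h3 _] := mink_delta (alpha0 A c p w).
by rewrite !(dmap_fpoint A_flat) !fvecE !(fmat_isometry A_flat) h2 h3.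
Qed.

(** All other entries of the j-th column of alpha' vanish anyway, so da_j would vanish on [w], and
    with it III. This is the source of all nondegeneracy below. *)
Lemma posdef_fvec j (F : M -> contact R) c p w : j = k1 \/ j = k4 ->
  (forall p, is_contact (F p) (fpoint A p) (fvec A j p)) -> III_posdef F ->
  atlas c -> dom c p -> w != 0 ->
  alpha' A c p w k2 j = 0 -> alpha' A c p w k3 j = 0 -> False.
Proof.
move=> hj hF pF ac cp w0 h2 h3.
have [[_ sQ _] _ _ _] := A_flat.
have sN : smooth (fvec A j).
  have -> : fvec A j = (fun q => fmat A q *m delta_mx j 0) by apply/funext => q; exact: fvecE.
  by apply: smooth_mulmx => //; exact: smooth_cst.
have null q : mink (fvec A j q) (fvec A j q) = 0.
  rewrite fvecE fmat_isometry //; have [d1 d2 d3 d4] := mink_delta (delta_mx j 0 : 'cV[R]_4).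
  by case: hj d1 d4 => -> d1 d4; [rewrite d1|rewrite d4]; rewrite mxE oppr0.
have E := dmap_fvec j w ac cp.
have [[h41 h14] _ [h11 h44] _ _] := alpha'_entries A_flat w ac cp.
have z : col j (alpha' A c p w) = 0.
  move: h2 h3 h41 h14 h11 h44; move: (alpha' A c p w) => X h2 h3 h41 h14 h11 h44.
  apply/colP; elim/forall_ord4; rewrite !mxE //.
    by case: hj => ->; rewrite ?h11 ?h14.
  by case: hj => ->; rewrite ?h41 ?h44.
have := pF c p w ac cp w0.
rewrite (envelope_III sN null hF ac cp w w) E z mulmx0 mink0l mul0r ltxx //.
Qed.

End Alpha.

Variables (A B : framing M) (lam : R) (v : M -> 'cV[R]_4) (r : M -> R).
Hypotheses (A_flat : curved_flat A) (B_flat : curved_flat B).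
Hypothesis AB : gauge_related A B lam v r.
Hypothesis v1 : forall p, v p k1 0 != 0.

Let sv : smooth v. Proof. by case: AB => -[]. Qed.
Let sr : smooth r. Proof. by case: AB => -[]. Qed.
Let v_cone p : lightcone (v p). Proof. by case: AB. Qed.
Let dv : for_all_tangent (fun c p w =>
  dmap c v p w = - (alpha'_lam lam (alpha' A c p w) *m v p)).
Proof. by case: AB. Qed.
Let dr : for_all_tangent (fun c p w =>
  dmap c r p w = v p k2 0 * alpha0 A c p w k2 0 + v p k3 0 * alpha0 A c p w k3 0).
Proof. by case: AB. Qed.

(** The inverse of 0 is 0, so v^4 = 0 would give b_1 = 0, impossible for a column of an invertible
    matrix. *)
Lemma gauge_v4_neq0 p : v p k4 0 != 0.
Proof.
case: AB => _ _ _ _ /(_ p)[_ h _ _ _]; apply/eqP => v40.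
move: h; rewrite v40 invr0 scale0r fvecE => h.
have := fmat_inj B_flat (etrans h (esym (mulmx0 _ _))).
by move=> /colP /(_ k1); rewrite !mxE /= => /eqP; rewrite oner_eq0.
Qed.

Let v4 := gauge_v4_neq0.
Let sv' i : smooth (fun q => v q i 0). Proof. exact: smooth_entry. Qed.
Let si4 : smooth (fun q => (v q k4 0)^-1). Proof. exact: smoothV. Qed.

Lemma gauge_fvec p :
  [/\ fvec B k1 p = fmat A p *m col4 (v p k4 0)^-1 0 0 0,
      fvec B k2 p = fmat A p *m col4 (v p k2 0 * (v p k4 0)^-1) 1 0 0,
      fvec B k3 p = fmat A p *m col4 (v p k3 0 * (v p k4 0)^-1) 0 1 0,
      fvec B k4 p = fmat A p *m col4 (v p k1 0) (v p k2 0) (v p k3 0) (v p k4 0) &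
      fpoint B p = fpoint A p + fmat A p *m col4 (r p * (v p k4 0)^-1) 0 0 0].
Proof.
case: AB => _ _ _ _ /(_ p)[h0 h1 h2 h3 h4].
rewrite !fmat_col4 !scale0r !scale1r !addr0 h0 h1 h2 h3 h4 sum_ord4; split=> //; exact: addrC.
Qed.

Section At.
Variables (c : chart R M) (p : M) (w : 'rV[R]_2).
Hypotheses (ac : atlas c) (cp : dom c p).

(** As b_4 = a v, db_4 = a (alpha' - alpha'_lambda) v, whence the factor 1 - lambda; the other
    entries come from the derivatives of b_1 and b_2. *)
Lemma gauge_alpha' (X := alpha' A c p w) (Y := alpha' B c p w) (y := v p) :
  [/\ Y k2 k1 = X k2 k1 / y k4 0, Y k3 k1 = X k3 k1 / y k4 0,
      Y k1 k2 = (1 - lam) * X k1 k2 * y k4 0, Y k1 k3 = (1 - lam) * X k1 k3 * y k4 0 &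
      Y k3 k2 = X k3 k2 + (y k2 0 * X k3 k1 - y k3 0 * X k2 k1) / y k4 0].
Proof.
have [_ _ _ [_ _ e24 e34] _] := alpha'_entries B_flat w ac cp.
have [b1 b2 b3 b4 _] := gauge_fvec p.
have iso := fmat_isometry A_flat p.
have [h1 h2 h3 h4] := dv_entries sv dv w ac cp.
have z : smooth (fun _ : M => 0 : R) := smooth_cst (0 : R).
have o : smooth (fun _ : M => 1 : R) := smooth_cst (1 : R).
have B1 : fvec B k1 = (fun q => fmat A q *m col4 (v q k4 0)^-1 0 0 0).
  by apply/funext => q; have [] := gauge_fvec q.
have B2 : fvec B k2 = (fun q => fmat A q *m col4 (v q k2 0 * (v q k4 0)^-1) 1 0 0).
  by apply/funext => q; have [] := gauge_fvec q.
have B4 : fvec B k4 = (fun q => fmat A q *m col4 (v q k1 0) (v q k2 0) (v q k3 0) (v q k4 0)).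
  by apply/funext => q; have [] := gauge_fvec q.
have D1 := dmap_frame A_flat w ac cp si4 z z z.
have D2 := dmap_frame A_flat w ac cp (smoothM (sv' k2) si4) o z z.
have D4 := dmap_frame A_flat w ac cp (sv' k1) (sv' k2) (sv' k3) (sv' k4).
rewrite h1 h2 h3 h4 in D4.
rewrite !dmap_cst in D1; rewrite !dmap_cst in D2.
rewrite -B1 in D1; rewrite -B2 in D2; rewrite -B4 in D4.
have [m21 m31] := mink_dmap_fvec B_flat k1 w ac cp.
have [_ m32] := mink_dmap_fvec B_flat k2 w ac cp.
have [m24 m34] := mink_dmap_fvec B_flat k4 w ac cp.
rewrite D1 b2 iso mink_col4 in m21; rewrite D1 b3 iso mink_col4 in m31.
rewrite D2 b3 iso mink_col4 in m32; rewrite D4 b2 iso mink_col4 in m24.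
rewrite D4 b3 iso mink_col4 in m34.
have {e24}m12 := etrans m24 e24; have {e34}m13 := etrans m34 e34.
have n4 := v4 p.
split; [apply: etrans (esym m21) _|apply: etrans (esym m31) _|apply: etrans (esym m12) _
  |apply: etrans (esym m13) _|apply: etrans (esym m32) _].
all: move: n4; rewrite /y; move: (v p) => z' {D1 D2 D4 m21 m31 m12 m13 m24 m34 m32 h1 h2 h3 h4}.
all: move: (z' k1 0) (z' k2 0) (z' k3 0) (z' k4 0) => y1 y2 y3 y4.
all: rewrite /X; move: (alpha' A c p w) => Z.
all: move: (Z k1 k2) (Z k1 k3) (Z k2 k1) (Z k3 k1) (Z k3 k2) => a b d e f y0.
all: rewrite ?(mul0r, mulr0, add0r, addr0, subr0, mulr1, mul1r, oppr0).
all: try move: (dmap _ _ _ _) => t.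
all: by field; rewrite ?y0.
Qed.

Lemma gauge_alpha0 (X := alpha' A c p w) (x := alpha0 A c p w) (y := v p) :
  alpha0 B c p w k2 0 = x k2 0 + r p / y k4 0 * X k2 k1 /\
  alpha0 B c p w k3 0 = x k3 0 + r p / y k4 0 * X k3 k1.
Proof.
have [_ b2 b3 _ _] := gauge_fvec p; have iso := fmat_isometry A_flat p.
have [[s0 sQ _] _ _ _] := A_flat.
have z : smooth (fun _ : M => 0 : R) := smooth_cst (0 : R).
have sk := smoothM sr si4.
have B0 : fpoint B = (fun q => fpoint A q + fmat A q *m col4 (r q * (v q k4 0)^-1) 0 0 0).
  by apply/funext => q; have [] := gauge_fvec q.
have sc := smooth_mulmx sQ (smooth_col4 sk z z z).
have D : dmap c (fpoint B) p w = fmat A p *m (alpha0 A c p w + col4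
    (dmap c (fun q => r q * (v q k4 0)^-1) p w + (X k1 k2 * 0 + X k1 k3 * 0))
    (0 + (X k2 k1 * (r p * (y k4 0)^-1) - X k3 k2 * 0 + X k1 k2 * 0))
    (0 + (X k3 k1 * (r p * (y k4 0)^-1) + X k3 k2 * 0 + X k1 k3 * 0))
    (0 + (X k2 k1 * 0 + X k3 k1 * 0))).
  rewrite B0; apply: etrans (dmapD ac cp w s0 sc) _.
  apply: etrans (congr2 (fun X Y : 'cV[R]_4 => X + Y) (dmap_fpoint A_flat c p w)
    (dmap_frame A_flat w ac cp sk z z z)) _.
  by rewrite !dmap_cst -mulmxDr.
have [m2 m3] := alpha0_mink B_flat w ac cp.
rewrite D (alpha0_entries A_flat w ac cp) col4D b2 iso mink_col4 in m2.
rewrite D (alpha0_entries A_flat w ac cp) col4D b3 iso mink_col4 in m3.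
split; [apply: etrans (esym m2) _|apply: etrans (esym m3) _].
all: rewrite /x /X /y {D m2 m3}; move: (alpha0 A c p w) (alpha' A c p w) (v p) => x' X' y'.
all: move: (dmap _ _ _ _) => t; ring.
Qed.

End At.

(** Solving the gauge relations for the a_j forces v'^4 = 1/v^4 and v'^j / v'^4 = - v^j for j = 2,
    3; the light cone equation then gives v'^1 = v^1. *)
Definition inverse_v p : 'cV[R]_4 :=
  col4 (v p k1 0) (- (v p k2 0 * (v p k4 0)^-1)) (- (v p k3 0 * (v p k4 0)^-1)) (v p k4 0)^-1.

Definition inverse_r p : R := - (r p * (v p k4 0)^-1).

(** On the light cone 2 v^1 v^4 is a sum of squares, so v^1 and v^4 have the same sign, and their
    sum is positive. This places [inverse_v] on the same half of the cone. *)
Lemma gauge_v_gt0 p : 0 < v p k1 0 /\ 0 < v p k4 0.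
Proof.
have [_ _ pos] := v_cone p; have h := v_null v_cone p.
have n1 := v1 p; have n4 := v4 p.
have : 0 < v p k1 0 * v p k4 0.
  rewrite lt_def mulf_neq0 //=; have : 0 <= v p k2 0 ^+ 2 + v p k3 0 ^+ 2 by rewrite addr_ge0 ?sqr_ge0.
  by rewrite h -mulrA pmulr_rge0.
move: pos n1 n4; move: (v p k1 0) (v p k4 0) => a b pos n1 n4 ab.
have [a0|a0|a0] := ltgtP 0 a; last by rewrite -a0 eqxx in n1.
  by split=> //; move: ab; rewrite pmulr_rgt0.
have b0 : b < 0 by move: ab; rewrite nmulr_rgt0.
lra.
Qed.

(** The relation between the constants is what dv'^1 = dv^1 demands. It is quantified over points of
    [M] so that it can be met on the empty surface, where [lam] may be 1. *)
Lemma gauge_inverse (lam' : R) : (forall p : M, lam' * (1 - lam) = - lam) ->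
  gauge_related B A lam' inverse_v inverse_r.
Proof.
move=> lamE.
have svr := smoothM sr si4; have sv2 := smoothM (sv' k2) si4; have sv3 := smoothM (sv' k3) si4.
split.
- by split; [apply: smooth_col4 => //; exact: smoothN|exact: smoothN].
- move=> p; have [p1 p4] := gauge_v_gt0 p; have h := v_null v_cone p; have n4 := v4 p.
  have [i1 i2 i3 i4] := col4_entries (v p k1 0) (- (v p k2 0 * (v p k4 0)^-1))
    (- (v p k3 0 * (v p k4 0)^-1)) (v p k4 0)^-1.
  split.
  + apply/eqP => /colP /(_ k4); rewrite i4 mxE => /eqP; rewrite invr_eq0.
    by apply/negP.
  + rewrite /inverse_v mink_col4; move: h n4.
    move: (v p k1 0) (v p k2 0) (v p k3 0) (v p k4 0) => y1 y2 y3 y4 h n4.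
    transitivity ((y2 ^+ 2 + y3 ^+ 2 - 2 * y1 * y4) / y4 ^+ 2); first by field.
    by rewrite h subrr mul0r.
  + by rewrite i1 i4 addr_gt0 // invr_gt0.
- move=> c p w ac cp.
  apply: etrans (dmap_col4 w (sv' k1) (smoothN sv2) (smoothN sv3) si4 ac cp) _.
  have [h1 h2 h3 h4] := dv_entries sv dv w ac cp.
  rewrite (dmapN ac cp w sv2) (dmapN ac cp w sv3) (dmapM ac cp w (sv' k2) si4).
  rewrite (dmapM ac cp w (sv' k3) si4) (dmapV ac cp w v4 (sv' k4)) h1 h2 h3 h4.
  rewrite [RHS]col4E.
  have ent (Z : 'cV[R]_4) i : (- Z) i 0 = - Z i 0 by rewrite mxE.
  rewrite !ent; have lE := lamE p; have h := v_null v_cone p; have n4 := v4 p; move: lE h n4.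
  move: (gauge_alpha' w ac cp); rewrite /inverse_v {h1 h2 h3 h4}.
  move: (alpha' B c p w) (alpha' A c p w) (v p) => Y X y [g21 g31 g12 g13 g32].
  have [-> -> -> ->] := alpha'_lam_mul lam' Y (col4 (y k1 0) (- (y k2 0 * (y k4 0)^-1))
    (- (y k3 0 * (y k4 0)^-1)) (y k4 0)^-1).
  have [-> -> -> ->] := col4_entries (y k1 0) (- (y k2 0 * (y k4 0)^-1))
    (- (y k3 0 * (y k4 0)^-1)) (y k4 0)^-1.
  rewrite g21 g31 g12 g13 g32; move: (y k1 0) (y k2 0) (y k3 0) (y k4 0) => y1 y2 y3 y4.
  move: (X k1 k2) (X k1 k3) (X k2 k1) (X k3 k1) (X k3 k2) => a b d e f lE h n4.
  congr col4.
  + have -> : - (lam' * ((1 - lam) * a * y4 * - (y2 / y4) + (1 - lam) * b * y4 * - (y3 / y4))) =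
      lam' * (1 - lam) * (a * y2 + b * y3) by field.
    by rewrite lE; ring.
  + have -> : - (d / y4 * y1 - (f + (y2 * e - y3 * d) / y4) * - (y3 / y4) +
       lam' * ((1 - lam) * a * y4) / y4) =
       - (d / y4 * y1 - (f + (y2 * e - y3 * d) / y4) * - (y3 / y4) +
       lam' * (1 - lam) * a) by field.
    (* The light cone equation supplies the squares of v^2 and v^3 that come from dv^4 and from the
       change of alpha^3_2. *)
    have -> : d / y4 * y1 = d * (y2 ^+ 2 + y3 ^+ 2 - y1 * y4) / y4 ^+ 2 by rewrite h; field.
    by rewrite lE; field.
  + have -> : - (e / y4 * y1 + (f + (y2 * e - y3 * d) / y4) * - (y2 / y4) +
       lam' * ((1 - lam) * b * y4) / y4) =
       - (e / y4 * y1 + (f + (y2 * e - y3 * d) / y4) * - (y2 / y4) +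
       lam' * (1 - lam) * b) by field.
    have -> : e / y4 * y1 = e * (y2 ^+ 2 + y3 ^+ 2 - y1 * y4) / y4 ^+ 2 by rewrite h; field.
    by rewrite lE; field.
  + by field.
- move=> c p w ac cp.
  rewrite /inverse_r (dmapN ac cp w svr) (dmapM ac cp w sr si4) (dr w ac cp).
  rewrite (dmapV ac cp w v4 (sv' k4)).
  have [_ _ _ h4] := dv_entries sv dv w ac cp; rewrite h4.
  move: (gauge_alpha0 w ac cp); move: (alpha0 B c p w) => xB [-> ->].
  have [_ i2 i3 _] := col4_entries (v p k1 0) (- (v p k2 0 * (v p k4 0)^-1))
    (- (v p k3 0 * (v p k4 0)^-1)) (v p k4 0)^-1.
  rewrite i2 i3; have n4 := v4 p; move: n4.
  move: (alpha' A c p w) (alpha0 A c p w) (v p) (r p) => X x y r'.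
  move: (y k1 0) (y k2 0) (y k3 0) (y k4 0) => y1 y2 y3 y4.
  move: (X k2 k1) (X k3 k1) (x k2 0) (x k3 0) => a b d e n4.
  by field.
- move=> p /=; have n4 := v4 p; have h := v_null v_cone p.
  have [b1 b2 b3 b4 b0] := gauge_fvec p.
  have [i1 i2 i3 i4] := col4_entries (v p k1 0) (- (v p k2 0 * (v p k4 0)^-1))
    (- (v p k3 0 * (v p k4 0)^-1)) (v p k4 0)^-1.
  have [a1 a2 a3 a4] := fvec_col4 A p.
  rewrite sum_ord4 i1 i2 i3 i4 b0 b1 b2 b3 b4 a1 a2 a3 a4 /inverse_r !invrK !scalemxAr.
  rewrite -!addrA -!mulmxDr !addrA !col4Z !col4D; move: n4 h.
  move: (v p k1 0) (v p k2 0) (v p k3 0) (v p k4 0) (r p) => y1 y2 y3 y4 r' n4 h.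
  split.
  + rewrite -[LHS]addr0; congr (_ + _); rewrite -[LHS](mulmx0 _ (fmat A p)); congr (_ *m _).
    by rewrite [LHS]col4E !mxE; congr col4; field.
  + by congr (_ *m col4 _ _ _ _); field.
  + by congr (_ *m col4 _ _ _ _); field.
  + by congr (_ *m col4 _ _ _ _); field.
  + congr (_ *m col4 _ _ _ _); try by field.
    transitivity (- (y2 ^+ 2 + y3 ^+ 2 - 2 * y1 * y4) / y4 ^+ 2); last by field.
    by rewrite h subrr oppr0 mul0r.
Qed.

End InverseGauge.

(** * The envelopes of the superposition congruence *)

Section SuperpositionEnvelope.
Context {R : realType} {M : orientedSurface R}.
Implicit Types (c : chart R M) (p : M) (w : 'rV[R]_2).

(** For lambda = 1 the entries alpha^1_2 and alpha^1_3 of [B] vanish, so b_4 is constant and III of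
    the second envelope is zero. The argument of type [M] provides the point at which this is a
    contradiction. *)
Lemma gauge_lam_neq1 (A B : framing M) (lam : R) v r (F : M -> contact R) :
  curved_flat A -> curved_flat B -> gauge_related A B lam v r ->
  second_envelope B F -> III_posdef F -> M -> lam != 1.
Proof.
move=> hA hB AB hF pF p; apply/eqP => l1.
have [c ac cp] := atlas_cover p.
have [_ _ g12 g13 _] := gauge_alpha' hA hB AB ux ac cp.
have [_ _ _ [_ _ e24 e34] _] := alpha'_entries hB ux ac cp.
have l0 : 1 - lam = 0 by rewrite l1 subrr.
have z12 := etrans e24 (etrans g12 (congr1 (fun t => t * _ * _) l0)).
have z13 := etrans e34 (etrans g13 (congr1 (fun t => t * _ * _) l0)).
apply: (posdef_fvec hB (or_intror erefl) hF pF ac cp (ux_neq0 (R := R))).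
  by apply: etrans z12 _; rewrite !mul0r.
by apply: etrans z13 _; rewrite !mul0r.
Qed.

Variables (A : framing M) (lam : R) (v : M -> 'cV[R]_4) (r : M -> R).
Variables (B : framing M) (F F1 Fs : M -> contact R).
Hypothesis A_flat : curved_flat A.
Hypothesis AB : gauge_related A B lam v r.
Hypotheses (lam0 : lam != 0) (lam1 : M -> lam != 1) (v1 : forall p, v p k1 0 != 0).
Hypotheses (F_first : first_envelope A F) (F1_second : second_envelope A F1).
Hypotheses (F_posdef : III_posdef F) (F1_posdef : III_posdef F1).
Let S := superposition_congruence A lam v r.
Let D := superposition_direction A lam v.
Let N := superposition_normal A lam v.
Let e2 := superposition_e2 A lam v.
Let e3 := superposition_e3 A lam v.
Hypothesis Fs_contact : forall p, is_contact (Fs p) (S p) (D p).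

Lemma gauge_null_frame : null_frame S D N e2 e3.
Proof.
by case: AB => -[sv sr] vc dv dr _; exact: superposition_null_frame.
Qed.

Let nf := gauge_null_frame.

Lemma superposition_second p : is_contact (F1 p) (S p) (N p).
Proof.
have l0 : lam / v p k1 0 != 0 by rewrite mulf_neq0 ?invr_eq0.
apply: (is_contact_change (t := lam * r p / v p k1 0) l0 _ _ (F1_second p)) => //.
by rewrite /N /superposition_normal fmat_col4 !scale0r !add0r.
Qed.

Lemma frame_det_neq0 (f : M -> 'cV[R]_4) c p : smooth f -> atlas c -> dom c p ->
  (forall w, w != 0 -> mink (dmap c f p w) (e2 p) = 0 -> mink (dmap c f p w) (e3 p) = 0 -> False) ->
  frame_det f e2 e3 c p != 0.
Proof.
move=> sf ac cp h; apply/eqP => d0; apply: (dependent_det0 d0) => s t h2 h3.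
have E2 := xi_bvec e2 (vec2 s t) sf ac cp; have E3 := xi_bvec e3 (vec2 s t) sf ac cp.
rewrite cx_vec2 cy_vec2 in E2; rewrite cx_vec2 cy_vec2 in E3.
have z : vec2 s t = 0.
  apply/eqP; rewrite -[_ == _]negbK; apply/negP => w0.
  exact: (h _ w0 (etrans E2 h2) (etrans E3 h3)).
by rewrite -(cx_vec2 s t) -[X in _ /\ X = 0](cy_vec2 s t) z cx0 cy0.
Qed.

Lemma frame_component (u : 'cV[R]_4) (k a b : R) p : k != 0 ->
  u = k *: (a *: e2 p + b *: e3 p) ->
  mink u (e2 p) = 0 -> mink u (e3 p) = 0 -> a = 0 /\ b = 0.
Proof.
move=> k0 ->; have [h2 h3 h23] := nf_orthonormal nf p.
rewrite !minkZl !minkDl !minkZl h2 h3 h23 (minkC (e3 p)) h23 !mulr0 !mulr1 addr0 add0r.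
by move=> /eqP; rewrite mulf_eq0 (negPf k0) => /eqP -> /eqP; rewrite mulf_eq0 (negPf k0) => /eqP ->.
Qed.

Lemma superposition_det1 c p : atlas c -> dom c p -> frame_det D e2 e3 c p != 0.
Proof.
move=> ac cp; have [_ sD _] := nf_smooth nf; apply: (frame_det_neq0 sD ac cp) => w w0 h2 h3.
have E : dmap c D p w = ((lam^-1 - 1) * v p k1 0) *:
    (alpha' A c p w k2 k1 *: e2 p + alpha' A c p w k3 k1 *: e3 p).
  by case: AB => -[sv sr] vc dv dr _; exact: dmap_superposition_direction.
have k0 : (lam^-1 - 1) * v p k1 0 != 0.
  rewrite mulf_neq0 // subr_eq0; apply: contra_neq (lam1 p) => l.
  by rewrite -[lam]invrK l invr1.
have [a0 b0] := frame_component k0 E h2 h3.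
exact: (posdef_fvec A_flat (or_introl erefl) F_first F_posdef ac cp w0 a0 b0).
Qed.

Lemma superposition_det2 c p : atlas c -> dom c p -> frame_det N e2 e3 c p != 0.
Proof.
move=> ac cp; have [_ _ sN] := nf_smooth nf; apply: (frame_det_neq0 sN ac cp) => w w0 h2 h3.
have E : dmap c N p w = (lam / v p k1 0) *:
    (alpha' A c p w k1 k2 *: e2 p + alpha' A c p w k1 k3 *: e3 p).
  by case: AB => -[sv sr] vc dv dr _; exact: dmap_superposition_normal.
have k0 : lam / v p k1 0 != 0 by rewrite mulf_neq0 ?invr_eq0.
have [a0 b0] := frame_component k0 E h2 h3.
have [_ _ _ [_ _ e24 e34] _] := alpha'_entries A_flat w ac cp.
exact: (posdef_fvec A_flat (or_intror erefl) F1_second F1_posdef ac cp w0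
  (etrans e24 a0) (etrans e34 b0)).
Qed.

Lemma superposition_L_isothermic : L_isothermic_immersion Fs.
Proof.
exact: (envelope_L_isothermic nf Fs_contact superposition_det1 superposition_det2).
Qed.

Lemma superposition_darboux : sphere_congruence S ->
  nondegenerate_darboux_congruence S N D F1 Fs.
Proof.
move=> cS.
exact: (nf_darboux nf Fs_contact superposition_second cS superposition_det1 superposition_det2).
Qed.

End SuperpositionEnvelope.

(** * Commutativity of superposition *)

Section InverseSuperposition.
Context {R : realType} {M : orientedSurface R}.
Variables (A B : framing M) (lam : R) (v : M -> 'cV[R]_4) (r : M -> R).
Hypotheses (A_flat : curved_flat A) (B_flat : curved_flat B).
Hypothesis AB : gauge_related A B lam v r.
Hypotheses (lam0 : lam != 0) (v1 : forall p, v p k1 0 != 0).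
Variable lam' : R.
Hypothesis lamE : forall p : M, lam != 1 /\ lam' = lam / (lam - 1).

(** The factor is read off from the a_2-coefficients, since lambda' - 1 = 1 / (lambda - 1). *)
Lemma inverse_superposition_direction p :
  superposition_direction B lam' (inverse_v v) p =
  ((lam - 1) * v p k4 0)^-1 *: superposition_direction A lam v p.
Proof.
have [l1 ->] := lamE p; have n4 := gauge_v4_neq0 B_flat AB p.
have h : v p k2 0 ^+ 2 + v p k3 0 ^+ 2 = 2 * v p k1 0 * v p k4 0.
  by case: AB => _ vc _ _ _; exact: v_null.
rewrite !superposition_directionE fmat_col4 /inverse_v.
have [-> -> -> ->] := col4_entries (v p k1 0) (- (v p k2 0 * (v p k4 0)^-1))
    (- (v p k3 0 * (v p k4 0)^-1)) (v p k4 0)^-1.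
have [-> -> -> -> _] := gauge_fvec AB p.
rewrite !scalemxAr -!mulmxDr !col4Z !col4D; move: n4 h; rewrite -subr_eq0 in l1.
move: (v p k1 0) (v p k2 0) (v p k3 0) (v p k4 0) => y1 y2 y3 y4 n4 h.
have l := lam0.
congr (_ *m col4 _ _ _ _); try by field; rewrite ?l ?l1 ?n4.
(* The a_1-coefficient is the one that needs the light cone equation. *)
transitivity (((lam - 1) ^+ 2 * y1 * y4 + lam ^+ 2 * y1 * y4
  - lam * (lam - 1) * (y2 ^+ 2 + y3 ^+ 2)) / (lam * (lam - 1) * y4 ^+ 2)).
  by field; rewrite ?l ?l1 ?n4.
by rewrite h; field; rewrite ?l ?l1 ?n4.
Qed.

(** The displacement along the common null line is again found from the a_2-coefficients, to which
    b_4 alone contributes. *)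
Lemma inverse_superposition_congruence p :
  superposition_congruence B lam' (inverse_v v) (inverse_r v r) p =
  superposition_congruence A lam v r p +
  (- (lam * r p / ((lam - 1) * v p k1 0 * v p k4 0))) *: superposition_direction A lam v p.
Proof.
have [l1 ->] := lamE p; have n4 := gauge_v4_neq0 B_flat AB p; have n1 := v1 p.
rewrite superposition_directionE [superposition_congruence A _ _ _ _]superposition_congruenceE
  /superposition_congruence /inverse_r /inverse_v.
have [-> _ _ _] := col4_entries (v p k1 0) (- (v p k2 0 * (v p k4 0)^-1))
    (- (v p k3 0 * (v p k4 0)^-1)) (v p k4 0)^-1.
have [_ _ _ -> ->] := gauge_fvec AB p.
rewrite !scalemxAr -!addrA -!mulmxDr !col4Z !col4D; move: n4 n1; rewrite -subr_eq0 in l1.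
move: (v p k1 0) (v p k2 0) (v p k3 0) (v p k4 0) (r p) => y1 y2 y3 y4 r' n4 n1.
have l := lam0.
by congr (_ + _ *m col4 _ _ _ _); field; rewrite ?l ?l1 ?n4 ?n1.
Qed.

End InverseSuperposition.

Unset Implicit Arguments.

Theorem theorem5 (R : realType) (M : orientedSurface R)
    (F F1 F2 : M -> contact R)
    (F_isothermic : L_isothermic_immersion F)
    (F1_transform : bianchi_darboux_transforms F F1)
    (F2_transform : bianchi_darboux_transforms F F2)
    (A1 A2 : framing M)
    (A1_flat : curved_flat A1) (A2_flat : curved_flat A2)
    (A1_first : first_envelope A1 F) (A1_second : second_envelope A1 F1)
    (A2_first : first_envelope A2 F) (A2_second : second_envelope A2 F2)
    (lam : R) (v : M -> 'cV[R]_4) (r : M -> R)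
    (A12 : gauge_related A1 A2 lam v r)
    (lam_neq0 : lam != 0) (v1_neq0 : forall p, v p k1 0 != 0)
    (congruence12 : sphere_congruence (superposition_congruence A1 lam v r))
    (congruence21 : forall (lam' : R) (v' : M -> 'cV[R]_4) (r' : M -> R),
       gauge_related A2 A1 lam' v' r' ->
       sphere_congruence (superposition_congruence A2 lam' v' r')) :
  exists Fs : M -> contact R,
    [/\ L_isothermic_immersion Fs,
        bianchi_darboux_transforms F1 Fs,
        bianchi_darboux_transforms F2 Fs,
        is_superposition A1 A2 Fs &
        is_superposition A2 A1 Fs].
Proof.
have [legF imF pF _] := F_isothermic.
have [_ iso1 _] := F1_transform; have [_ iso2 _] := F2_transform.
have pF1 : III_posdef F1 by case: iso1.
have pF2 : III_posdef F2 by case: iso2.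
have l1 : M -> lam != 1 := gauge_lam_neq1 A1_flat A2_flat A12 A2_second pF2.
pose S := superposition_congruence A1 lam v r; pose D := superposition_direction A1 lam v.
have nf := gauge_null_frame A1_flat A12 lam_neq0 v1_neq0.
have D0 p : mink (D p) (D p) = 0 by have [] := nf_null nf p.
(* A null vector of time component 0 is zero, which <D, N> = -1 excludes. *)
have tD p : tau (D p) != 0.
  apply/eqP => t0; have [_ _ h] := nf_null nf p.
  move: h; rewrite [superposition_direction _ _ _ _](null_tau_eq0 (D0 p) t0) mink0l => /esym/eqP.
  by rewrite oppr_eq0 oner_eq0.
pose Fs p := contact_of (S p) (D0 p) (tD p).
have Fs_contact p : is_contact (Fs p) (S p) (D p) by exact: contact_ofP.
(* On the empty surface [lam = 1] is possible, and any nonzero constant will do. *)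
pose lam' := if lam == 1 then 1 else lam / (lam - 1).
have lamE (p : M) : lam != 1 /\ lam' = lam / (lam - 1).
  by rewrite /lam' (negPf (l1 p)); split=> //; exact: l1.
have lam'0 : lam' != 0.
  rewrite /lam'; case: ifPn => [_|n1]; first exact: oner_neq0.
  by rewrite mulf_neq0 // invr_eq0 subr_eq0.
have A21 : gauge_related A2 A1 lam' (inverse_v v) (inverse_r v r).
  apply: (gauge_inverse A1_flat A2_flat A12 v1_neq0) => p; have [n1 ->] := lamE p.
  by field; rewrite subr_eq0.
have v1' p : inverse_v v p k1 0 != 0.
  by rewrite /inverse_v; have [-> _ _ _] := col4_entries (v p k1 0) (- (v p k2 0 * (v p k4 0)^-1))
    (- (v p k3 0 * (v p k4 0)^-1)) (v p k4 0)^-1.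
(* With the framings exchanged, [F1] is the second envelope whose third fundamental form is used. *)
have l1' : M -> lam' != 1 := gauge_lam_neq1 A2_flat A1_flat A21 A1_second pF1.
have cS' := congruence21 _ _ _ A21.
have Fs_contact' p : is_contact (Fs p)
    (superposition_congruence A2 lam' (inverse_v v) (inverse_r v r) p)
    (superposition_direction A2 lam' (inverse_v v) p).
  have k0 : ((lam - 1) * v p k4 0)^-1 != 0.
    rewrite invr_eq0 mulf_neq0 ?subr_eq0 ?l1 //; exact: (gauge_v4_neq0 A2_flat A12).
  exact: (is_contact_change k0 (inverse_superposition_direction A2_flat A12 lam_neq0 lamE p)
    (inverse_superposition_congruence A2_flat A12 lam_neq0 v1_neq0 lamE p) (Fs_contact p)).
have isoFs : L_isothermic_immersion Fs.
  exact: (superposition_L_isothermic A1_flat A12 lam_neq0 l1 v1_neq0 A1_first A1_second pF pF1 Fs_contact).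
exists Fs; split=> //.
- split=> //; do 3 eexists.
  exact: (superposition_darboux A1_flat A12 lam_neq0 l1 v1_neq0 A1_first A1_second pF pF1 Fs_contact
    congruence12).
(* The same argument for the reversed gauge change, where [F2] is the second envelope of the initial
   framing. *)
- split=> //; do 3 eexists.
  exact: (superposition_darboux A2_flat A21 lam'0 l1' v1' A2_first A2_second pF pF2 Fs_contact' cS').
- by exists lam, v, r; split.
- by exists lam', (inverse_v v), (inverse_r v r); split.
Qed.
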